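(* Let $T>0$ and assume $F\in C_b^3(W,\mathcal L(U,W))$ and $F_0\in C_b^1(W,W)$. Let $\mathbf X=(X,\mathbb X),\widetilde{\mathbf X}=(\widetilde X,\widetilde{\mathbb X})\in\mathcal D^\alpha([0,T],V)$, $\mathbf Z=(Z,Z')\in\mathcal C^\alpha_{\mathbf X}([0,T],U)$ and $\widetilde{\mathbf Z}=(\widetilde Z,\widetilde Z')\in\mathcal C^\alpha_{\widetilde{\mathbf X}}([0,T],U)$. Then: 1. For each $Y_0\in W$ there exists a unique solution $\mathbf Y\in\mathcal C^\alpha_{\mathbf X}([0,T],W)$, with initial value $Y_0$, of $dY_t=F(Y_t)\,d\mathbf Z_t+F_0(Y_t)\,dt$. 2. Let $\mathbf Y=(Y,Y')\in\mathcal C^\alpha_{\mathbf X}([0,T],W)$ and $\widetilde{\mathbf Y}=(\widetilde Y,\widetilde Y')\in\mathcal C^\alpha_{\widetilde{\mathbf X}}([0,T],W)$ be the solutions driven by $\mathbf Z$ and $\widetilde{\mathbf Z}$ with initial values $Y_0$ and $\widetilde Y_0$, respectively. Then there are a constant $C_\alpha$ (depending on $\alpha$) and a finite nonnegative function $M$ of the indicated arguments (neither depending otherwise on the data) such that $$d_{\mathbf X,\widetilde{\mathbf X};\alpha}(\mathbf Y,\widetilde{\mathbf Y})\le C_\alpha\,M\cdot\Bigl(d_{\mathbf X,\widetilde{\mathbf X};\alpha}(\mathbf Z,\widetilde{\mathbf Z})+\|\mathbf X-\widetilde{\mathbf X}\|_\alpha+\|Y_0-\widetilde Y_0\|+\|Y'_0-\widetilde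 Y'_0\|+\|Z_0-\widetilde Z_0\|+\|Z'_0-\widetilde Z'_0\|\Bigr),$$ where $$M=M\bigl(T,\|F\|_{C_b^3},\|F_0\|_{C_b^1},\|Y_0'\|,\|\widetilde Y_0'\|,\|Z_0'\|,\|\widetilde Z'_0\|,\|\mathbf Y\|_{\mathcal C^\alpha_{\mathbf X}([0,T])},\|\widetilde{\mathbf Y}\|_{\mathcal C^\alpha_{\widetilde{\mathbf X}}([0,T])},\|\mathbf Z\|_{\mathcal C^\alpha_{\mathbf X}([0,T])},\|\widetilde{\mathbf Z}\|_{\mathcal C^\alpha_{\widetilde{\mathbf X}}([0,T])},\|\mathbf X\|_\alpha,\|\widetilde{\mathbf X}\|_\alpha\bigr).$$
   Context: $U,V,W$ are finite-dimensional Banach spaces, $\mathcal L(A,B)$ denotes bounded linear maps, $\alpha\in(1/3,1/2]$, $X_{s,t}:=X_t-X_s$. $C_b^k(A,B)$ is the space of $k$-times continuously differentiable maps with bounded derivatives up to order $k$, with its usual norm. $\mathcal D^\alpha([0,T],V)$: pairs $\mathbf X=(X,\mathbb X)$, $X:[0,T]\to V$ with $\|X\|_\alpha:=\sup_{s\ne t}\|X_{s,t}\|/|t-s|^\alpha<\infty$, $\mathbb X:\{0\le s\le t\le T\}\to V\otimes V$ with $\|\mathbb X\|_{2\alpha}:=\sup_{s<t}\|\mathbb X_{s,t}\|/|t-s|^{2\alpha}<\infty$, and $\mathbb X_{s,t}=\mathbb X_{s,u}+\mathbb X_{u,t}+X_{s,u}\otimes X_{u,t}$. Norm: $\|\mathbf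 X\|_\alpha:=\max\{\|X\|_\alpha,\|\mathbb X\|_{2\alpha}^{1/2}\}$; for two rough paths $\|\mathbf X-\widetilde{\mathbf X}\|_\alpha:=\max\{\|X-\widetilde X\|_\alpha,\|\mathbb X-\widetilde{\mathbb X}\|_{2\alpha}^{1/2}\}$. $\mathcal C^\alpha_{\mathbf X}([0,T],W)$: pairs $\mathbf Y=(Y,Y')$, $Y:[0,T]\to W$, $Y':[0,T]\to\mathcal L(V,W)$, with $\|Y'\|_\alpha<\infty$ and $R^Y_{s,t}:=Y_{s,t}-Y'_sX_{s,t}$ satisfying $\|R^Y\|_{2\alpha}<\infty$. Norm: $\|\mathbf Y\|_{\mathcal C^\alpha_{\mathbf X}([0,T])}:=\max\{\|Y\|_\infty,\|Y'\|_\infty,\|R^Y\|_{2\alpha},\|Y'\|_\alpha\}$. Distance: $d_{\mathbf X,\widetilde{\mathbf X};\alpha}(\mathbf Y,\widetilde{\mathbf Y}):=\|R^Y-R^{\widetilde Y}\|_{2\alpha}+\|Y'-\widetilde Y'\|_\alpha$. A solution of $dY_t=F(Y_t)\,d\mathbf Z_t+F_0(Y_t)\,dt$ with initial value $Y_0$ is $(Y,Y')\in\mathcal C^\alpha_{\mathbf X}([0,T],W)$ with $Y_t=Y_0+\int_0^tF(Y_r)\,d\mathbf Z_r+\int_0^tF_0(Y_r)\,dr$ and $Y'_t=F(Y_t)Z'_t$ for all $t$, where $\int_s^tF(Y_r)\,d\mathbf Z_r:=\lim_{|\mathcal P|\to0}\sum_{[u,v]\in\mathcal P}\bigl(F(Y_u)Z_{u,v}+DF(Y_u)Y'_uZ'_u\mathbb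 X_{u,v}\bigr)$. *)

(* Defs.v *)
(* Stdlib reals and Coquelicot.  Paths on [0,T] are total functions on R: only
   their values on [0,T] enter any definition below, and equality of paths is
   equality on [0,T]. *)
From Stdlib Require Import Reals Lra List.
From Stdlib Require Import FunctionalExtensionality ProofIrrelevance.
From Stdlib Require Import ClassicalEpsilon.
From Coquelicot Require Import Coquelicot.
Open Scope R_scope.

(* [sum_n f n] has the n+1 terms f 0, ..., f n; the zero space is spanned by a
   single zero vector. *)
Definition finite_dim (V : ModuleSpace R_AbsRing) : Prop :=
  exists (n : nat) (e : nat -> V),
    forall v : V, exists c : nat -> R,
      v = sum_n (fun i => scal (c i) (e i)) n.

Notation NormedSpace := (NormedModule R_AbsRing).
Notation BanachSpace := (CompleteNormedModule R_AbsRing).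

(* Coquelicot's [is_linear] includes boundedness. *)
Record lin (A B : NormedSpace) := Lin {
  lin_fun :> A -> B;
  lin_is_linear : is_linear lin_fun }.
Arguments Lin {A B}.
Arguments lin_fun {A B}.
Arguments lin_is_linear {A B}.

Definition op_norm_set {A B : NormedSpace} (l : A -> B) : R -> Prop :=
  fun r => exists x : A, norm x <= 1 /\ r = norm (l x).

(* The set is nonempty and, for bounded [l], bounded above. *)
Definition op_norm {A B : NormedSpace} (l : A -> B) : R :=
  real (Lub_Rbar (op_norm_set l)).

Section LinNormedModule.

Context {A B : NormedSpace}.
Implicit Types l m : lin A B.

Lemma lin_ext l m : (forall x, l x = m x) -> l = m.
Proof.
  destruct l as [f Hf], m as [g Hg]; simpl; intros E.
  assert (f = g) as -> by now apply functional_extensionality.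
  f_equal; apply proof_irrelevance.
Qed.

Lemma is_linear_lin_plus l m : is_linear (fun x => plus (l x) (m x)).
Proof.
  apply (is_linear_comp (fun x => (l x, m x))
           (fun p : B * B => plus (fst p) (snd p))).
  - apply is_linear_prod; apply lin_is_linear.
  - apply is_linear_plus.
Qed.

Lemma is_linear_lin_scal (k : R) l : is_linear (fun x => scal (k : R_AbsRing) (l x)).
Proof.
  apply (is_linear_comp l (fun y : B => scal (k : R_AbsRing) y)).
  - apply lin_is_linear.
  - apply is_linear_scal_r; intros; apply Rmult_comm.
Qed.

Lemma is_linear_lin_opp l : is_linear (fun x => opp (l x)).
Proof.
  apply (is_linear_comp l opp); [apply lin_is_linear | apply is_linear_opp].
Qed.

Definition lin_zero : lin A B := Lin (fun _ => zero) is_linear_zero.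
Definition lin_plus l m : lin A B := Lin _ (is_linear_lin_plus l m).
Definition lin_opp l : lin A B := Lin _ (is_linear_lin_opp l).
Definition lin_scal (k : R) l : lin A B := Lin _ (is_linear_lin_scal k l).

Definition lin_AbelianMonoid_mixin : AbelianMonoid.mixin_of (lin A B).
Proof.
  apply (AbelianMonoid.Mixin _ lin_plus lin_zero); intros; apply lin_ext;
    intros; simpl.
  - apply plus_comm.
  - apply plus_assoc.
  - apply plus_zero_r.
Defined.

Canonical lin_AbelianMonoid : AbelianMonoid :=
  AbelianMonoid.Pack (lin A B) lin_AbelianMonoid_mixin (lin A B).

Definition lin_AbelianGroup_mixin : AbelianGroup.mixin_of lin_AbelianMonoid.
Proof.
  apply (AbelianGroup.Mixin lin_AbelianMonoid lin_opp).
  intros; apply lin_ext; intros; simpl; apply (@plus_opp_r (NormedModule.AbelianGroup _ B)).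
Defined.

Canonical lin_AbelianGroup : AbelianGroup :=
  AbelianGroup.Pack (lin A B)
    (AbelianGroup.Class _ lin_AbelianMonoid_mixin lin_AbelianGroup_mixin)
    (lin A B).

Definition lin_ModuleSpace_mixin :
  ModuleSpace.mixin_of R_AbsRing lin_AbelianGroup.
Proof.
  apply (ModuleSpace.Mixin R_AbsRing lin_AbelianGroup lin_scal);
    intros; apply lin_ext; intros; simpl.
  - apply scal_assoc.
  - apply (scal_one (K := R_AbsRing)).
  - apply (@scal_distr_l R_AbsRing (NormedModule.ModuleSpace _ B)).
  - apply (@scal_distr_r R_AbsRing (NormedModule.ModuleSpace _ B)).
Defined.

Canonical lin_ModuleSpace : ModuleSpace R_AbsRing :=
  ModuleSpace.Pack R_AbsRing (lin A B)
    (ModuleSpace.Class R_AbsRing _ _ lin_ModuleSpace_mixin) (lin A B).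

Lemma op_norm_lub l : is_lub (op_norm_set l) (op_norm l).
Proof.
  destruct (linear_norm _ (lin_is_linear l)) as [M [M0 HM]].
  assert (bdd : forall r, op_norm_set l r -> r <= M).
  { intros r [x [Hx ->]].
    apply Rle_trans with (1 := HM x).
    rewrite <- (Rmult_1_r M) at 2; apply Rmult_le_compat_l; lra. }
  assert (ne : op_norm_set l 0).
  { exists zero; split; [rewrite norm_zero; lra|].
    now rewrite (linear_zero _ (lin_is_linear l)), norm_zero. }
  unfold op_norm.
  destruct (Lub_Rbar_correct (op_norm_set l)) as [ub least].
  assert (le1 := ub 0 ne).
  assert (le2 : Rbar_le (Lub_Rbar (op_norm_set l)) M)
    by (apply least; intros r Hr; exact (bdd r Hr)).
  destruct (Lub_Rbar (op_norm_set l)) as [s | |]; simpl in *; try tauto.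
  split.
  - intros r Hr; exact (ub r Hr).
  - intros b Hb; exact (least (Finite b) (fun r Hr => Hb r Hr)).
Qed.

Lemma op_norm_ge_0 l : 0 <= op_norm l.
Proof.
  apply (proj1 (op_norm_lub l)).
  exists zero; split; [rewrite norm_zero; lra|].
  now rewrite (linear_zero _ (lin_is_linear l)), norm_zero.
Qed.

Lemma norm_lin_le l x : norm (l x) <= op_norm l * norm x.
Proof.
  destruct (Req_dec (norm x) 0) as [E | N].
  - assert (x = zero) as -> by now apply norm_eq_zero.
    rewrite (linear_zero _ (lin_is_linear l)), !norm_zero; lra.
  - assert (P : 0 < norm x) by (generalize (norm_ge_0 x); lra).
    assert (Pi := Rinv_0_lt_compat _ P).
    set (y := scal (/ norm x) x : A).
    assert (Hy : norm y <= 1).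
    { unfold y. eapply Rle_trans; [apply (@norm_scal R_AbsRing)|].
      change (Rabs (/ norm x) * norm x <= 1).
      rewrite Rabs_right by lra. rewrite Rinv_l; lra. }
    assert (Hly : norm (l y) <= op_norm l)
      by (apply (proj1 (op_norm_lub l)); now exists y).
    assert (E : l x = scal (norm x) (l y)).
    { unfold y. rewrite (linear_scal _ (lin_is_linear l)), scal_assoc.
      change (mult (norm x) (/ norm x)) with (norm x * / norm x).
      rewrite Rinv_r by lra. symmetry; apply (scal_one (K := R_AbsRing)). }
    rewrite E. eapply Rle_trans; [apply (@norm_scal R_AbsRing)|].
    change (Rabs (norm x) * norm (l y) <= op_norm l * norm x).
    rewrite Rabs_right by lra. rewrite Rmult_comm.
    apply Rmult_le_compat_r; lra.
Qed.

Lemma op_norm_le l (c : R) :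
  0 <= c -> (forall x, norm (l x) <= c * norm x) -> op_norm l <= c.
Proof.
  intros Hc H. apply (proj2 (op_norm_lub l)).
  intros r [x [Hx ->]]. eapply Rle_trans; [apply H|].
  rewrite <- (Rmult_1_r c) at 2; apply Rmult_le_compat_l; lra.
Qed.

Lemma op_norm_plus l m : op_norm (plus l m) <= op_norm l + op_norm m.
Proof.
  apply op_norm_le.
  - generalize (op_norm_ge_0 l) (op_norm_ge_0 m); lra.
  - intros x; simpl. eapply Rle_trans; [apply norm_triangle|].
    generalize (norm_lin_le l x) (norm_lin_le m x); lra.
Qed.

Lemma op_norm_scal (k : R) l : op_norm (scal k l) <= Rabs k * op_norm l.
Proof.
  apply op_norm_le.
  - apply Rmult_le_pos; [apply Rabs_pos | apply op_norm_ge_0].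
  - intros x; simpl. eapply Rle_trans; [apply (@norm_scal R_AbsRing)|].
    change (Rabs k * norm (l x) <= Rabs k * op_norm l * norm x).
    rewrite Rmult_assoc.
    apply Rmult_le_compat_l; [apply Rabs_pos | apply norm_lin_le].
Qed.

Lemma op_norm_eq_0 l : op_norm l = 0 -> l = zero.
Proof.
  intros E; apply lin_ext; intros x; simpl.
  apply norm_eq_zero. generalize (norm_lin_le l x) (norm_ge_0 (l x)).
  rewrite E; lra.
Qed.

Lemma op_norm_zero : op_norm (zero : lin A B) = 0.
Proof.
  apply Rle_antisym; [|apply op_norm_ge_0].
  apply op_norm_le; [lra|]; intros x; simpl; rewrite norm_zero; lra.
Qed.

Definition lin_ball l (e : R) m : Prop := op_norm (minus m l) < e.

Definition lin_UniformSpace_mixin : UniformSpace.mixin_of (lin A B).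
Proof.
  apply (UniformSpace.Mixin _ lin_zero lin_ball); unfold lin_ball.
  - intros l e. rewrite minus_eq_zero.
    eapply Rle_lt_trans; [apply Req_le; exact op_norm_zero | apply cond_pos].
  - intros l m e H. eapply Rle_lt_trans; [|exact H].
    replace (minus l m) with (scal (-1) (minus m l)).
    + eapply Rle_trans; [apply op_norm_scal|].
      rewrite Rabs_left by lra; lra.
    + transitivity (opp (minus m l)); [|apply opp_minus].
      apply (@scal_opp_one R_AbsRing lin_ModuleSpace).
  - intros l m n e1 e2 H1 H2.
    rewrite (minus_trans m n l).
    eapply Rle_lt_trans; [apply op_norm_plus|]; lra.
Defined.

Canonical lin_UniformSpace : UniformSpace :=
  UniformSpace.Pack (lin A B) lin_UniformSpace_mixin (lin A B).

Canonical lin_NormedModuleAux : NormedModuleAux R_AbsRing :=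
  NormedModuleAux.Pack R_AbsRing (lin A B)
    (NormedModuleAux.Class R_AbsRing _
       (ModuleSpace.class _ lin_ModuleSpace) lin_UniformSpace_mixin)
    (lin A B).

Definition lin_NormedModule_mixin :
  NormedModule.mixin_of R_AbsRing lin_NormedModuleAux.
Proof.
  apply (NormedModule.Mixin R_AbsRing lin_NormedModuleAux
           (fun l : lin A B => op_norm l) 1).
  - exact op_norm_plus.
  - exact op_norm_scal.
  - intros l m e H; exact H.
  - intros l m e H; rewrite Rmult_1_l; exact H.
  - exact op_norm_eq_0.
Defined.

Canonical lin_NormedModule : NormedModule R_AbsRing :=
  NormedModule.Pack R_AbsRing (lin A B)
    (NormedModule.Class R_AbsRing _
       (NormedModuleAux.class _ lin_NormedModuleAux) lin_NormedModule_mixin)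
    (lin A B).

End LinNormedModule.

Arguments lin_NormedModule A B : clear implicits.

Definition lin_comp {A B C : NormedSpace} (l : lin B C) (m : lin A B) :
  lin A C :=
  Lin (fun x => l (m x))
    (is_linear_comp m l (lin_is_linear m) (lin_is_linear l)).

(* The Fréchet derivative; meaningful where [f] is differentiable, in which
   case the derivative is unique. *)
Definition Fderive {A B : NormedSpace} (f : A -> B) (x : A) : lin A B :=
  epsilon (inhabits lin_zero) (fun l => filterdiff f (locally x) l).

Definition sup_norm {A B : NormedSpace} (f : A -> B) : Rbar :=
  Lub_Rbar (fun r => exists x : A, r = norm (f x)).

Fixpoint Cb (k : nat) {A B : NormedSpace} (f : A -> B) : Prop :=
  is_finite (sup_norm f) /\
  match k with
  | O => forall x, continuous f x
  | S k' => (forall x, ex_filterdiff f (locally x)) /\ Cb k' (Fderive f)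
  end.

(* max_{0 <= i <= k} sup_x ||D^i f(x)|| *)
Fixpoint Cb_norm (k : nat) {A B : NormedSpace} (f : A -> B) : R :=
  match k with
  | O => sup_norm f
  | S k' => Rmax (sup_norm f) (Cb_norm k' (Fderive f))
  end.

Definition linear_map {A B : ModuleSpace R_AbsRing} (l : A -> B) : Prop :=
  (forall x y, l (plus x y) = plus (l x) (l y)) /\
  (forall (k : R) x, l (scal k x) = scal k (l x)).

Definition bilinear_map {A B C : ModuleSpace R_AbsRing} (b : A -> B -> C) : Prop :=
  (forall y, linear_map (fun x => b x y)) /\ (forall x, linear_map (b x)).

(* (VV, tens) is the algebraic tensor product of V with itself.  When VV is
   normed, no relation between its norm and that of V is required: any norm on
   the finite-dimensional space V (x) V is allowed. *)
Definition is_tensor_square {V VV : ModuleSpace R_AbsRing} (tens : V -> V -> VV) :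
  Prop :=
  bilinear_map tens /\
  forall (E : ModuleSpace R_AbsRing) (b : V -> V -> E), bilinear_map b ->
    exists l : VV -> E,
      (linear_map l /\ (forall v w, l (tens v w) = b v w)) /\
      (forall l' : VV -> E,
         linear_map l' -> (forall v w, l' (tens v w) = b v w) ->
         forall x, l' x = l x).

(* The linear map on V (x) V induced by a bilinear [b]. *)
Definition tens_lift {V VV E : ModuleSpace R_AbsRing} (tens : V -> V -> VV)
    (b : V -> V -> E) : VV -> E :=
  epsilon (inhabits (fun _ => zero))
    (fun l => linear_map l /\ (forall v w, l (tens v w) = b v w)).

(* Suprema are taken in the extended reals; they are over nonempty sets when
   0 < T, so they are real numbers as soon as they are bounded. *)

Definition incr {A : NormedSpace} (X : R -> A) (s t : R) : A :=
  minus (X t) (X s).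

Definition sup_on (T : R) {A : NormedSpace} (X : R -> A) : Rbar :=
  Lub_Rbar (fun r => exists t, 0 <= t <= T /\ r = norm (X t)).

Definition hoelder (T a : R) {A : NormedSpace} (X : R -> A) : Rbar :=
  Lub_Rbar (fun r => exists s t, 0 <= s <= T /\ 0 <= t <= T /\ s <> t /\
    r = norm (incr X s t) / Rpower (Rabs (t - s)) a).

Definition hoelder2 (T a : R) {A : NormedSpace} (XX : R -> R -> A) : Rbar :=
  Lub_Rbar (fun r => exists s t, 0 <= s /\ s < t /\ t <= T /\
    r = norm (XX s t) / Rpower (Rabs (t - s)) a).

Definition rough_path (T alpha : R) {V VV : NormedSpace} (tens : V -> V -> VV)
    (X : R -> V) (XX : R -> R -> VV) : Prop :=
  is_finite (hoelder T alpha X) /\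
  is_finite (hoelder2 T (2 * alpha) XX) /\
  forall s u t, 0 <= s -> s <= u -> u <= t -> t <= T ->
    XX s t = plus (plus (XX s u) (XX u t)) (tens (incr X s u) (incr X u t)).

Definition rough_norm (T alpha : R) {V VV : NormedSpace}
    (X : R -> V) (XX : R -> R -> VV) : R :=
  Rmax (hoelder T alpha X) (sqrt (hoelder2 T (2 * alpha) XX)).

Definition rough_dist (T alpha : R) {V VV : NormedSpace}
    (X : R -> V) (XX : R -> R -> VV) (X2 : R -> V) (XX2 : R -> R -> VV) : R :=
  Rmax (hoelder T alpha (fun t => minus (X t) (X2 t)))
       (sqrt (hoelder2 T (2 * alpha) (fun s t => minus (XX s t) (XX2 s t)))).

Definition remainder {V W : NormedSpace} (X : R -> V) (Y : R -> W)
    (Y' : R -> lin V W) (s t : R) : W :=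
  minus (incr Y s t) (Y' s (incr X s t)).

Definition controlled (T alpha : R) {V W : NormedSpace} (X : R -> V)
    (Y : R -> W) (Y' : R -> lin V W) : Prop :=
  is_finite (hoelder T alpha Y') /\
  is_finite (hoelder2 T (2 * alpha) (remainder X Y Y')).

Definition controlled_norm (T alpha : R) {V W : NormedSpace} (X : R -> V)
    (Y : R -> W) (Y' : R -> lin V W) : R :=
  Rmax (Rmax (sup_on T Y) (sup_on T Y'))
       (Rmax (hoelder2 T (2 * alpha) (remainder X Y Y')) (hoelder T alpha Y')).

Definition controlled_dist (T alpha : R) {V W : NormedSpace}
    (X : R -> V) (Y : R -> W) (Y' : R -> lin V W)
    (X2 : R -> V) (Y2 : R -> W) (Y2' : R -> lin V W) : Rbar :=
  Rbar_plus
    (hoelder2 T (2 * alpha)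
       (fun s t => minus (remainder X Y Y' s t) (remainder X2 Y2 Y2' s t)))
    (hoelder T alpha (fun t => minus (Y' t) (Y2' t))).

(* A partition s = p_0 < p_1 < ... < p_n = t is the list [p_1; ...; p_n]. *)
Fixpoint is_partition (s t : R) (p : list R) : Prop :=
  match p with
  | nil => s = t
  | u :: p' => s < u /\ is_partition u t p'
  end.

Fixpoint mesh (s : R) (p : list R) : R :=
  match p with
  | nil => 0
  | u :: p' => Rmax (u - s) (mesh u p')
  end.

Fixpoint partition_sum {E : NormedSpace} (Xi : R -> R -> E) (s : R)
    (p : list R) : E :=
  match p with
  | nil => zero
  | u :: p' => plus (Xi s u) (partition_sum Xi u p')
  end.

Definition is_partition_limit {E : NormedSpace} (Xi : R -> R -> E) (s t : R)
    (I : E) : Prop :=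
  forall eps, 0 < eps -> exists delta, 0 < delta /\
    forall p, is_partition s t p -> mesh s p < delta ->
      norm (minus (partition_sum Xi s p) I) < eps.

(* In DF(Y_u) Y'_u Z'_u XX_{u,v}, the first tensor factor is fed to Y'_u and
   the second one to Z'_u: it is the image of XX_{u,v} under the linear map
   v (x) w |-> DF(Y_u)(Y'_u v)(Z'_u w). *)
Definition rough_germ {U V W VV : NormedSpace} (tens : V -> V -> VV)
    (XX : R -> R -> VV) (Z : R -> U) (Z' : R -> lin V U)
    (F : W -> lin U W) (Y : R -> W) (Y' : R -> lin V W) (u v : R) : W :=
  plus (F (Y u) (incr Z u v))
    (tens_lift tens
       (fun x y : V => (Fderive F (Y u) (Y' u x) : lin U W) (Z' u y))
       (XX u v)).

Definition is_rough_integral {U V W VV : NormedSpace} (tens : V -> V -> VV)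
    (XX : R -> R -> VV) (Z : R -> U) (Z' : R -> lin V U)
    (F : W -> lin U W) (Y : R -> W) (Y' : R -> lin V W) (s t : R) (I : W) :
  Prop :=
  is_partition_limit (rough_germ tens XX Z Z' F Y Y') s t I.

Definition is_solution (T alpha : R) {U V W VV : NormedSpace}
    (tens : V -> V -> VV) (X : R -> V) (XX : R -> R -> VV)
    (Z : R -> U) (Z' : R -> lin V U) (F : W -> lin U W) (F0 : W -> W)
    (y0 : W) (Y : R -> W) (Y' : R -> lin V W) : Prop :=
  controlled T alpha X Y Y' /\
  forall t, 0 <= t <= T ->
    (exists I J : W,
       is_rough_integral tens XX Z Z' F Y Y' 0 t I /\
       is_RInt (fun r => F0 (Y r)) 0 t J /\
       Y t = plus (plus y0 I) J) /\
    Y' t = lin_comp (F (Y t)) (Z' t).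

(* Main.v *)
Require Import Defs.
From Stdlib Require Import Reals Lra Lia List Psatz ClassicalEpsilon ProofIrrelevance.
From Coquelicot Require Import Coquelicot.
Open Scope R_scope.

(** The equation is driven by a path [Z] in [U], and to second order it only
    feels the increments of [Z] and the vectors [ZZ s t b], the iterated integral
    of [Z] over [[s, t]] tested against a bilinear map [b].  For a controlled path
    [ZZ s t b] is [b (Z' s) (Z' s)] applied to [XX s t].  Chen's relation then
    fails, but only by terms of order [3 alpha] ([controlled_chen_defect]), and
    this is enough: as [3 alpha > 1], errors of this order disappear when
    intervals are subdivided.

    A path [Y] solves the equation exactly when its increments are those of its
    drift plus the germ [F (Y s) Z_st + ZZ s t (DF F (Y s))], up to order
    [3 alpha] (Davie's estimate).  One direction is sewing of the Riemann sums
    ([integral_germ_bound], [davie_of_solution]); in the other one the sums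
    telescope ([solution_of_davie]).

    Stability rests on the identity [germ_defect] for the failure of the germ to
    be additive.  Its terms are products of total order [3 alpha], and their
    difference along two solutions is linear in the difference of the solutions,
    with a constant that involves three derivatives of [F]
    ([germ_defect_pair_bound]).  Sewing bounds the difference of the Davie
    remainders by this defect times the [alpha]-th power of the length of the
    window.  On short windows the difference is therefore absorbed, and only the
    distance of the data remains ([local_stability]); finitely many windows cover
    [[0, T]] ([global_stability]).  Equal data give uniqueness.

    Existence comes from the Euler scheme that takes drift and germ for the
    increment of one step.  Davie's estimate holds for it with a constant independent of
    the step ([euler_davie]).  Two consecutive dyadic grids carry approximate
    solutions of the same equation on the coarser grid, so the stability estimate,
    which is proved for abstract index sets for this purpose, makes the scheme
    Cauchy ([euler_refinement]).  The limit inherits Davie's estimate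
    ([euler_path_davie]), hence is a solution.

    Finally, all constants can be chosen from a single integer that bounds the
    norms of the data and [1 / (alpha - 1/3)] ([distance_uniform]).  As the
    maximum of two integers is one of them, the product of the constants chosen
    for the norms and for [alpha] separately dominates the one for both. *)

(** * Identities between linear combinations *)

Section VectorIdentities.
Context {E : ModuleSpace R_AbsRing}.

(** Expressions over a list of atoms.  An identity between two of them is proved
    coefficient by coefficient, which leaves equations between real numbers. *)
Inductive vexp :=
| VVar (n : nat) | VZero | VAdd (a b : vexp) | VOpp (a : vexp)
| VScal (k : R) (a : vexp).

Fixpoint veval (env : list E) (e : vexp) : E :=
  match e with
  | VVar n => nth n env zero
  | VZero => zero
  | VAdd a b => plus (veval env a) (veval env b)
  | VOpp a => opp (veval env a)
  | VScal k a => scal k (veval env a)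
  end.

Fixpoint vcoef (e : vexp) (i : nat) : R :=
  match e with
  | VVar n => if Nat.eqb n i then 1 else 0
  | VZero => 0
  | VAdd a b => vcoef a i + vcoef b i
  | VOpp a => - vcoef a i
  | VScal k a => k * vcoef a i
  end.

Fixpoint vcomb (c : nat -> R) (env : list E) : E :=
  match env with
  | nil => zero
  | x :: env' => plus (scal (c O) x) (vcomb (fun i => c (S i)) env')
  end.

Lemma vcomb_ext c c' env :
  (forall i, (i < length env)%nat -> c i = c' i) -> vcomb c env = vcomb c' env.
Proof.
  revert c c'; induction env as [|x env IH]; intros c c' H; simpl; auto.
  rewrite (H O) by (simpl; lia). f_equal. apply IH.
  intros i Hi; apply H; simpl; lia.
Qed.

Lemma vcomb_zero env : vcomb (fun _ => 0) env = zero.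
Proof.
  induction env as [|x env IH]; simpl; auto.
  rewrite IH, plus_zero_r. apply (scal_zero_l x).
Qed.

Lemma vcomb_plus c c' env :
  vcomb (fun i => c i + c' i) env = plus (vcomb c env) (vcomb c' env).
Proof.
  revert c c'; induction env as [|x env IH]; intros c c'; simpl.
  - now rewrite plus_zero_r.
  - rewrite (IH (fun i => c (S i)) (fun i => c' (S i))).
    rewrite (@scal_distr_r R_AbsRing E (c O) (c' O) x : scal (c O + c' O) x = _).
    rewrite <- !plus_assoc. f_equal.
    rewrite !plus_assoc. f_equal. apply plus_comm.
Qed.

Lemma vcomb_scal k c env :
  vcomb (fun i => k * c i) env = scal k (vcomb c env).
Proof.
  revert c; induction env as [|x env IH]; intros c; simpl.
  - symmetry; apply (@scal_zero_r R_AbsRing E).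
  - rewrite (IH (fun i => c (S i))), scal_distr_l, scal_assoc. reflexivity.
Qed.

Lemma vcomb_var n env :
  vcomb (fun i => if Nat.eqb n i then 1 else 0) env = nth n env zero.
Proof.
  revert n; induction env as [|x env IH]; intros n; simpl.
  - now destruct n.
  - destruct n as [|n]; simpl.
    + rewrite vcomb_zero, plus_zero_r. apply (@scal_one R_AbsRing E).
    + rewrite IH. transitivity (plus zero (nth n env zero)).
      * f_equal. apply (scal_zero_l x).
      * apply plus_zero_l.
Qed.

Lemma veval_vcomb env e : veval env e = vcomb (vcoef e) env.
Proof.
  induction e as [n| |a IHa b IHb|a IHa|k a IHa]; simpl.
  - symmetry; apply vcomb_var.
  - symmetry; apply vcomb_zero.
  - rewrite IHa, IHb. symmetry; apply vcomb_plus.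
  - rewrite IHa. transitivity (scal (-1) (vcomb (vcoef a) env)).
    + symmetry; exact (@scal_opp_one R_AbsRing E _).
    + rewrite <- vcomb_scal. apply vcomb_ext; intros; simpl; ring.
  - rewrite IHa. symmetry; apply vcomb_scal.
Qed.

Fixpoint vagree (c c' : nat -> R) (n : nat) : Prop :=
  match n with
  | O => True
  | S n => c O = c' O /\ vagree (fun i => c (S i)) (fun i => c' (S i)) n
  end.

Lemma vagree_eq c c' n :
  vagree c c' n -> forall i, (i < n)%nat -> c i = c' i.
Proof.
  revert c c'; induction n as [|n IH]; intros c c' H i Hi; [lia|].
  destruct H as [H0 H]. destruct i as [|i]; auto.
  apply (IH _ _ H); lia.
Qed.

Lemma veval_eq env a b :
  vagree (vcoef a) (vcoef b) (length env) -> veval env a = veval env b.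
Proof.
  intros H. rewrite !veval_vcomb. apply vcomb_ext.
  apply vagree_eq, H.
Qed.
End VectorIdentities.

Ltac vec_mem x l :=
  lazymatch l with
  | nil => constr:(false)
  | x :: _ => constr:(true)
  | _ :: ?l' => vec_mem x l'
  end.
Ltac vec_idx x l :=
  lazymatch l with
  | x :: _ => constr:(O)
  | _ :: ?l' => let n := vec_idx x l' in constr:(S n)
  end.
Ltac vec_atoms e l :=
  lazymatch e with
  | @plus _ ?a ?b => let l := vec_atoms a l in vec_atoms b l
  | @minus _ ?a ?b => let l := vec_atoms a l in vec_atoms b l
  | @opp _ ?a => vec_atoms a l
  | @zero _ => l
  | @scal _ _ _ ?a => vec_atoms a l
  | _ => lazymatch vec_mem e l with
         | true => l
         | false => constr:(e :: l)
         end
  end.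
Ltac vec_reify e l :=
  lazymatch e with
  | @plus _ ?a ?b => let a := vec_reify a l in let b := vec_reify b l in
                     constr:(VAdd a b)
  | @minus _ ?a ?b => let a := vec_reify a l in let b := vec_reify b l in
                     constr:(VAdd a (VOpp b))
  | @opp _ ?a => let a := vec_reify a l in constr:(VOpp a)
  | @zero _ => constr:(VZero)
  | @scal _ _ ?k ?a => let a := vec_reify a l in constr:(VScal k a)
  | _ => let n := vec_idx e l in constr:(VVar n)
  end.
Ltac vec_in E :=
  lazymatch goal with
  | |- @eq ?T ?a ?b =>
      let l0 := constr:(@nil T) in
      let l := vec_atoms a l0 in
      let l := vec_atoms b l in
      let ra := vec_reify a l in
      let rb := vec_reify b l in
      change (@veval E l ra = @veval E l rb);
      apply (@veval_eq E l ra rb);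
      cbn [vagree vcoef length Nat.eqb];
      repeat match goal with
      | |- _ /\ _ => split
      | |- True => exact I
      end; try ring
  end.

(* The structure is found by unification, since the carrier of the goal may be a
   space of linear maps, a normed or a complete space. *)
Ltac vec :=
  lazymatch goal with
  | |- @eq ?T _ _ =>
      let E := open_constr:(_ : ModuleSpace R_AbsRing) in
      unify (ModuleSpace.sort R_AbsRing E) T;
      vec_in E
  end.

(** * Norm inequalities and simultaneous size and difference bounds *)

Ltac nonneg :=
  first [assumption | lazymatch goal with
  | |- 0 <= norm _ => apply norm_ge_0
  | |- 0 <= _ ^ 2 => apply pow2_ge_0
  | |- 0 <= _ ^ _ => apply pow_le; nonneg
  | |- 0 <= _ + _ => apply Rplus_le_le_0_compat; nonneg
  | |- 0 <= _ * _ => apply Rmult_le_pos; nonneg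
  | |- 0 <= _ / _ => apply Rdiv_le_0_compat; [nonneg|lra]
  | _ => lra
  end].

Lemma lin_plus_arg {A B : NormedSpace} (l : lin A B) x y :
  l (plus x y) = plus (l x) (l y).
Proof. apply (linear_plus _ (lin_is_linear l)). Qed.

Lemma lin_scal_arg {A B : NormedSpace} (l : lin A B) (k : R) x :
  l (scal k x) = scal k (l x).
Proof. apply (linear_scal _ (lin_is_linear l)). Qed.

Lemma lin_opp_arg {A B : NormedSpace} (l : lin A B) x : l (opp x) = opp (l x).
Proof. apply (linear_opp _ _ (lin_is_linear l)). Qed.

Lemma lin_zero_arg {A B : NormedSpace} (l : lin A B) : l (zero : A) = (zero : B).
Proof. apply (linear_zero _ (lin_is_linear l)). Qed.

Lemma lin_minus_arg {A B : NormedSpace} (l : lin A B) x y :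
  l (minus x y) = minus (l x) (l y).
Proof.
  exact (eq_trans (lin_plus_arg l x (opp y)) (f_equal (plus (l x)) (lin_opp_arg l y))).
Qed.

Lemma norm_app {A B : NormedSpace} (l : lin A B) x :
  norm (l x) <= norm l * norm x.
Proof. apply norm_lin_le. Qed.

Lemma norm_lin_bound {A B : NormedSpace} (l : lin A B) c :
  0 <= c -> (forall x, norm (l x) <= c * norm x) -> norm l <= c.
Proof. apply op_norm_le. Qed.

Lemma norm_plus_le {A : NormedSpace} (x y : A) a b :
  norm x <= a -> norm y <= b -> norm (plus x y) <= a + b.
Proof. intros. eapply Rle_trans; [apply norm_triangle|lra]. Qed.

Lemma norm_minus_le {A : NormedSpace} (x y : A) a b :
  norm x <= a -> norm y <= b -> norm (minus x y) <= a + b.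
Proof. intros. apply norm_plus_le; auto. now rewrite norm_opp. Qed.

Lemma norm_scal_le {A : NormedSpace} (k : R) (x : A) :
  norm (scal k x) <= Rabs k * norm x.
Proof. apply (@norm_scal R_AbsRing). Qed.

Lemma norm_zero_eq {A : NormedSpace} : norm (zero : A) = 0.
Proof. exact (@norm_zero R_AbsRing A). Qed.

Lemma minus_diag {A : NormedSpace} (x : A) : minus x x = (zero : A).
Proof. vec. Qed.

Lemma minus_zero_right {A : NormedSpace} (x : A) : minus x (zero : A) = x.
Proof. vec. Qed.

Lemma norm_minus_diag {A : NormedSpace} (x : A) : norm (minus x x) = 0.
Proof. replace (minus x x) with (zero : A) by vec. apply norm_zero_eq. Qed.

Lemma norm_le_ge_0 {A : NormedSpace} (x : A) c : norm x <= c -> 0 <= c.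
Proof. exact (Rle_trans _ _ _ (norm_ge_0 x)). Qed.

Lemma norm_le_of_eq {A : NormedSpace} (x y : A) c : x = y -> norm y <= c -> norm x <= c.
Proof. now intros ->. Qed.

Lemma norm_minus_sym {A : NormedSpace} (x y : A) :
  norm (minus x y) = norm (minus y x).
Proof. rewrite <- (opp_minus y x). apply norm_opp. Qed.

Lemma norm_app_le {A B : NormedSpace} (l : lin A B) x a b :
  norm l <= a -> norm x <= b -> norm (l x) <= a * b.
Proof.
  intros Ha Hb. eapply Rle_trans; [apply norm_app|].
  apply Rmult_le_compat; auto using norm_ge_0.
Qed.

Lemma minus_zero_iff {A : NormedSpace} (x y : A) :
  norm (minus x y) <= 0 -> x = y.
Proof.
  intros H. assert (E : minus x y = zero).
  { apply norm_eq_zero. generalize (norm_ge_0 (minus x y)); lra. }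
  transitivity (plus (minus x y) y); [vec|]. rewrite E. vec.
Qed.

(** [pair_bound m d x x'] bounds the sizes of [x], [x'] and their distance at once,
    so that one traversal of an expression yields both a bound on it and its
    Lipschitz dependence on the data. *)
Definition pair_bound {A : NormedSpace} (m d : R) (x x' : A) : Prop :=
  norm x <= m /\ norm x' <= m /\ norm (minus x x') <= d.

Lemma pair_bound_le {A : NormedSpace} m d m' d' (x x' : A) :
  pair_bound m d x x' -> m <= m' -> d <= d' -> pair_bound m' d' x x'.
Proof. intros (H1 & H2 & H3) Hm Hd. repeat split; lra. Qed.

Lemma pair_bound_refl {A : NormedSpace} m (x : A) : norm x <= m -> pair_bound m 0 x x.
Proof.
  intros H; repeat split; auto. rewrite norm_minus_diag. lra.
Qed.

Lemma pair_bound_plus {A : NormedSpace} m d n e (x x' y y' : A) :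
  pair_bound m d x x' -> pair_bound n e y y' -> pair_bound (m + n) (d + e) (plus x y) (plus x' y').
Proof.
  intros (H1 & H2 & H3) (K1 & K2 & K3). repeat split; try now apply norm_plus_le.
  replace (minus (plus x y) (plus x' y')) with (plus (minus x x') (minus y y')) by vec.
  now apply norm_plus_le.
Qed.

Lemma pair_bound_opp {A : NormedSpace} m d (x x' : A) :
  pair_bound m d x x' -> pair_bound m d (opp x) (opp x').
Proof.
  intros (H1 & H2 & H3). unfold pair_bound. rewrite !norm_opp. repeat split; auto.
  replace (minus (opp x) (opp x')) with (opp (minus x x')) by vec.
  now rewrite norm_opp.
Qed.

Lemma pair_bound_minus {A : NormedSpace} m d n e (x x' y y' : A) :
  pair_bound m d x x' -> pair_bound n e y y' -> pair_bound (m + n) (d + e) (minus x y) (minus x' y').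
Proof. intros H K. apply pair_bound_plus; auto. now apply pair_bound_opp. Qed.

Lemma pair_bound_app {A B : NormedSpace} m d n e (l l' : lin A B) (x x' : A) :
  pair_bound m d l l' -> pair_bound n e x x' -> pair_bound (m * n) (d * n + m * e) (l x) (l' x').
Proof.
  intros (H1 & H2 & H3) (K1 & K2 & K3). repeat split; try now apply norm_app_le.
  replace (minus (l x) (l' x')) with (plus ((minus l l') x) (l' (minus x x'))).
  - apply norm_plus_le; now apply norm_app_le.
  - rewrite lin_minus_arg. change (minus l l' x) with (minus (l x) (l' x)). vec.
Qed.

Lemma lin_comp_bound {A B C : NormedSpace} (l : lin B C) (m : lin A B) a b :
  norm l <= a -> norm m <= b -> norm (lin_comp l m) <= a * b.
Proof.
  intros Ha Hb. apply norm_lin_bound.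
  - apply Rmult_le_pos; eapply Rle_trans; eauto using norm_ge_0.
  - intros x. simpl. rewrite Rmult_assoc.
    apply norm_app_le; auto. apply norm_app_le; auto. lra.
Qed.

Lemma pair_bound_comp {A B C : NormedSpace} m d n e (l l' : lin B C) (k k' : lin A B) :
  pair_bound m d l l' -> pair_bound n e k k' ->
  pair_bound (m * n) (d * n + m * e) (lin_comp l k) (lin_comp l' k').
Proof.
  intros (H1 & H2 & H3) (K1 & K2 & K3). repeat split; try now apply lin_comp_bound.
  apply (norm_le_of_eq _ (plus (lin_comp (minus l l') k) (lin_comp l' (minus k k')))).
  - apply lin_ext; intros x.
    change (minus (l (k x)) (l' (k' x)) =
      plus (minus (l (k x)) (l' (k x))) (l' (minus (k x) (k' x)))).
    rewrite lin_minus_arg. vec.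
  - apply (@norm_plus_le (lin_NormedModule A C)); now apply lin_comp_bound.
Qed.

(** * The mean value inequality and Taylor estimates *)

Definition frechet {A B : NormedSpace} (f : A -> B) (x : A) (l : lin A B) : Prop :=
  forall eps, 0 < eps -> exists delta, 0 < delta /\
    forall y, norm (minus y x) < delta ->
      norm (minus (minus (f y) (f x)) (l (minus y x))) <= eps * norm (minus y x).

Lemma Fderive_frechet {A B : NormedSpace} (f : A -> B) (x : A) :
  ex_filterdiff f (locally x) -> frechet f x (Fderive f x).
Proof.
  intros [l Hl].
  assert (H : filterdiff f (locally x) (Fderive f x)).
  { unfold Fderive. apply epsilon_spec. now exists (Lin l (proj1 Hl)). }
  intros eps Heps. destruct H as [_ H].
  specialize (H x (fun P HP => HP) (mkposreal eps Heps)).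
  apply (locally_norm_le_locally x) in H. destruct H as [d Hd].
  exists d; split; [apply cond_pos|]. intros y Hy. exact (Hd y Hy).
Qed.

Lemma frechet_minus {A B : NormedSpace} (f g : A -> B) x l m :
  frechet f x l -> frechet g x m ->
  frechet (fun y => minus (f y) (g y)) x (minus l m).
Proof.
  intros Hf Hg eps He.
  destruct (Hf (eps / 2)) as [d1 [P1 H1]]; [lra|].
  destruct (Hg (eps / 2)) as [d2 [P2 H2]]; [lra|].
  exists (Rmin d1 d2). split; [now apply Rmin_pos|]. intros y Hy.
  specialize (H1 y (Rlt_le_trans _ _ _ Hy (Rmin_l _ _))).
  specialize (H2 y (Rlt_le_trans _ _ _ Hy (Rmin_r _ _))).
  change (minus l m (minus y x)) with (minus (l (minus y x)) (m (minus y x))).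
  match goal with |- norm ?a <= _ => replace a with
    (minus (minus (minus (f y) (f x)) (l (minus y x)))
       (minus (minus (g y) (g x)) (m (minus y x)))) by vec end.
  replace (eps * norm (minus y x))
    with (eps / 2 * norm (minus y x) + eps / 2 * norm (minus y x)) by field.
  now apply norm_minus_le.
Qed.

Lemma frechet_shift {A B : NormedSpace} (f : A -> B) (h x : A) l :
  frechet f (plus h x) l -> frechet (fun y => f (plus h y)) x l.
Proof.
  intros Hf eps He. destruct (Hf eps He) as [d [P H]]. exists d; split; auto.
  intros y Hy. specialize (H (plus h y)).
  replace (minus (plus h y) (plus h x)) with (minus y x) in H by vec. auto.
Qed.

Lemma frechet_lin {A B : NormedSpace} (l : lin A B) x : frechet l x l.
Proof.
  intros eps He. exists 1; split; [lra|]. intros y _.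
  apply (norm_le_of_eq _ zero).
  - rewrite lin_minus_arg. vec.
  - rewrite norm_zero_eq. apply Rmult_le_pos; [lra|apply norm_ge_0].
Qed.

(** Local Lipschitz bounds with one constant add up along an interval: the set
    of good end points is closed under suprema and open to the right. *)
Lemma lipschitz_of_local {B : NormedSpace} (g : R -> B) (M : R) :
  (forall c, 0 <= c <= 1 -> exists delta, 0 < delta /\
     forall t, 0 <= t <= 1 -> Rabs (t - c) < delta ->
       norm (minus (g t) (g c)) <= M * Rabs (t - c)) ->
  norm (minus (g 1) (g 0)) <= M.
Proof.
  intros H.
  set (S := fun t => 0 <= t <= 1 /\ norm (minus (g t) (g 0)) <= M * t).
  assert (S0 : S 0).
  { split; [lra|]. rewrite norm_minus_diag; lra. }
  destruct (completeness S) as [m [ub lub]].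
  { exists 1. intros t [Ht _]; lra. }
  { now exists 0. }
  assert (Hm : 0 <= m <= 1).
  { split; [now apply ub|]. apply lub. intros t [Ht _]; lra. }
  destruct (H m Hm) as [d [Pd Hd]].
  assert (Sm : S m).
  { assert (exists t, S t /\ m - d < t) as [t [St Ht]].
    { destruct (Classical_Prop.classic (exists t, S t /\ m - d < t)) as [|N]; auto.
      exfalso. assert (m <= m - d); [|lra].
      apply lub. intros t St. destruct (Rle_dec t (m - d)); auto.
      exfalso; apply N; exists t; split; auto; lra. }
    assert (t <= m) by now apply ub.
    destruct St as [Ht1 Ht2]. split; auto.
    replace (minus (g m) (g 0))
      with (minus (minus (g t) (g 0)) (minus (g t) (g m))) by vec.
    eapply Rle_trans; [apply norm_minus_le; [apply Ht2|apply Hd]|].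
    - lra.
    - rewrite Rabs_left1; lra.
    - rewrite Rabs_left1 by lra. lra. }
  destruct (Rlt_dec m 1) as [L|L].
  - exfalso. set (t := Rmin 1 (m + d / 2)).
    assert (t <= 1) by apply Rmin_l.
    assert (t <= m + d / 2) by apply Rmin_r.
    assert (m < t) by (unfold t; apply Rmin_glb_lt; lra).
    assert (t <= m); [|lra]. apply ub. split; [lra|].
    replace (minus (g t) (g 0))
      with (plus (minus (g t) (g m)) (minus (g m) (g 0))) by vec.
    eapply Rle_trans; [apply norm_plus_le; [apply Hd|apply Sm]|].
    + lra.
    + rewrite Rabs_right; lra.
    + rewrite Rabs_right by lra. lra.
  - replace m with 1 in Sm by lra. destruct Sm. lra.
Qed.

Lemma mean_value {A B : NormedSpace} (f : A -> B) (l : A -> lin A B) (x y : A) K :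
  (forall t, 0 <= t <= 1 -> let z := plus x (scal t (minus y x)) in
     frechet f z (l z) /\ norm (l z) <= K) ->
  norm (minus (f y) (f x)) <= K * norm (minus y x).
Proof.
  intros H. set (h := minus y x). set (n := norm h).
  assert (Hn : 0 <= n) by apply norm_ge_0.
  assert (HK : 0 <= K).
  { destruct (H 0) as [_ HK]; [lra|]. exact (norm_le_ge_0 _ _ HK). }
  apply le_epsilon. intros eps He.
  set (g := fun t : R => f (plus x (scal t h))).
  replace (f y) with (g 1).
  2: { unfold g, h. f_equal. vec. }
  replace (f x) with (g 0).
  2: { unfold g, h. f_equal. vec. }
  apply lipschitz_of_local. intros c Hc.
  destruct (H c Hc) as [Hf Hl]. fold h in Hf, Hl.
  set (z := plus x (scal c h)) in *.
  destruct (Hf (eps / (n + 1))) as [d [Pd Hd]].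
  { apply Rdiv_lt_0_compat; lra. }
  exists (d / (n + 1)). split; [apply Rdiv_lt_0_compat; lra|].
  intros t Ht Hct. unfold g. fold z.
  set (w := plus x (scal t h)).
  assert (E : minus w z = scal (t - c) h) by (unfold w, z; vec).
  assert (Nw : norm (minus w z) <= Rabs (t - c) * n) by (rewrite E; apply norm_scal_le).
  assert (Pa := Rabs_pos (t - c)).
  assert (Dw : norm (minus w z) < d).
  { eapply Rle_lt_trans; [apply Nw|].
    apply Rle_lt_trans with (Rabs (t - c) * (n + 1)); [nra|].
    apply Rmult_lt_reg_r with (/ (n + 1)); [apply Rinv_0_lt_compat; lra|].
    rewrite Rmult_assoc, Rinv_r by lra. rewrite Rmult_1_r. exact Hct. }
  specialize (Hd w Dw).
  replace (minus (f w) (f z))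
    with (plus (minus (minus (f w) (f z)) (l z (minus w z))) (l z (minus w z))) by vec.
  eapply Rle_trans.
  { apply norm_plus_le; [apply Hd|]. apply norm_app_le; [apply Hl|apply Nw]. }
  assert (eps / (n + 1) * n <= eps).
  { apply Rmult_le_reg_r with (n + 1); [lra|].
    replace (eps / (n + 1) * n * (n + 1)) with (eps * n) by (field; lra). nra. }
  assert (0 < eps / (n + 1)) by (apply Rdiv_lt_0_compat; lra).
  apply Rle_trans with (eps / (n + 1) * (Rabs (t - c) * n) + K * (Rabs (t - c) * n)).
  - apply Rplus_le_compat_r. apply Rmult_le_compat_l; lra.
  - replace (eps / (n + 1) * (Rabs (t - c) * n)) with (eps / (n + 1) * n * Rabs (t - c)) by ring.
    nra.
Qed.

Section FourPoint.
Context {A B : NormedSpace} (f : A -> B) (l : A -> lin A B) (K : R).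
Hypothesis Hf : forall x, frechet f x (l x).
Hypothesis HK : forall x, norm (l x) <= K.

Lemma lipschitz x y : norm (minus (f y) (f x)) <= K * norm (minus y x).
Proof. apply mean_value with l. intros t _ z. split; [apply Hf|apply HK]. Qed.

Hypothesis Hl : forall x y, norm (minus (l y) (l x)) <= K * norm (minus y x).

(** Apply the mean value inequality to [x |-> f (h + x) - f x] with
    [h = z - y]; the remaining discrepancy is [f] at two points that differ by
    [(z - y) - (z' - y')]. *)
Lemma four_point y z y' z' :
  norm (minus (minus (f z) (f y)) (minus (f z') (f y'))) <=
  K * (norm (minus (minus z y) (minus z' y')) + norm (minus z y) * norm (minus y y')).
Proof.
  set (h := minus z y).
  set (g := fun x => minus (f (plus h x)) (f x)).
  assert (Hg : norm (minus (g y) (g y')) <= K * norm h * norm (minus y y')).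
  { apply mean_value with (fun x => minus (l (plus h x)) (l x)).
    intros t _ x. split.
    - apply frechet_minus; [apply frechet_shift|]; apply Hf.
    - eapply Rle_trans; [apply Hl|]. right. f_equal. f_equal. vec. }
  assert (Hz : norm (minus (f (plus h y')) (f z')) <= K * norm (minus h (minus z' y'))).
  { eapply Rle_trans; [apply lipschitz|]. right. f_equal. f_equal. vec. }
  replace (minus (minus (f z) (f y)) (minus (f z') (f y')))
    with (plus (minus (g y) (g y')) (minus (f (plus h y')) (f z'))).
  - eapply Rle_trans; [apply norm_plus_le; [apply Hg|apply Hz]|]. lra.
  - unfold g. replace (plus h y) with z by (unfold h; vec). vec.
Qed.

Definition taylor_rem (y z : A) : B :=
  minus (minus (f z) (f y)) (l y (minus z y)).

Lemma taylor_step y h h' M :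
  norm h <= M -> norm h' <= M ->
  norm (minus (taylor_rem y (plus y h)) (taylor_rem y (plus y h')))
  <= K * M * norm (minus h h').
Proof.
  intros Hh Hh'.
  apply (mean_value (fun h => taylor_rem y (plus y h))
           (fun h => minus (l (plus y h)) (l y))).
  intros t Ht z.
  assert (HK0 : 0 <= K).
  { exact (norm_le_ge_0 _ _ (HK y)). }
  assert (norm z <= M).
  { unfold z. replace (plus h' (scal t (minus h h')))
      with (plus (scal (1 - t) h') (scal t h)) by vec.
    eapply Rle_trans.
    - apply norm_plus_le; (eapply Rle_trans; [apply norm_scal_le|]);
        apply Rmult_le_compat_l; try apply Rabs_pos; [apply Hh'|apply Hh].
    - rewrite !Rabs_right by lra. lra. }
  split.
  - intros eps He.
    destruct (frechet_minus _ _ z _ _ (frechet_shift _ y z _ (Hf (plus y z)))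
                (frechet_lin (l y) z) eps He) as [d [Pd Hd]].
    exists d; split; auto. intros w Hw.
    replace (minus (taylor_rem y (plus y w)) (taylor_rem y (plus y z)))
      with (minus (minus (f (plus y w)) (l y w)) (minus (f (plus y z)) (l y z))).
    + apply Hd, Hw.
    + unfold taylor_rem.
      replace (minus (plus y w) y) with w by vec.
      replace (minus (plus y z) y) with z by vec. vec.
  - eapply Rle_trans; [apply Hl|]. apply Rmult_le_compat_l; auto.
    now replace (minus (plus y z) y) with z by vec.
Qed.

Lemma taylor_rem_bound y z : norm (taylor_rem y z) <= K * norm (minus z y) ^ 2.
Proof.
  assert (H := taylor_step y (minus z y) zero (norm (minus z y)) (Rle_refl _)).
  rewrite norm_zero_eq in H. specialize (H (norm_ge_0 _)).
  replace (plus y (minus z y)) with z in H by vec.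
  replace (plus y zero) with y in H by vec.
  replace (minus (taylor_rem y z) (taylor_rem y y)) with (taylor_rem y z) in H.
  - rewrite minus_zero_right in H.
    eapply Rle_trans; [apply H|]. right; ring.
  - unfold taylor_rem at 3. rewrite !minus_diag, lin_zero_arg. vec.
Qed.

(** The difference of two remainders is estimated first by moving the base
    point, where the increment in [h] is a four-point difference of [l], then
    by moving the increment. *)
Lemma taylor_rem_four_point y z y' z' :
  (forall a b a' b',
     norm (minus (minus (l b) (l a)) (minus (l b') (l a'))) <=
     K * (norm (minus (minus b a) (minus b' a')) + norm (minus b a) * norm (minus a a'))) ->
  norm (minus (taylor_rem y z) (taylor_rem y' z')) <=
  K * (norm (minus z y) ^ 2 * norm (minus y y') +
       (norm (minus z y) + norm (minus z' y')) * norm (minus (minus z y) (minus z' y'))).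
Proof.
  intros H4. set (h := minus z y). set (h' := minus z' y').
  assert (HK0 : 0 <= K).
  { exact (norm_le_ge_0 _ _ (HK y)). }
  assert (H1 : norm (minus (taylor_rem y' (plus y' h)) (taylor_rem y' (plus y' h')))
               <= K * (norm h + norm h') * norm (minus h h')).
  { apply taylor_step; generalize (norm_ge_0 h) (norm_ge_0 h'); lra. }
  assert (H2 : norm (minus (minus (taylor_rem y (plus y h)) (taylor_rem y' (plus y' h)))
                 (minus (taylor_rem y (plus y (zero : A))) (taylor_rem y' (plus y' (zero : A)))))
               <= K * norm h * norm (minus y y') * norm (minus h (zero : A))).
  { apply (mean_value (fun h => minus (taylor_rem y (plus y h)) (taylor_rem y' (plus y' h)))
           (fun h => minus (minus (l (plus y h)) (l y)) (minus (l (plus y' h)) (l y')))).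
    intros t Ht x. split.
    - intros eps He.
      destruct (frechet_minus _ _ x _ _
        (frechet_minus _ _ x _ _ (frechet_shift _ y x _ (Hf (plus y x)))
                (frechet_lin (l y) x))
        (frechet_minus _ _ x _ _ (frechet_shift _ y' x _ (Hf (plus y' x)))
                (frechet_lin (l y') x)) eps He) as [d [Pd Hd]].
      exists d; split; auto. intros w Hw.
      eapply Rle_trans; [|apply (Hd w Hw)]. right. f_equal.
      unfold taylor_rem.
      replace (minus (plus y w) y) with w by vec.
      replace (minus (plus y' w) y') with w by vec.
      replace (minus (plus y x) y) with x by vec.
      replace (minus (plus y' x) y') with x by vec. vec.
    - eapply Rle_trans; [apply H4|]. rewrite Rmult_assoc. apply Rmult_le_compat_l; auto.
      replace (minus (plus y x) y) with x by vec.
      replace (minus (plus y' x) y') with x by vec.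
      rewrite norm_minus_diag, Rplus_0_l.
      apply Rmult_le_compat_r; [apply norm_ge_0|].
      apply (norm_le_of_eq _ (scal t h)); [unfold x; vec|].
      eapply Rle_trans; [apply norm_scal_le|]. rewrite Rabs_right by lra.
      generalize (norm_ge_0 h); nra. }
  replace (plus y h) with z in H2 by (unfold h; vec).
  replace (plus y' h') with z' in H1 by (unfold h'; vec).
  replace (minus (taylor_rem y z) (taylor_rem y' z')) with
    (plus (minus (minus (taylor_rem y z) (taylor_rem y' (plus y' h)))
                 (minus (taylor_rem y (plus y (zero : A))) (taylor_rem y' (plus y' (zero : A)))))
          (minus (taylor_rem y' (plus y' h)) (taylor_rem y' z'))).
  - eapply Rle_trans; [apply norm_plus_le; [apply H2|apply H1]|].
    rewrite minus_zero_right. right; ring.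
  - replace (taylor_rem y (plus y (zero : A))) with (zero : B).
    replace (taylor_rem y' (plus y' (zero : A))) with (zero : B).
    + vec.
    + unfold taylor_rem. replace (plus y' (zero : A)) with y' by vec.
      rewrite !minus_diag, lin_zero_arg. vec.
    + unfold taylor_rem. replace (plus y (zero : A)) with y by vec.
      rewrite !minus_diag, lin_zero_arg. vec.
Qed.
End FourPoint.

(** * The vector fields *)

(** The coefficient [DF(y) F(y)] of the second-order term in the expansion of a
    solution started at [y]. *)
Definition second_field {U W : NormedSpace} (F : W -> lin U W) (y : W) :
  lin U (lin_NormedModule U W) := lin_comp (Fderive F y) (F y).

(** The bounds through which [F] and [F0] enter all later estimates.  The
    four-point bounds [sm_rem_four] and [sm_G_four] are those that consume the
    third derivative: they make differences of second-order terms along two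
    paths Lipschitz in the difference of the paths. *)
Record smooth {U W : NormedSpace} (K : R) (F : W -> lin U W) (F0 : W -> W) : Prop := {
  sm_K : 1 <= K;
  sm_F : forall y, norm (F y) <= K;
  sm_F_lip : forall y z, norm (minus (F y) (F z)) <= K * norm (minus y z);
  sm_DF : forall y, norm (Fderive F y) <= K;
  sm_DF_lip : forall y z,
    norm (minus (Fderive F y) (Fderive F z)) <= K * norm (minus y z);
  sm_rem : forall y z,
    norm (taylor_rem F (Fderive F) y z) <= K * norm (minus z y) ^ 2;
  sm_rem_four : forall y z y' z',
    norm (minus (taylor_rem F (Fderive F) y z) (taylor_rem F (Fderive F) y' z')) <=
    K * (norm (minus z y) ^ 2 * norm (minus y y') +
         (norm (minus z y) + norm (minus z' y')) *
         norm (minus (minus z y) (minus z' y')));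
  sm_G : forall y, norm (second_field F y) <= K;
  sm_G_lip : forall y z,
    norm (minus (second_field F y) (second_field F z)) <= K * norm (minus y z);
  sm_G_four : forall y z y' z',
    norm (minus (minus (second_field F z) (second_field F y))
                (minus (second_field F z') (second_field F y'))) <=
    K * (norm (minus (minus z y) (minus z' y')) +
         (norm (minus z y) + norm (minus z' y')) * norm (minus y y'));
  sm_F0 : forall y, norm (F0 y) <= K;
  sm_F0_lip : forall y z, norm (minus (F0 y) (F0 z)) <= K * norm (minus y z)
}.

Arguments sm_K {U W K F F0}.
Arguments sm_F {U W K F F0}.
Arguments sm_F_lip {U W K F F0}.
Arguments sm_DF {U W K F F0}.
Arguments sm_DF_lip {U W K F F0}.
Arguments sm_rem {U W K F F0}.
Arguments sm_rem_four {U W K F F0}.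
Arguments sm_G {U W K F F0}.
Arguments sm_G_lip {U W K F F0}.
Arguments sm_G_four {U W K F F0}.
Arguments sm_F0 {U W K F F0}.
Arguments sm_F0_lip {U W K F F0}.

Section SmoothPairs.
Context {U W : NormedSpace} {K : R} {F : W -> lin U W} {F0 : W -> W} (HF : smooth K F F0).
Context (y y' : W) (Q : R) (HQ : norm (minus y y') <= Q).

Lemma sm_F_pair : pair_bound K (K * Q) (F y) (F y').
Proof.
  split; [apply (sm_F HF)|split; [apply (sm_F HF)|]].
  eapply Rle_trans; [apply (sm_F_lip HF)|]. generalize (sm_K HF); nra.
Qed.

Lemma sm_DF_pair : pair_bound K (K * Q) (Fderive F y) (Fderive F y').
Proof.
  split; [apply (sm_DF HF)|split; [apply (sm_DF HF)|]].
  eapply Rle_trans; [apply (sm_DF_lip HF)|]. generalize (sm_K HF); nra.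
Qed.

Lemma sm_G_pair : pair_bound K (K * Q) (second_field F y) (second_field F y').
Proof.
  split; [apply (sm_G HF)|split; [apply (sm_G HF)|]].
  eapply Rle_trans; [apply (sm_G_lip HF)|]. generalize (sm_K HF); nra.
Qed.
End SmoothPairs.

Lemma sup_norm_bound {A B : NormedSpace} (f : A -> B) :
  is_finite (sup_norm f) -> forall x, norm (f x) <= sup_norm f.
Proof.
  intros H x. destruct (Lub_Rbar_correct (fun r => exists x, r = norm (f x))) as [ub _].
  specialize (ub (norm (f x)) (ex_intro _ x eq_refl)).
  change (Rbar_le (norm (f x)) (sup_norm f)) in ub. now rewrite <- H in ub.
Qed.

Lemma lin_comp_minus_four {A B C : NormedSpace}
  (az ay az' ay' : lin B C) (bz by_ bz' by' : lin A B) :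
  minus (minus (lin_comp az bz) (lin_comp ay by_))
        (minus (lin_comp az' bz') (lin_comp ay' by')) =
  plus (plus (lin_comp (minus (minus az ay) (minus az' ay')) bz)
             (lin_comp (minus az' ay') (minus bz bz')))
       (plus (lin_comp (minus ay ay') (minus bz by_))
             (lin_comp ay' (minus (minus bz by_) (minus bz' by')))).
Proof.
  apply lin_ext; intros x.
  change (minus (minus (az (bz x)) (ay (by_ x))) (minus (az' (bz' x)) (ay' (by' x))) =
    plus (plus (minus (minus (az (bz x)) (ay (bz x))) (minus (az' (bz x)) (ay' (bz x))))
               (minus (az' (minus (bz x) (bz' x))) (ay' (minus (bz x) (bz' x)))))
         (plus (minus (ay (minus (bz x) (by_ x))) (ay' (minus (bz x) (by_ x))))
               (ay' (minus (minus (bz x) (by_ x)) (minus (bz' x) (by' x)))))).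
  rewrite !lin_minus_arg. vec.
Qed.

(** The factor [4] is what the terms of [lin_comp_minus_four] add up to, each a
    product of two bounds on [F] and its derivatives; smaller multiples of [B^2]
    would do elsewhere. *)
Lemma smooth_of_Cb {U W : NormedSpace} (F : W -> lin U W) (F0 : W -> W) B :
  Cb 3 F -> Cb 1 F0 -> 1 <= B -> Cb_norm 3 F <= B -> Cb_norm 1 F0 <= B ->
  smooth (4 * B ^ 2) F F0.
Proof.
  intros (F1 & D1 & F2 & D2 & F3 & D3 & F4 & _) (G1 & E1 & G2 & _) HB HF HG.
  simpl in HF, HG.
  assert (S1 : forall y, norm (F y) <= B).
  { intros y. eapply Rle_trans; [apply (sup_norm_bound _ F1)|].
    eapply Rle_trans; [apply Rmax_l|apply HF]. }
  assert (HF' := Rle_trans _ _ _ (Rmax_r _ _) HF).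
  assert (S2 : forall y, norm (Fderive F y) <= B).
  { intros y. eapply Rle_trans; [apply (sup_norm_bound _ F2)|].
    eapply Rle_trans; [apply Rmax_l|apply HF']. }
  assert (HF'' := Rle_trans _ _ _ (Rmax_r _ _) HF').
  assert (S3 : forall y, norm (Fderive (Fderive F) y) <= B).
  { intros y. eapply Rle_trans; [apply (sup_norm_bound _ F3)|].
    eapply Rle_trans; [apply Rmax_l|apply HF'']. }
  assert (HF3 := Rle_trans _ _ _ (Rmax_r _ _) HF'').
  assert (S4 : forall y, norm (Fderive (Fderive (Fderive F)) y) <= B).
  { intros y. eapply Rle_trans; [apply (sup_norm_bound _ F4)|apply HF3]. }
  assert (T1 : forall y, norm (F0 y) <= B).
  { intros y. eapply Rle_trans; [apply (sup_norm_bound _ G1)|].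
    eapply Rle_trans; [apply Rmax_l|apply HG]. }
  assert (T2 : forall y, norm (Fderive F0 y) <= B).
  { intros y. eapply Rle_trans; [apply (sup_norm_bound _ G2)|].
    eapply Rle_trans; [apply Rmax_r|apply HG]. }
  assert (P1 : forall y, frechet F y (Fderive F y)) by (intros; apply Fderive_frechet, D1).
  assert (P2 : forall y, frechet (Fderive F) y (Fderive (Fderive F) y))
    by (intros; apply Fderive_frechet, D2).
  assert (P3 : forall y, frechet (Fderive (Fderive F)) y (Fderive (Fderive (Fderive F)) y))
    by (intros; apply Fderive_frechet, D3).
  assert (Q1 : forall y, frechet F0 y (Fderive F0 y)) by (intros; apply Fderive_frechet, E1).
  assert (L1 := lipschitz F _ B P1 S2).
  assert (L2 := lipschitz _ _ B P2 S3).
  assert (L3 := lipschitz _ _ B P3 S4).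
  assert (M1 := lipschitz _ _ B Q1 T2).
  assert (H4 := four_point _ _ B P2 S3 L3).
  assert (H41 := four_point _ _ B P1 S2 L2).
  assert (HK : B <= 4 * B ^ 2) by nra.
  assert (HK2 : B * B <= 4 * B ^ 2) by nra.
  assert (up : forall a b, 0 <= b -> a <= B * b -> a <= 4 * B ^ 2 * b) by (intros; nra).
  assert (C : forall y z, pair_bound (B * B) (B * norm (minus y z) * B + B * (B * norm (minus y z)))
     (second_field F y) (second_field F z)).
  { intros y z. apply pair_bound_comp; repeat split; auto. }
  split.
  - nra.
  - intros y. eapply Rle_trans; [apply S1|lra].
  - intros y z. apply up; [apply norm_ge_0|apply L1].
  - intros y. eapply Rle_trans; [apply S2|lra].
  - intros y z. apply up; [apply norm_ge_0|apply L2].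
  - intros y z. apply up; [apply pow2_ge_0|]. now apply taylor_rem_bound.
  - intros y z y' z'. apply up; [|now apply taylor_rem_four_point].
    repeat first [apply norm_ge_0|apply pow2_ge_0|apply Rplus_le_le_0_compat|apply Rmult_le_pos].
  - intros y. destruct (C y y) as [H _]. eapply Rle_trans; [apply H|lra].
  - intros y z. destruct (C y z) as (_ & _ & H). eapply Rle_trans; [apply H|].
    generalize (norm_ge_0 (minus y z)); nra.
  - intros y z y' z'. unfold second_field.
    set (h := norm (minus z y)). set (h' := norm (minus z' y')).
    set (e := norm (minus y y')). set (d := norm (minus (minus z y) (minus z' y'))).
    assert (0 <= h) by apply norm_ge_0. assert (0 <= h') by apply norm_ge_0.
    assert (0 <= e) by apply norm_ge_0. assert (0 <= d) by apply norm_ge_0.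
    assert (Hz : norm (minus z z') <= d + e).
    { apply (norm_le_of_eq _ (plus (minus (minus z y) (minus z' y')) (minus y y'))); [vec|].
      apply norm_plus_le; apply Rle_refl. }
    apply (norm_le_of_eq _ _ _ (lin_comp_minus_four _ _ _ _ _ _ _ _)).
    set (A2 := norm (lin_comp (minus (Fderive F z') (Fderive F y')) (minus (F z) (F z')))).
    assert (B2 : A2 <= 2 * B * B * d + B * h' * (B * e)).
    { assert (N1 : norm (minus (Fderive F z') (Fderive F y')) <= 2 * B).
      { replace (2 * B) with (B + B) by ring.
        apply (@norm_minus_le (lin_NormedModule W (lin_NormedModule U W))); apply S2. }
      assert (N2 : norm (minus (Fderive F z') (Fderive F y')) <= B * h') by apply L2.
      assert (N3 : norm (minus (F z) (F z')) <= B * (d + e)).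
      { eapply Rle_trans; [apply L1|]. apply Rmult_le_compat_l; lra. }
      set (n := norm (minus (Fderive F z') (Fderive F y'))) in *.
      assert (0 <= n) by apply (@norm_ge_0 _ (lin_NormedModule W (lin_NormedModule U W))).
      assert (A2 <= n * (B * (d + e))) by (apply lin_comp_bound; auto; apply Rle_refl).
      assert (n * (B * d) <= 2 * B * (B * d)) by (apply Rmult_le_compat_r; nra).
      assert (n * (B * e) <= B * h' * (B * e)) by (apply Rmult_le_compat_r; nra).
      nra. }
    eapply Rle_trans.
    { apply (@norm_plus_le (lin_NormedModule U (lin_NormedModule U W)));
      apply (@norm_plus_le (lin_NormedModule U (lin_NormedModule U W))).
      - apply lin_comp_bound; [apply H4|apply S1].
      - apply B2.
      - apply lin_comp_bound; [apply L2|apply L1].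
      - apply lin_comp_bound; [apply S2|apply H41]. }
    fold h h' e d.
    assert (0 <= B ^ 2 * (h * e)) by (repeat apply Rmult_le_pos; nra).
    assert (0 <= B ^ 2 * (h' * e)) by (repeat apply Rmult_le_pos; nra).
    assert (0 <= B ^ 2 * d) by nra.
    replace (B * (d + h * e) * B + (2 * B * B * d + B * h' * (B * e)) +
       (B * e * (B * h) + B * (B * (d + h * e))))
      with (4 * (B ^ 2 * d) + 3 * (B ^ 2 * (h * e)) + B ^ 2 * (h' * e)) by ring.
    replace (4 * B ^ 2 * (d + (h + h') * e))
      with (4 * (B ^ 2 * d) + 4 * (B ^ 2 * (h * e)) + 4 * (B ^ 2 * (h' * e))) by ring.
    lra.
  - intros y. eapply Rle_trans; [apply T1|lra].
  - intros y z. apply up; [apply norm_ge_0|apply M1].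
Qed.

(** * Finite-dimensional spaces and the tensor square *)

Lemma pow_unit_bound q n : 0 <= q < 1 -> 0 <= q ^ n <= 1.
Proof.
  intros Hq. split; [apply pow_le; lra|].
  induction n as [|n IH]; simpl; [lra|].
  assert (0 <= q ^ n) by (apply pow_le; lra). nra.
Qed.

Lemma pow_small q c eps : 0 <= q < 1 -> 0 <= c -> 0 < eps ->
  exists N, forall n, (N <= n)%nat -> c * q ^ n < eps.
Proof.
  intros Hq Hc He.
  destruct (pow_lt_1_zero q) with (y := eps / (c + 1)) as [N HN].
  - rewrite Rabs_right; lra.
  - apply Rdiv_lt_0_compat; lra.
  - exists N. intros n Hn. specialize (HN n Hn).
    assert (P : 0 <= q ^ n) by (apply pow_le; lra).
    rewrite Rabs_right in HN by lra.
    apply Rle_lt_trans with ((c + 1) * q ^ n); [nra|].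
    apply Rmult_lt_reg_l with (/ (c + 1)); [apply Rinv_0_lt_compat; lra|].
    rewrite <- Rmult_assoc, Rinv_l by lra. rewrite Rmult_1_l.
    unfold Rdiv in HN. lra.
Qed.

Lemma le_of_pow_error a b c q : 0 <= q < 1 -> 0 <= c ->
  (exists N, forall n, (N <= n)%nat -> a <= b + c * q ^ n) -> a <= b.
Proof.
  intros Hq Hc [N H]. apply le_epsilon. intros eps He.
  destruct (pow_small q c eps Hq Hc He) as [M HM].
  specialize (H (max N M) (Nat.le_max_l _ _)).
  specialize (HM (max N M) (Nat.le_max_r _ _)). lra.
Qed.

Lemma geometric_limit {W : BanachSpace} (u : nat -> (W : NormedSpace)) c q :
  0 <= q < 1 ->
  (forall k, norm (minus (u (S k)) (u k)) <= c * q ^ k) ->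
  exists l, forall k, norm (minus (u k) l) <= c / (1 - q) * q ^ k.
Proof.
  intros Hq H.
  assert (Hc : 0 <= c).
  { generalize (norm_le_ge_0 _ _ (H O)). simpl; lra. }
  set (C := c / (1 - q)).
  assert (HC : 0 <= C) by (apply Rdiv_le_0_compat; lra).
  assert (EC : C * (1 - q) = c) by (unfold C; field; lra).
  assert (step : forall m k, norm (minus (u (m + k)%nat) (u k)) <= C * q ^ k * (1 - q ^ m)).
  { induction m as [|m IH]; intros k; simpl.
    - rewrite norm_minus_diag. right; ring.
    - replace (minus (u (S (m + k))) (u k))
        with (plus (minus (u (S (m + k))) (u (m + k)%nat)) (minus (u (m + k)%nat) (u k))) by vec.
      eapply Rle_trans; [apply norm_plus_le; [apply H|apply IH]|].
      rewrite pow_add, <- EC. right; ring. }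
  assert (step' : forall n k, (k <= n)%nat -> norm (minus (u n) (u k)) <= C * q ^ k).
  { intros n k Hk. replace n with ((n - k) + k)%nat by lia.
    eapply Rle_trans; [apply step|].
    assert (P := pow_unit_bound q (n - k) Hq). assert (P' := pow_unit_bound q k Hq).
    assert (0 <= C * q ^ k) by nra. nra. }
  destruct (proj1 (filterlim_locally_cauchy (F := eventually) u)) as [l Hl].
  { intros eps. destruct (pow_small q (2 * C) eps Hq) as [N HN]; [lra|apply cond_pos|].
    exists (fun n => (N <= n)%nat). split; [now exists N|].
    intros n m Hn Hm. apply (@norm_compat1 R_AbsRing (CompleteNormedModule.NormedModule _ W)).
    specialize (HN N (Nat.le_refl _)).
    apply Rle_lt_trans with (2 := HN).
    replace (minus (u m) (u n)) with (minus (minus (u m) (u N)) (minus (u n) (u N))) by vec.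
    replace (2 * C * q ^ N) with (C * q ^ N + C * q ^ N) by ring.
    apply norm_minus_le; auto. }
  exists l. intros k. apply le_epsilon. intros eps He.
  destruct (proj1 (filterlim_locally_ball_norm (U := CompleteNormedModule.NormedModule _ W) (F := eventually) u l) Hl (mkposreal eps He))
    as [N HN].
  specialize (HN (max N k) (Nat.le_max_l _ _)).
  change (norm (minus (u (max N k)) l) < eps) in HN.
  replace (minus (u k) l) with (minus (minus (u (max N k)) l) (minus (u (max N k)) (u k))) by vec.
  eapply Rle_trans.
  { apply norm_minus_le; [apply Rlt_le, HN|apply step', Nat.le_max_r]. }
  lra.
Qed.

Definition span {E : ModuleSpace R_AbsRing} (l : list E) (x : E) : Prop :=
  exists c, x = vcomb c l.

Lemma span_zero {E : ModuleSpace R_AbsRing} (l : list E) : span l zero.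
Proof. exists (fun _ => 0). symmetry; apply vcomb_zero. Qed.

Lemma span_plus {E : ModuleSpace R_AbsRing} (l : list E) x y :
  span l x -> span l y -> span l (plus x y).
Proof.
  intros [c ->] [d ->]. exists (fun i => c i + d i). symmetry; apply vcomb_plus.
Qed.

Lemma span_scal {E : ModuleSpace R_AbsRing} (l : list E) k x :
  span l x -> span l (scal k x).
Proof. intros [c ->]. exists (fun i => k * c i). symmetry; apply vcomb_scal. Qed.

Lemma span_opp {E : ModuleSpace R_AbsRing} (l : list E) x :
  span l x -> span l (opp x).
Proof.
  intros H. rewrite <- (@scal_opp_one R_AbsRing E x). now apply span_scal.
Qed.

Lemma span_in {E : ModuleSpace R_AbsRing} (l : list E) x : In x l -> span l x.
Proof.
  intros H. destruct (In_nth l x zero H) as [n [_ Hn]].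
  exists (fun i => if Nat.eqb n i then 1 else 0). now rewrite vcomb_var.
Qed.

Fixpoint rsum {A : Type} (f : A -> R) (l : list A) : R :=
  match l with nil => 0 | x :: l' => f x + rsum f l' end.

Lemma rsum_ge_0 {A : Type} (f : A -> R) l : (forall x, 0 <= f x) -> 0 <= rsum f l.
Proof. intros H; induction l as [|x l IH]; simpl; [lra|]. specialize (H x); lra. Qed.

Lemma norm_vcomb {E : NormedSpace} (c : nat -> R) (l : list E) a :
  0 <= a -> (forall i, (i < length l)%nat -> Rabs (c i) <= a) ->
  norm (vcomb c l) <= a * rsum norm l.
Proof.
  intros Ha. revert c. induction l as [|x l IH]; intros c Hc; simpl.
  - rewrite (norm_zero_eq : norm (@zero (ModuleSpace.AbelianMonoid _ E)) = 0). lra.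
  - rewrite Rmult_plus_distr_l. apply norm_plus_le.
    + eapply Rle_trans; [apply norm_scal_le|].
      apply Rmult_le_compat_r; [apply norm_ge_0|]. apply Hc; simpl; lia.
    + apply IH. intros i Hi; apply Hc; simpl; lia.
Qed.

Lemma vcomb_minus {E : ModuleSpace R_AbsRing} (c d : nat -> R) (l : list E) :
  minus (vcomb c l) (vcomb d l) = vcomb (fun i => c i - d i) l.
Proof.
  rewrite (vcomb_ext (fun i => c i - d i) (fun i => c i + (-1) * d i)) by (intros; ring).
  rewrite (vcomb_plus c (fun i => (-1) * d i)), vcomb_scal. vec.
Qed.

Lemma choice_function {A B : Type} (P : A -> B -> Prop) :
  (forall x, exists y, P x y) -> exists f, forall x, P x (f x).
Proof.
  intros H. exists (fun x => proj1_sig (constructive_indefinite_description _ (H x))).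
  intros x. apply proj2_sig.
Qed.

(** By induction on the family, which need not be independent: if the new vector
    is a combination of the others it can be dropped; otherwise the span of the
    others is complete by the induction hypothesis, hence at positive distance
    from it.  This equivalence of norms is what bounds the linear lift of a
    bilinear map on the tensor square, whose norm is arbitrary. *)
Lemma bounded_coefficients {E : NormedSpace} (l : list E) :
  exists C, 0 <= C /\ forall c, exists c', vcomb c' l = vcomb c l /\
    forall i, (i < length l)%nat -> Rabs (c' i) <= C * norm (vcomb c l).
Proof.
  induction l as [|e l [C [HC IH]]].
  { exists 0; split; [lra|]. intros c; exists c; split; auto. simpl; lia. }
  destruct (Classical_Prop.classic (span l e)) as [[a Ha]|N].
  - exists C; split; auto. intros c.
    assert (E1 : vcomb c (e :: l) = vcomb (fun i => c (S i) + c O * a i) l).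
    { simpl. rewrite vcomb_plus, (vcomb_scal (c O) a), <- Ha. vec. }
    destruct (IH (fun i => c (S i) + c O * a i)) as [c' [E2 H2]].
    exists (fun i => match i with O => 0 | S i => c' i end). split.
    + rewrite E1, <- E2. simpl. change (fun i => c' i) with c'. vec.
    + rewrite E1. intros [|i] Hi.
      * rewrite Rabs_R0. apply Rmult_le_pos; auto. apply norm_ge_0.
      * apply H2. simpl in Hi; lia.
  - assert (exists d, 0 < d /\ forall x, span l x -> d <= norm (minus e x)) as [d [Pd Hd]].
    { destruct (Classical_Prop.classic
        (exists d, 0 < d /\ forall x, span l x -> d <= norm (minus e x))) as [|M]; auto.
      exfalso. apply N.
      assert (far : forall k, exists c, norm (minus e (vcomb c l)) <= (1/2) ^ k).
      { intros k. destruct (Classical_Prop.classic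
          (exists c, norm (minus e (vcomb c l)) <= (1/2) ^ k)) as [|M']; auto.
        exfalso. apply M. exists ((1/2) ^ k). split; [apply pow_lt; lra|].
        intros x [c ->]. destruct (Rle_dec ((1/2) ^ k) (norm (minus e (vcomb c l)))); auto.
        exfalso; apply M'; exists c; lra. }
      destruct (choice_function _ far) as [c Hc].
      assert (inc : forall k, exists b,
        vcomb b l = minus (vcomb (c (S k)) l) (vcomb (c k) l) /\
        forall i, (i < length l)%nat -> Rabs (b i) <= 2 * C * (1/2) ^ k).
      { intros k. destruct (IH (fun i => c (S k) i - c k i)) as [b [E1 H1]].
        exists b. rewrite vcomb_minus. split; auto. intros i Hi.
        eapply Rle_trans; [apply H1, Hi|]. rewrite <- vcomb_minus.
        assert (norm (minus (vcomb (c (S k)) l) (vcomb (c k) l)) <= 2 * (1/2) ^ k).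
        { replace (minus (vcomb (c (S k)) l) (vcomb (c k) l)) with
            (minus (minus e (vcomb (c k) l)) (minus e (vcomb (c (S k)) l))) by vec.
          eapply Rle_trans; [apply norm_minus_le; apply Hc|]. simpl.
          assert (0 <= (1/2) ^ k) by (apply pow_le; lra). lra. }
        nra. }
      destruct (choice_function _ inc) as [b Hb].
      set (s := fix s k i := match k with O => c O i | S k => s k i + b k i end : R).
      assert (Es : forall k, vcomb (s k) l = vcomb (c k) l).
      { induction k as [|k IHk]; auto.
        change (s (S k)) with (fun i => s k i + b k i).
        rewrite vcomb_plus, IHk, (proj1 (Hb k)). vec. }
      assert (lim : forall i, exists a, (i < length l)%nat -> forall k,
        Rabs (s k i - a) <= 4 * C * (1/2) ^ k).
      { intros i. destruct (Compare_dec.lt_dec i (length l)) as [Hi|]; [|exists 0; lia].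
        destruct (geometric_limit (W := R_CompleteNormedModule)
          (fun k => s k i) (2 * C) (1/2)) as [a Ha]; [lra| |].
        - intros k. change (Rabs (s k i + b k i - s k i) <= 2 * C * (1/2) ^ k).
          replace (s k i + b k i - s k i) with (b k i) by ring. now apply Hb.
        - exists a. intros _ k. eapply Rle_trans; [apply (Ha k)|]. right; field. }
      destruct (choice_function _ lim) as [a Ha].
      exists a. apply minus_zero_iff.
      apply le_of_pow_error with (1 + 4 * C * rsum norm l) (1/2); [lra| |].
      { assert (0 <= rsum norm l) by (apply rsum_ge_0, norm_ge_0). nra. }
      exists O. intros k _.
      replace (minus e (vcomb a l)) with
        (plus (minus e (vcomb (c k) l)) (minus (vcomb (s k) l) (vcomb a l)))
        by (rewrite Es; vec).
      eapply Rle_trans.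
      { apply norm_plus_le; [apply Hc|]. rewrite vcomb_minus.
        apply norm_vcomb; [|intros i Hi; apply Ha, Hi].
        assert (0 <= (1/2) ^ k) by (apply pow_le; lra). nra. }
      right; ring. }
    set (n := norm e).
    assert (Hn : 0 <= n) by apply norm_ge_0.
    assert (Hnd : 0 <= n / d) by (apply Rdiv_le_0_compat; lra).
    assert (Pi : 0 < / d) by now apply Rinv_0_lt_compat.
    exists (/ d + C * (1 + n / d)). split; [nra|].
    intros c. set (x := vcomb c (e :: l)).
    set (t := vcomb (fun i => c (S i)) l).
    assert (Ex : x = plus (scal (c O) e) t) by reflexivity.
    assert (Hx : 0 <= norm x) by apply norm_ge_0.
    assert (H0 : Rabs (c O) <= / d * norm x).
    { destruct (Req_dec (c O) 0) as [Z|Z].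
      - rewrite Z, Rabs_R0. nra.
      - assert (D : d <= norm (minus e (scal (- / c O) t))).
        { apply Hd, span_scal. now exists (fun i => c (S i)). }
        assert (Q : norm (minus e (scal (- / c O) t)) <= Rabs (/ c O) * norm x).
        { apply (norm_le_of_eq _ (scal (/ c O) x)); [|apply norm_scal_le].
          rewrite Ex, scal_distr_l, scal_assoc.
          change (mult (/ c O) (c O)) with (/ c O * c O). rewrite Rinv_l by auto.
          vec. }
        rewrite Rabs_inv in Q.
        assert (0 < Rabs (c O)) by now apply Rabs_pos_lt.
        assert (Rabs (c O) * d <= norm x).
        { apply Rle_trans with (Rabs (c O) * (/ Rabs (c O) * norm x)).
          - apply Rmult_le_compat_l; lra.
          - right; field; lra. }
        apply Rmult_le_reg_l with d; auto. rewrite <- Rmult_assoc, Rinv_r by lra. lra. }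
    assert (Ht : norm t <= (1 + n / d) * norm x).
    { replace t with (minus x (scal (c O) e)) by (rewrite Ex; vec).
      eapply Rle_trans; [apply norm_minus_le; [apply Rle_refl|apply norm_scal_le]|].
      fold n. assert (Rabs (c O) * n <= / d * norm x * n) by (apply Rmult_le_compat_r; auto).
      unfold Rdiv. nra. }
    destruct (IH (fun i => c (S i))) as [c' [E1 H1]]. fold t in E1, H1.
    exists (fun i => match i with O => c O | S i => c' i end). split.
    + simpl. change (fun i => c' i) with c'. now rewrite E1.
    + assert (P : 0 <= C * (1 + n / d) * norm x) by (repeat apply Rmult_le_pos; lra).
      assert (0 <= / d * norm x) by nra.
      rewrite Rmult_plus_distr_r.
      intros [|i] Hi; [lra|].
      assert (Rabs (c' i) <= C * norm t) by (apply H1; simpl in Hi; lia).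
      assert (C * norm t <= C * ((1 + n / d) * norm x)) by (apply Rmult_le_compat_l; lra).
      lra.
Qed.

Lemma vcomb_sum_n {E : ModuleSpace R_AbsRing} (c : nat -> R) (e : nat -> E) n :
  sum_n (fun i => scal (c i) (e i)) n = vcomb c (map e (seq 0 (S n))).
Proof.
  assert (H : forall m k, vcomb (fun i => c (k + i)%nat) (map e (seq k (S m)))
     = sum_n_m (fun i => scal (c i) (e i)) k (k + m)).
  { induction m as [|m IH]; intros k.
    - simpl. rewrite Nat.add_0_r, sum_n_n. apply plus_zero_r.
    - rewrite sum_Sn_m by lia.
      change (plus (scal (c (k + 0)%nat) (e k))
                (vcomb (fun i => c (k + S i)%nat) (map e (seq (S k) (S m)))) =
              plus (scal (c k) (e k))
                (sum_n_m (fun i => scal (c i) (e i)) (S k) (k + S m))).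
      rewrite Nat.add_0_r. f_equal.
      transitivity (vcomb (fun i => c (S k + i)%nat) (map e (seq (S k) (S m)))).
      + apply vcomb_ext; intros; f_equal; lia.
      + rewrite IH. f_equal; lia. }
  symmetry. apply (H n O).
Qed.

Section SpanModule.
Context {E : ModuleSpace R_AbsRing} (l : list E).

Let T : Type := { x : E | span l x }.

Lemma sub_eq (x y : T) : proj1_sig x = proj1_sig y -> x = y.
Proof. destruct x, y; simpl; intros ->; f_equal; apply proof_irrelevance. Qed.

Definition span_AbelianMonoid : AbelianMonoid.
Proof.
  apply (AbelianMonoid.Pack T); [|exact T].
  apply (AbelianMonoid.Mixin T
    (fun x y => exist _ _ (span_plus l _ _ (proj2_sig x) (proj2_sig y)))
    (exist _ _ (span_zero l)));
    intros; apply sub_eq; simpl; vec.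
Defined.

Definition span_AbelianGroup : AbelianGroup.
Proof.
  apply (AbelianGroup.Pack T); [|exact T].
  apply (AbelianGroup.Class T (AbelianMonoid.class span_AbelianMonoid)).
  apply (AbelianGroup.Mixin span_AbelianMonoid
    (fun x => exist _ _ (span_opp l _ (proj2_sig x)))).
  intros; apply sub_eq; simpl; vec.
Defined.

(** The universal property of the tensor square is stated for maps into spaces,
    so a span has to be made into one before tensors can be mapped to it. *)
Definition span_module : ModuleSpace R_AbsRing.
Proof.
  apply (ModuleSpace.Pack R_AbsRing T); [|exact T].
  apply (ModuleSpace.Class R_AbsRing T (AbelianGroup.class span_AbelianGroup)).
  apply (ModuleSpace.Mixin R_AbsRing span_AbelianGroup
    (fun k x => exist _ _ (span_scal l k _ (proj2_sig x))));
    intros; apply sub_eq; simpl.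
  - apply scal_assoc.
  - apply (@scal_one R_AbsRing E).
  - apply (@scal_distr_l R_AbsRing E).
  - apply (@scal_distr_r R_AbsRing E).
Defined.
End SpanModule.

Section Tensor.
Context {V VV : NormedSpace} (tens : V -> V -> VV).
Hypothesis HV : finite_dim V.
Hypothesis Ht : is_tensor_square tens.

Lemma linear_map_comb {A B : ModuleSpace R_AbsRing} (f : A -> B) (c : nat -> R) l :
  linear_map f -> f (vcomb c l) = vcomb c (map f l).
Proof.
  intros [Hp Hs]. revert c. induction l as [|x l IH]; intros c; simpl.
  - transitivity (f (scal 0 zero)).
    + f_equal. symmetry. apply (@scal_zero_r R_AbsRing A).
    + rewrite Hs. apply (@scal_zero_l R_AbsRing B).
  - now rewrite Hp, Hs, IH.
Qed.

Lemma span_image {A B : ModuleSpace R_AbsRing} (f : A -> B) l m x :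
  linear_map f -> (forall y, In y l -> span m (f y)) -> span l x -> span m (f x).
Proof.
  intros Hf H [c ->]. rewrite (linear_map_comb f c l Hf).
  revert c. induction l as [|y l IH]; intros c; simpl; [apply span_zero|].
  apply span_plus; [apply span_scal, H; now left|].
  apply IH. intros z Hz; apply H; now right.
Qed.

(** The span [S] of the products of spanning vectors contains all pure tensors,
    so the identity of [VV] and the map lifted through [S] both extend [tens];
    by uniqueness they agree, and [S] is everything. *)
Lemma tensors_span :
  exists l : list (V * V), forall x : VV,
    span (map (fun p => tens (fst p) (snd p)) l) x.
Proof.
  destruct HV as (n & e & He). destruct Ht as [Hb Hu].
  set (l0 := map e (seq 0 (S n))).
  assert (H0 : forall v, span l0 v).
  { intros v. destruct (He v) as [c ->]. exists c. apply (vcomb_sum_n (E := V)). }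
  exists (list_prod l0 l0).
  set (m := map (fun p => tens (fst p) (snd p)) (list_prod l0 l0)).
  assert (Hpure : forall v w, span m (tens v w)).
  { intros v w.
    apply (span_image (fun v => tens v w) l0 m v (proj1 Hb w)); auto.
    intros y Hy. apply (span_image (tens y) l0 m w (proj2 Hb y)); auto.
    intros z Hz. apply span_in. unfold m.
    change (tens y z) with ((fun p => tens (fst p) (snd p)) (y, z)).
    apply in_map. now apply in_prod. }
  set (S := span_module m).
  destruct (Hu S (fun v w => exist _ _ (Hpure v w))) as [f [[Hf Hft] _]].
  { split; intros v; split; intros; apply sub_eq; simpl; apply Hb. }
  destruct (Hu VV tens Hb) as [g [_ Hg]].
  intros x.
  assert (Eid : x = g x).
  { apply (Hg (fun x => x)); [split; auto|auto]. }
  assert (Ef : proj1_sig (f x) = g x).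
  { apply (Hg (fun x => proj1_sig (f x))).
    - destruct Hf as [Hp Hs]. split; intros; [now rewrite Hp|now rewrite Hs].
    - intros v w. now rewrite Hft. }
  rewrite Eid, <- Ef. apply (proj2_sig (f x)).
Qed.

Lemma tens_lift_spec {E : ModuleSpace R_AbsRing} (b : V -> V -> E) :
  bilinear_map b ->
  linear_map (tens_lift tens b) /\ forall v w, tens_lift tens b (tens v w) = b v w.
Proof.
  intros Hb. unfold tens_lift. apply epsilon_spec.
  destruct (proj2 Ht E b Hb) as [l [Hl _]]. now exists l.
Qed.

Lemma tens_lift_unique {E : ModuleSpace R_AbsRing} (b : V -> V -> E) (f : VV -> E) :
  bilinear_map b -> linear_map f -> (forall v w, f (tens v w) = b v w) ->
  forall x, tens_lift tens b x = f x.
Proof.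
  intros Hb Hf Hfb x. destruct (proj2 Ht E b Hb) as [g [_ Hg]].
  destruct (tens_lift_spec b Hb). rewrite (Hg _ Hf Hfb). now apply Hg.
Qed.

Lemma tens_lift_bound : exists C, 0 <= C /\
  forall (E : NormedSpace) (b : V -> V -> E) M, bilinear_map b -> 0 <= M ->
    (forall v w, norm (b v w) <= M * norm v * norm w) ->
    forall x, norm (tens_lift tens b x) <= C * M * norm x.
Proof.
  destruct tensors_span as [l Hl].
  set (m := map (fun p => tens (fst p) (snd p)) l) in *.
  destruct (bounded_coefficients m) as [C [HC Hc]].
  set (s := rsum (fun p => norm (fst p) * norm (snd p)) l).
  assert (Hs : 0 <= s).
  { apply rsum_ge_0. intros p. apply Rmult_le_pos; apply norm_ge_0. }
  exists (C * s). split; [nra|].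
  intros E b M Hb HM Hbound x. destruct (Hl x) as [c0 E0].
  destruct (Hc c0) as [c [E1 H1]]. rewrite <- E0 in E1, H1.
  destruct (tens_lift_spec b Hb) as [Hlin Hpure].
  assert (Hx := norm_ge_0 x).
  rewrite <- E1 at 1. rewrite (linear_map_comb _ _ _ Hlin).
  eapply Rle_trans.
  { apply (norm_vcomb c _ (C * norm x)); [nra|]. unfold m. rewrite !length_map.
    intros i Hi. apply H1. unfold m. now rewrite length_map. }
  assert (B : rsum norm (map (tens_lift tens b) m) <= M * s).
  { unfold m, s. clear -Hpure Hbound. induction l as [|p l IH]; cbn [map rsum].
    - rewrite Rmult_0_r. apply Rle_refl.
    - rewrite Hpure. specialize (Hbound (fst p) (snd p)). lra. }
  replace (C * s * M * norm x) with (C * norm x * (M * s)) by ring.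
  apply Rmult_le_compat_l; [nra|exact B].
Qed.

Section Contraction.
Context {U W : NormedSpace}.
Notation BB := (lin U (lin_NormedModule U W)).

(** The second-order terms of the equation all have this form: the linear map
    induced by [b] precomposed with [P] and [Q], at an element of the tensor
    square. *)
Definition contract (b : BB) (P Q : lin V U) (x : VV) : W :=
  tens_lift tens (fun v w => (b (P v) : lin U W) (Q w)) x.

Lemma contract_bilinear (b : BB) (P Q : lin V U) :
  bilinear_map (fun v w => (b (P v) : lin U W) (Q w)).
Proof.
  assert (H1 : forall (y v w : V), (b (P (plus v w)) : lin U W) (Q y) =
    plus ((b (P v) : lin U W) (Q y)) ((b (P w) : lin U W) (Q y))).
  { intros. now rewrite lin_plus_arg, (lin_plus_arg b). }
  assert (H2 : forall (y : V) k (v : V), (b (P (scal k v)) : lin U W) (Q y) =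
    scal k ((b (P v) : lin U W) (Q y))).
  { intros. now rewrite lin_scal_arg, (lin_scal_arg b). }
  assert (H3 : forall (y v w : V), (b (P y) : lin U W) (Q (plus v w)) =
    plus ((b (P y) : lin U W) (Q v)) ((b (P y) : lin U W) (Q w))).
  { intros. now rewrite !lin_plus_arg. }
  assert (H4 : forall (y : V) k (v : V), (b (P y) : lin U W) (Q (scal k v)) =
    scal k ((b (P y) : lin U W) (Q v))).
  { intros. now rewrite !lin_scal_arg. }
  split; intros y; split; [exact (H1 y)|exact (H2 y)|exact (H3 y)|exact (H4 y)].
Qed.

Lemma contract_tens b P Q v w : contract b P Q (tens v w) = (b (P v) : lin U W) (Q w).
Proof. apply (proj2 (tens_lift_spec _ (contract_bilinear b P Q))). Qed.

Lemma contract_linear b P Q : linear_map (contract b P Q).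
Proof. apply (proj1 (tens_lift_spec _ (contract_bilinear b P Q))). Qed.

Lemma contract_plus b P Q x y :
  contract b P Q (plus x y) = plus (contract b P Q x) (contract b P Q y).
Proof. apply contract_linear. Qed.

Lemma linear_map_minus {A B : NormedSpace} (f : A -> B) x y :
  linear_map f -> f (minus x y) = minus (f x) (f y).
Proof.
  intros [Hp Hs]. replace (minus x y) with (plus x (scal (-1) y)) by vec.
  rewrite Hp, Hs. vec.
Qed.

Lemma contract_minus b P Q x y :
  contract b P Q (minus x y) = minus (contract b P Q x) (contract b P Q y).
Proof. apply linear_map_minus, contract_linear. Qed.

Lemma linear_map_sub {A B : NormedSpace} (f g : A -> B) :
  linear_map f -> linear_map g -> linear_map (fun x => minus (f x) (g x)).
Proof.
  intros [Fp Fs] [Gp Gs]. split; intros.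
  - rewrite Fp, Gp. vec.
  - rewrite Fs, Gs. vec.
Qed.

Lemma contract_minus_b b b' P Q x :
  contract (minus b b') P Q x = minus (contract b P Q x) (contract b' P Q x).
Proof.
  apply tens_lift_unique with (f := fun x => minus (contract b P Q x) (contract b' P Q x)).
  - apply contract_bilinear.
  - apply linear_map_sub; apply contract_linear.
  - intros v w. now rewrite !contract_tens.
Qed.

Lemma contract_minus_1 b P P' Q x :
  contract b (minus P P') Q x = minus (contract b P Q x) (contract b P' Q x).
Proof.
  apply tens_lift_unique with (f := fun x => minus (contract b P Q x) (contract b P' Q x)).
  - apply contract_bilinear.
  - apply linear_map_sub; apply contract_linear.
  - intros v w. rewrite !contract_tens.
    change (minus P P' v) with (minus (P v) (P' v)). now rewrite (lin_minus_arg b).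
Qed.

Lemma contract_minus_2 b P Q Q' x :
  contract b P (minus Q Q') x = minus (contract b P Q x) (contract b P Q' x).
Proof.
  apply tens_lift_unique with (f := fun x => minus (contract b P Q x) (contract b P Q' x)).
  - apply contract_bilinear.
  - apply linear_map_sub; apply contract_linear.
  - intros v w. rewrite !contract_tens.
    change (minus Q Q' w) with (minus (Q w) (Q' w)). now rewrite lin_minus_arg.
Qed.

Definition contract_bounded (C : R) : Prop :=
  forall (b : BB) (P Q : lin V U) (x : VV) mb mP mQ mx,
    norm b <= mb -> norm P <= mP -> norm Q <= mQ -> norm x <= mx ->
    norm (contract b P Q x) <= C * (mb * mP * mQ * mx).

Lemma contract_pair_bound C b b' mb db P P' mP dP Q Q' mQ dQ x x' mx dx :
  contract_bounded C ->
  pair_bound mb db b b' -> pair_bound mP dP P P' -> pair_bound mQ dQ Q Q' ->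
  pair_bound mx dx x x' ->
  pair_bound (C * (mb * mP * mQ * mx))
    (C * (db * mP * mQ * mx) + C * (mb * dP * mQ * mx) + C * (mb * mP * dQ * mx) +
     C * (mb * mP * mQ * dx))
    (contract b P Q x) (contract b' P' Q' x').
Proof.
  intros HC (b1 & b2 & b3) (P1 & P2 & P3) (Q1 & Q2 & Q3) (x1 & x2 & x3).
  repeat split; try now apply HC.
  replace (minus (contract b P Q x) (contract b' P' Q' x')) with
    (plus (plus (plus (contract (minus b b') P Q x) (contract b' (minus P P') Q x))
                (contract b' P' (minus Q Q') x))
          (contract b' P' Q' (minus x x'))).
  - repeat apply norm_plus_le; now apply HC.
  - rewrite contract_minus, contract_minus_b, contract_minus_1, contract_minus_2. vec.
Qed.
End Contraction.

Lemma contract_bound_exists (U W : NormedSpace) :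
  exists C, 0 <= C /\ @contract_bounded U W C.
Proof.
  destruct tens_lift_bound as [C [HC H]]. exists C; split; auto.
  intros b P Q x mb mP mQ mx Hb HP HQ Hx.
  assert (0 <= mb) by exact (norm_le_ge_0 _ _ Hb).
  assert (0 <= mP) by exact (norm_le_ge_0 _ _ HP).
  assert (0 <= mQ) by exact (norm_le_ge_0 _ _ HQ).
  assert (0 <= mx) by exact (norm_le_ge_0 _ _ Hx).
  eapply Rle_trans.
  { apply (H W _ (mb * mP * mQ)).
    - apply contract_bilinear.
    - repeat apply Rmult_le_pos; auto.
    - intros v w.
      replace (mb * mP * mQ * norm v * norm w) with (mb * (mP * norm v) * (mQ * norm w)) by ring.
      apply norm_app_le; [|apply norm_app_le; auto; apply Rle_refl].
      apply norm_app_le; auto. apply norm_app_le; auto; apply Rle_refl. }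
  rewrite Rmult_assoc. apply Rmult_le_compat_l; auto.
  apply Rmult_le_compat_l; auto. repeat apply Rmult_le_pos; auto.
Qed.
End Tensor.

(** * Powers of interval lengths and discrete sewing *)

(** As [Rpower 0 a = 1], bounds by powers of [t - s] would say nothing for
    [s = t]; with the value [0] they hold on the diagonal as well. *)
Definition pw (a x : R) : R := if Rle_dec x 0 then 0 else Rpower x a.

Lemma pw_pos a x : 0 < x -> pw a x = Rpower x a.
Proof. intros H. unfold pw. destruct (Rle_dec x 0); auto; lra. Qed.

Lemma pw_zero a : pw a 0 = 0.
Proof. unfold pw. destruct (Rle_dec 0 0); auto; lra. Qed.

Lemma Rpower_gt_0 x a : 0 < Rpower x a.
Proof. apply exp_pos. Qed.

Lemma pw_ge_0 a x : 0 <= pw a x.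
Proof. unfold pw. destruct (Rle_dec x 0); [lra|]. apply Rlt_le, Rpower_gt_0. Qed.

Lemma Rpower_mono a x y : 0 <= a -> 0 < x -> x <= y -> Rpower x a <= Rpower y a.
Proof. intros Ha Hx Hxy. now apply Rle_Rpower_l. Qed.

Lemma pw_mono a x y : 0 <= a -> x <= y -> pw a x <= pw a y.
Proof.
  intros Ha H. destruct (Rle_dec x 0) as [L|L].
  - unfold pw at 1. destruct (Rle_dec x 0); [apply pw_ge_0|lra].
  - rewrite !pw_pos by lra. apply Rpower_mono; lra.
Qed.

Lemma pw_mult a c x : 0 < c -> pw a (c * x) = Rpower c a * pw a x.
Proof.
  intros Hc. destruct (Rle_dec x 0) as [L|L].
  - unfold pw. destruct (Rle_dec (c * x) 0); [|nra]. destruct (Rle_dec x 0); [ring|lra].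
  - rewrite !pw_pos by nra. symmetry. apply Rpower_mult_distr; lra.
Qed.

Lemma pw_le_1 a x : 0 <= a -> x <= 1 -> pw a x <= 1.
Proof.
  intros Ha H. apply Rle_trans with (pw a 1); [now apply pw_mono|].
  rewrite pw_pos by lra. unfold Rpower. rewrite ln_1, Rmult_0_r, exp_0. lra.
Qed.

Lemma Rpower_pow_nat x a n : Rpower x a ^ n = Rpower x (INR n * a).
Proof.
  induction n as [|n IH].
  - simpl. unfold Rpower. rewrite Rmult_0_l, Rmult_0_l, exp_0. reflexivity.
  - cbn [pow]. rewrite IH, <- Rpower_plus. f_equal. rewrite S_INR. ring.
Qed.

Lemma pw_sqr a x : pw a x ^ 2 = pw (2 * a) x.
Proof.
  unfold pw. destruct (Rle_dec x 0); [ring|]. rewrite Rpower_pow_nat. f_equal.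
Qed.

Lemma pw_cube a x : pw a x ^ 3 = pw (3 * a) x.
Proof.
  unfold pw. destruct (Rle_dec x 0); [ring|]. rewrite Rpower_pow_nat. f_equal.
  simpl; ring.
Qed.

Lemma Rpower_anti x a b : 0 < x <= 1 -> a <= b -> Rpower x b <= Rpower x a.
Proof.
  intros Hx Hab. unfold Rpower. 
  assert (ln x <= 0).
  { destruct (Req_dec x 1) as [->|]; [rewrite ln_1; lra|].
    rewrite <- ln_1. apply Rlt_le, ln_increasing; lra. }
  destruct (Req_dec (b * ln x) (a * ln x)) as [->|]; [lra|].
  apply Rlt_le, exp_increasing. nra.
Qed.

Lemma pw_anti a b x : x <= 1 -> a <= b -> pw b x <= pw a x.
Proof.
  intros Hx Hab. unfold pw. destruct (Rle_dec x 0); [lra|]. apply Rpower_anti; lra.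
Qed.

Lemma le_pw_sqr a x : a <= 1 / 2 -> x <= 1 -> x <= pw a x ^ 2.
Proof.
  intros Ha Hx. rewrite pw_sqr. destruct (Rle_dec x 0) as [L|L].
  - generalize (pw_ge_0 (2 * a) x); lra.
  - apply Rle_trans with (pw 1 x); [|apply pw_anti; lra].
    rewrite pw_pos by lra. rewrite Rpower_1; lra.
Qed.

(** The cube of [min 1 c] works for all exponents from [1/3] on at once, which
    is what keeps constants uniform in the Hölder exponent. *)
Lemma pw_small c : 0 < c -> exists delta, 0 < delta <= 1 /\
  forall a, 1 / 3 <= a -> pw a delta <= c.
Proof.
  intros Hc. set (d := Rmin 1 c). exists (d ^ 3).
  assert (Hd : 0 < d) by (apply Rmin_pos; lra).
  assert (Hd1 : d <= 1) by apply Rmin_l.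
  assert (Hd2 : d <= c) by apply Rmin_r.
  assert (P : 0 < d ^ 3) by now apply pow_lt.
  assert (Hle : d ^ 3 <= 1).
  { replace 1 with (1 ^ 3) by ring. apply pow_incr; lra. }
  split; [lra|].
  intros a Ha. apply Rle_trans with (pw (1 / 3) (d ^ 3)).
  - apply pw_anti; lra.
  - rewrite pw_pos by lra. rewrite <- Rpower_pow by lra. rewrite Rpower_mult.
    simpl INR. replace ((1 + 1 + 1) * (1 / 3)) with 1 by field.
    rewrite Rpower_1; lra.
Qed.

Lemma INR_half_le g m : (2 * m <= g)%nat -> INR m <= INR g / 2.
Proof.
  intros H. apply le_INR in H. rewrite mult_INR in H. simpl INR in H. lra.
Qed.

(** Splitting [i..k] into two blocks of at most half the length and one step in
    between produces two defects; since [2 w(x/2) <= q w(x)] with [q < 1], the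
    contributions of the halves leave room for them. *)
Lemma discrete_sewing {E : NormedSpace} (A : nat -> nat -> E) (w : R -> R) h C e q i0 k0 :
  0 <= h -> 0 <= C -> 0 <= q < 1 -> (forall x, 0 <= w x) ->
  (forall x y, x <= y -> w x <= w y) -> (forall x, 0 <= x -> 2 * w (x / 2) <= q * w x) ->
  (forall i, (i0 <= i <= k0)%nat -> A i i = zero) ->
  (forall i j k, (i0 <= i)%nat -> (i < j < k)%nat -> (k <= k0)%nat ->
     norm (minus (A i k) (plus (A i j) (A j k))) <= C * w (INR (k - i) * h)) ->
  (forall i, (i0 <= i < k0)%nat -> norm (A i (S i)) <= e) ->
  forall i k, (i0 <= i)%nat -> (i <= k)%nat -> (k <= k0)%nat ->
    norm (A i k) <= 2 / (1 - q) * C * w (INR (k - i) * h) + e * INR (k - i).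
Proof.
  intros Hh HC Hq W0 Wm Wh A0 HA Hstep.
  set (S := 2 / (1 - q)).
  assert (HS : 0 <= S) by (apply Rdiv_le_0_compat; lra).
  assert (ES : S * (1 - q) = 2) by (unfold S; field; lra).
  assert (HSC : 0 <= S * C) by nra.
  assert (main : forall g i k, (k - i = g)%nat -> (i0 <= i)%nat -> (i <= k)%nat -> (k <= k0)%nat ->
    norm (A i k) <= S * C * w (INR g * h) + e * INR g).
  2: { intros; now apply main. }
  induction g as [g IH] using (well_founded_induction Wf_nat.lt_wf).
  intros i k Hg Hi Hik Hk.
  destruct (Nat.eq_dec g 0) as [Z|Z].
  { replace k with i by lia. rewrite A0 by lia. rewrite norm_zero_eq.
    subst g. replace (k - i)%nat with 0%nat by lia. simpl.
    rewrite Rmult_0_l, Rmult_0_r. specialize (W0 0). nra. }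
  destruct (Nat.eq_dec g 1) as [O|O].
  { replace k with (Datatypes.S i) by lia. rewrite O. simpl INR.
    specialize (Hstep i). specialize (W0 (1 * h)).
    assert (norm (A i (Datatypes.S i)) <= e) by (apply Hstep; lia). nra. }
  set (m := (i + g / 2)%nat).
  assert (Hm : (2 * (g / 2) <= g)%nat) by (apply Nat.Div0.mul_div_le).
  assert (Hm' : (g < 2 * Datatypes.S (g / 2))%nat) by (apply Nat.mul_succ_div_gt; lia).
  assert (B1 : norm (A i m) <= S * C * w (INR (g / 2) * h) + e * INR (g / 2)).
  { apply IH; unfold m; lia. }
  set (g2 := (k - Datatypes.S m)%nat).
  assert (B2 : norm (A (Datatypes.S m) k) <= S * C * w (INR g2 * h) + e * INR g2).
  { apply IH; unfold g2, m; lia. }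
  assert (B3 : norm (A m (Datatypes.S m)) <= e) by (apply Hstep; unfold m; lia).
  assert (D1 : norm (minus (A i k) (plus (A i m) (A m k))) <= C * w (INR g * h)).
  { rewrite <- Hg. apply HA; unfold m; lia. }
  assert (D2 : norm (minus (A m k) (plus (A m (Datatypes.S m)) (A (Datatypes.S m) k)))
      <= C * w (INR g * h)).
  { destruct (Nat.eq_dec (Datatypes.S m) k) as [Ek|Ek].
    - rewrite <- Ek, A0 by (unfold m; lia).
      apply (norm_le_of_eq _ zero); [vec|]. rewrite norm_zero_eq.
      apply Rmult_le_pos; auto.
    - eapply Rle_trans; [apply HA; unfold m in *; lia|].
      apply Rmult_le_compat_l; auto. apply Wm. apply Rmult_le_compat_r; auto.
      apply le_INR. unfold m; lia. }
  assert (Hx : 0 <= INR g * h) by (apply Rmult_le_pos; auto; apply pos_INR).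
  assert (W1 : w (INR (g / 2) * h) <= w (INR g * h / 2)).
  { apply Wm. generalize (INR_half_le g (g / 2) Hm). nra. }
  assert (W2 : w (INR g2 * h) <= w (INR g * h / 2)).
  { apply Wm. assert (H2 : (2 * g2 <= g)%nat) by (unfold g2, m; lia).
    generalize (INR_half_le g g2 H2). nra. }
  assert (Wq := Wh _ Hx).
  assert (EI : INR g = INR (g / 2) + 1 + INR g2).
  { replace g with (g / 2 + 1 + g2)%nat at 1 by (unfold g2, m; lia).
    rewrite !plus_INR. simpl. ring. }
  replace (A i k) with
    (plus (plus (minus (A i k) (plus (A i m) (A m k)))
                (minus (A m k) (plus (A m (Datatypes.S m)) (A (Datatypes.S m) k))))
          (plus (plus (A i m) (A m (Datatypes.S m))) (A (Datatypes.S m) k))) by vec.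
  eapply Rle_trans.
  { apply norm_plus_le.
    - apply norm_plus_le; [apply D1|apply D2].
    - apply norm_plus_le; [|apply B2]. apply norm_plus_le; [apply B1|apply B3]. }
  assert (S * C * w (INR (g / 2) * h) + S * C * w (INR g2 * h) <= S * C * (q * w (INR g * h))).
  { apply Rle_trans with (S * C * (2 * w (INR g * h / 2))).
    - assert (S * C * w (INR (g / 2) * h) <= S * C * w (INR g * h / 2))
        by (apply Rmult_le_compat_l; auto).
      assert (S * C * w (INR g2 * h) <= S * C * w (INR g * h / 2))
        by (apply Rmult_le_compat_l; auto). lra.
    - apply Rmult_le_compat_l; auto. }
  assert (E2 : S * C * w (INR g * h) = S * C * (q * w (INR g * h)) + 2 * C * w (INR g * h)).
  { rewrite <- ES. ring. }
  rewrite E2, EI. rewrite EI in H. lra.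
Qed.

(** * Local stability of approximate solutions *)

Definition dlt {I : Type} {A : NormedSpace} (X : I -> A) (s t : I) : A :=
  minus (X t) (X s).

Lemma pair_bound_compose {A B : NormedSpace} (f f' : A -> B) m d k e b b' :
  (forall x y, f' (minus x y) = minus (f' x) (f' y)) ->
  (forall x, norm (f x) <= k * norm x) -> (forall x, norm (f' x) <= k * norm x) ->
  (forall x, norm (minus (f x) (f' x)) <= e * norm x) -> 0 <= k -> 0 <= e ->
  pair_bound m d b b' -> pair_bound (k * m) (e * m + k * d) (f b) (f' b').
Proof.
  intros Hl Hf Hf' Hd Hk He (H1 & H2 & H3). repeat split.
  - eapply Rle_trans; [apply Hf|]. now apply Rmult_le_compat_l.
  - eapply Rle_trans; [apply Hf'|]. now apply Rmult_le_compat_l.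
  - replace (minus (f b) (f' b')) with (plus (minus (f b) (f' b)) (minus (f' b) (f' b'))) by vec.
    apply norm_plus_le.
    + eapply Rle_trans; [apply Hd|]. now apply Rmult_le_compat_l.
    + rewrite <- Hl. eapply Rle_trans; [apply Hf'|]. now apply Rmult_le_compat_l.
Qed.

Section Stability.
Context {U W : NormedSpace} (F : W -> lin U W) (F0 : W -> W).
Notation BB := (lin_NormedModule U (lin_NormedModule U W)).
Context {I : Type}.
Implicit Types (Z : I -> U) (ZZ : I -> I -> BB -> W) (Y D : I -> W).

(** A path [Z] in [U] enters the equation through its increments and through
    [ZZ s t b], the second-order iterated integral of [Z] tested against the
    bilinear map [b].  The defect in Chen's relation need not vanish, as [ZZ] is
    built from the Gubinelli derivative frozen at the left end point. *)
Definition chen_defect Z ZZ (s u t : I) (b : BB) : W :=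
  minus (minus (minus (ZZ s t b) (ZZ s u b)) (ZZ u t b))
        ((b (dlt Z s u) : lin U W) (dlt Z u t)).

Definition germ Z ZZ Y (s t : I) : W :=
  plus (F (Y s) (dlt Z s t)) (ZZ s t (second_field F (Y s))).

Definition first_rem Z Y (s t : I) : W :=
  minus (dlt Y s t) (F (Y s) (dlt Z s t)).

Lemma germ_defect Z ZZ Y s u t :
  (forall x y, ZZ u t (minus x y) = minus (ZZ u t x) (ZZ u t y)) ->
  minus (plus (germ Z ZZ Y s u) (germ Z ZZ Y u t)) (germ Z ZZ Y s t) =
  plus (plus (taylor_rem F (Fderive F) (Y s) (Y u) (dlt Z u t))
             ((Fderive F (Y s) (first_rem Z Y s u) : lin U W) (dlt Z u t)))
       (minus (ZZ u t (minus (second_field F (Y u)) (second_field F (Y s))))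
              (chen_defect Z ZZ s u t (second_field F (Y s)))).
Proof.
  intros Hl. rewrite Hl. unfold chen_defect, germ, first_rem, taylor_rem.
  change ((second_field F (Y s) (dlt Z s u) : lin U W) (dlt Z u t))
    with ((Fderive F (Y s) (F (Y s) (dlt Z s u)) : lin U W) (dlt Z u t)).
  rewrite (lin_minus_arg (Fderive F (Y s)) (dlt Y s u)).
  change (minus (minus (F (Y u)) (F (Y s))) (Fderive F (Y s) (minus (Y u) (Y s))) (dlt Z u t))
    with (minus (minus (F (Y u) (dlt Z u t)) (F (Y s) (dlt Z u t)))
                ((Fderive F (Y s) (minus (Y u) (Y s)) : lin U W) (dlt Z u t))).
  change (minus (Fderive F (Y s) (dlt Y s u)) (Fderive F (Y s) (F (Y s) (dlt Z s u))) (dlt Z u t))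
    with (minus ((Fderive F (Y s) (dlt Y s u) : lin U W) (dlt Z u t))
                ((Fderive F (Y s) (F (Y s) (dlt Z s u)) : lin U W) (dlt Z u t))).
  change (dlt Y s u) with (minus (Y u) (Y s)).
  replace (dlt Z s t) with (plus (dlt Z s u) (dlt Z u t)) by (unfold dlt; vec).
  rewrite (lin_plus_arg (F (Y s))). vec.
Qed.

(** Times are indexed by an abstract type, so that the same estimates serve
    continuous time and the grids of the Euler scheme; [p] stands for the modulus
    [h |-> h ^ alpha].  Bounds on [ZZ] are required against every [b], linearly
    in its norm, because [b] is the value of [second_field F] along a path. *)
Record driver_pair (tau : I -> R) (In : I -> Prop) (p : R -> R) (K eps : R)
    Z Z' ZZ ZZ' : Prop := {
  dp_eps : 0 <= eps;
  dp_Z : forall s t, In s -> In t -> tau s <= tau t ->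
    pair_bound (K * p (tau t - tau s)) (eps * p (tau t - tau s)) (dlt Z s t) (dlt Z' s t);
  dp_lin : forall s t x y, ZZ s t (minus x y) = minus (ZZ s t x) (ZZ s t y);
  dp_lin' : forall s t x y, ZZ' s t (minus x y) = minus (ZZ' s t x) (ZZ' s t y);
  dp_ZZ : forall s t b, In s -> In t -> tau s <= tau t ->
    pair_bound (K * p (tau t - tau s) ^ 2 * norm b) (eps * p (tau t - tau s) ^ 2 * norm b)
      (ZZ s t b) (ZZ' s t b);
  dp_N : forall s u t b, In s -> In u -> In t -> tau s <= tau u <= tau t ->
    pair_bound (K * p (tau t - tau s) ^ 3 * norm b) (eps * p (tau t - tau s) ^ 3 * norm b)
      (chen_defect Z ZZ s u t b) (chen_defect Z' ZZ' s u t b)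
}.

Arguments dp_eps {tau In p K eps Z Z' ZZ ZZ'}.
Arguments dp_Z {tau In p K eps Z Z' ZZ ZZ'}.
Arguments dp_lin {tau In p K eps Z Z' ZZ ZZ'}.
Arguments dp_lin' {tau In p K eps Z Z' ZZ ZZ'}.
Arguments dp_ZZ {tau In p K eps Z Z' ZZ ZZ'}.
Arguments dp_N {tau In p K eps Z Z' ZZ ZZ'}.

Section Defect.
Context (tau : I -> R) (In : I -> Prop) (p : R -> R) (K eps : R)
  (Z Z' : I -> U) (ZZ ZZ' : I -> I -> BB -> W) (Y Y' : I -> W).
Hypothesis HF : smooth K F F0.
Hypothesis HZ : driver_pair tau In p K eps Z Z' ZZ ZZ'.
Hypothesis Hp : forall x, 0 <= p x.
Hypothesis Hpm : forall x y, x <= y -> p x <= p y.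

Lemma second_order_pair_bound s t m d b b' :
  In s -> In t -> tau s <= tau t -> pair_bound m d b b' ->
  pair_bound (K * p (tau t - tau s) ^ 2 * m)
    (eps * p (tau t - tau s) ^ 2 * m + K * p (tau t - tau s) ^ 2 * d)
    (ZZ s t b) (ZZ' s t b').
Proof.
  intros Hs Ht Hst Hb. assert (P2 := pow2_ge_0 (p (tau t - tau s))).
  assert (HK := sm_K HF). assert (He := dp_eps HZ).
  apply (pair_bound_compose (A := BB)); auto; try nra;
    try (intros x; apply (dp_ZZ HZ s t x Hs Ht Hst)).
  apply (dp_lin' HZ).
Qed.

Lemma chen_defect_minus s u t b b' :
  chen_defect Z' ZZ' s u t (minus b b') =
  minus (chen_defect Z' ZZ' s u t b) (chen_defect Z' ZZ' s u t b').
Proof.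
  unfold chen_defect. rewrite !(dp_lin' HZ).
  change ((minus b b' (dlt Z' s u) : lin U W) (dlt Z' u t)) with
    (minus ((b (dlt Z' s u) : lin U W) (dlt Z' u t)) ((b' (dlt Z' s u) : lin U W) (dlt Z' u t))).
  vec.
Qed.

Lemma chen_defect_pair_bound s u t m d b b' :
  In s -> In u -> In t -> tau s <= tau u <= tau t -> pair_bound m d b b' ->
  pair_bound (K * p (tau t - tau s) ^ 3 * m)
    (eps * p (tau t - tau s) ^ 3 * m + K * p (tau t - tau s) ^ 3 * d)
    (chen_defect Z ZZ s u t b) (chen_defect Z' ZZ' s u t b').
Proof.
  intros Hs Hu Ht Hst Hb. assert (P3 := pow_le (p (tau t - tau s)) 3 (Hp _)).
  assert (HK := sm_K HF). assert (He := dp_eps HZ).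
  apply (pair_bound_compose (A := BB)); auto; try nra;
    try (intros x; apply (dp_N HZ s u t x Hs Hu Ht Hst)).
  apply chen_defect_minus.
Qed.

(** Each of the four terms of [germ_defect] is a product of factors of total
    order three in [p]; [pair_bound] yields the size of the defect and its
    Lipschitz dependence on paths and drivers in one traversal. *)
Lemma germ_defect_pair_bound s u t rho drho kap eta Q :
  In s -> In u -> In t -> tau s <= tau u <= tau t ->
  norm (minus (Y s) (Y' s)) <= Q -> 0 <= kap -> 0 <= eta -> 0 <= rho -> 0 <= drho ->
  pair_bound (kap * p (tau u - tau s)) (eta * p (tau u - tau s)) (dlt Y s u) (dlt Y' s u) ->
  pair_bound (rho * p (tau u - tau s) ^ 2) (drho * p (tau u - tau s) ^ 2)
    (first_rem Z Y s u) (first_rem Z' Y' s u) ->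
  pair_bound ((K ^ 2 * kap ^ 2 + K ^ 2 * rho + K ^ 2 * kap + K ^ 2) * p (tau t - tau s) ^ 3)
    ((K ^ 2 * (kap ^ 2 * Q + 2 * kap * eta) + K * kap ^ 2 * eps +
      K ^ 2 * (Q * rho + drho) + K * rho * eps +
      (eps * K * kap + K ^ 2 * (eta + 2 * kap * Q)) + (eps * K + K ^ 2 * Q))
     * p (tau t - tau s) ^ 3)
    (minus (plus (germ Z ZZ Y s u) (germ Z ZZ Y u t)) (germ Z ZZ Y s t))
    (minus (plus (germ Z' ZZ' Y' s u) (germ Z' ZZ' Y' u t)) (germ Z' ZZ' Y' s t)).
Proof.
  intros Hs Hu Ht Hst HQ Hkap Heta Hrho Hdrho HY Hr.
  rewrite germ_defect by (intros; apply (dp_lin HZ)).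
  rewrite germ_defect by (intros; apply (dp_lin' HZ)).
  set (P := p (tau t - tau s)).
  assert (HK := sm_K HF). assert (He := dp_eps HZ).
  assert (P0 : 0 <= P) by apply Hp.
  assert (HQ0 : 0 <= Q) by exact (norm_le_ge_0 _ _ HQ).
  assert (Psu : p (tau u - tau s) <= P) by (apply Hpm; lra).
  assert (Put : p (tau t - tau u) <= P) by (apply Hpm; lra).
  assert (Psu2 : p (tau u - tau s) ^ 2 <= P ^ 2) by (apply pow_incr; split; auto).
  assert (Put2 : p (tau t - tau u) ^ 2 <= P ^ 2) by (apply pow_incr; split; auto).
  assert (CY : pair_bound (kap * P) (eta * P) (dlt Y s u) (dlt Y' s u)).
  { eapply pair_bound_le; [apply HY| |]; apply Rmult_le_compat_l; auto. }
  assert (Cr : pair_bound (rho * P ^ 2) (drho * P ^ 2) (first_rem Z Y s u) (first_rem Z' Y' s u)).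
  { eapply pair_bound_le; [apply Hr| |]; apply Rmult_le_compat_l; auto. }
  assert (CZ : pair_bound (K * P) (eps * P) (dlt Z u t) (dlt Z' u t)).
  { eapply pair_bound_le; [apply (dp_Z HZ); auto; lra| |];
      apply Rmult_le_compat_l; auto; lra. }
  assert (CD := sm_DF_pair HF _ _ _ HQ). assert (CG := sm_G_pair HF _ _ _ HQ).
  destruct CY as (Y1 & Y2 & Y3). unfold dlt in Y1, Y2, Y3.
  assert (H2 : forall x y, 0 <= x -> x <= y -> x ^ 2 <= y ^ 2) by (intros; apply pow_incr; auto).
  assert (CE : pair_bound (K * kap ^ 2 * P ^ 2) (K * (kap ^ 2 * Q + 2 * kap * eta) * P ^ 2)
    (taylor_rem F (Fderive F) (Y s) (Y u)) (taylor_rem F (Fderive F) (Y' s) (Y' u))).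
  { replace (K * kap ^ 2 * P ^ 2) with (K * (kap * P) ^ 2) by ring.
    repeat split.
    - eapply Rle_trans; [apply (sm_rem HF)|].
      apply Rmult_le_compat_l; [lra|]. apply H2; auto; apply norm_ge_0.
    - eapply Rle_trans; [apply (sm_rem HF)|].
      apply Rmult_le_compat_l; [lra|]. apply H2; auto; apply norm_ge_0.
    - eapply Rle_trans; [apply (sm_rem_four HF)|]. rewrite Rmult_assoc.
      apply Rmult_le_compat_l; [lra|].
      replace ((kap ^ 2 * Q + 2 * kap * eta) * P ^ 2)
        with ((kap * P) ^ 2 * Q + (kap * P + kap * P) * (eta * P)) by ring.
      apply Rplus_le_compat; apply Rmult_le_compat; auto using pow2_ge_0, norm_ge_0.
      + apply Rplus_le_le_0_compat; apply norm_ge_0.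
      + apply Rplus_le_compat; auto. }
  assert (CGG : pair_bound (K * kap * P) (K * (eta + 2 * kap * Q) * P)
    (minus (second_field F (Y u)) (second_field F (Y s)))
    (minus (second_field F (Y' u)) (second_field F (Y' s)))).
  { repeat split.
    - eapply Rle_trans; [apply (sm_G_lip HF)|]. rewrite Rmult_assoc.
      apply Rmult_le_compat_l; lra.
    - eapply Rle_trans; [apply (sm_G_lip HF)|]. rewrite Rmult_assoc.
      apply Rmult_le_compat_l; lra.
    - eapply Rle_trans; [apply (sm_G_four HF)|]. rewrite Rmult_assoc.
      apply Rmult_le_compat_l; [lra|].
      replace ((eta + 2 * kap * Q) * P) with (eta * P + (kap * P + kap * P) * Q) by ring.
      apply Rplus_le_compat; auto. apply Rmult_le_compat; auto using norm_ge_0.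
      + apply Rplus_le_le_0_compat; apply norm_ge_0.
      + apply Rplus_le_compat; auto. }
  assert (CZZ : pair_bound (K * P ^ 2 * (K * kap * P))
    (eps * P ^ 2 * (K * kap * P) + K * P ^ 2 * (K * (eta + 2 * kap * Q) * P))
    (ZZ u t (minus (second_field F (Y u)) (second_field F (Y s))))
    (ZZ' u t (minus (second_field F (Y' u)) (second_field F (Y' s))))).
  { eapply pair_bound_le; [apply second_order_pair_bound; [auto|auto|lra|apply CGG]| |].
    - apply Rmult_le_compat_r; [repeat apply Rmult_le_pos; lra|].
      apply Rmult_le_compat_l; lra.
    - apply Rplus_le_compat; (apply Rmult_le_compat_r; [|apply Rmult_le_compat_l; lra]).
      + repeat apply Rmult_le_pos; lra.
      + assert (0 <= kap * Q) by now apply Rmult_le_pos.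
        repeat apply Rmult_le_pos; lra. }
  assert (CN := chen_defect_pair_bound s u t _ _ _ _ Hs Hu Ht Hst CG).
  fold P in CN.
  eapply pair_bound_le.
  { apply pair_bound_plus; [|apply pair_bound_minus; [apply CZZ|apply CN]].
    apply pair_bound_plus.
    - apply pair_bound_app; [apply CE|apply CZ].
    - apply pair_bound_app; [|apply CZ]. apply pair_bound_app; [apply CD|apply Cr]. }
  - right; ring.
  - right; ring.
Qed.
End Defect.
End Stability.
Arguments dp_eps {U W I tau In p K eps Z Z' ZZ ZZ'}.
Arguments dp_Z {U W I tau In p K eps Z Z' ZZ ZZ'}.
Arguments dp_lin {U W I tau In p K eps Z Z' ZZ ZZ'}.
Arguments dp_lin' {U W I tau In p K eps Z Z' ZZ ZZ'}.
Arguments dp_ZZ {U W I tau In p K eps Z Z' ZZ ZZ'}.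
Arguments dp_N {U W I tau In p K eps Z Z' ZZ ZZ'}.

Section LocalStability.
Context {U W : NormedSpace} (F : W -> lin U W) (F0 : W -> W).
Notation BB := (lin_NormedModule U (lin_NormedModule U W)).
Context {I : Type}.

(** Davie's characterization of a solution [Y] with drift term [D]: this is of
    order three in the modulus.  Its defect under splitting an interval is that
    of the germ, since the increments of [Y] and [D] are additive. *)
Definition davie_rem (Z : I -> U) (ZZ : I -> I -> BB -> W) (D Y : I -> W) (s t : I) : W :=
  minus (minus (dlt Y s t) (dlt D s t)) (germ F Z ZZ Y s t).

Context (tau : I -> R) (In : I -> Prop) (p : R -> R) (K S pi eps q : R)
  (Z Z' : I -> U) (ZZ ZZ' : I -> I -> BB -> W) (Y Y' D D' : I -> W) (a : I).

Notation h s t := (tau t - tau s).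
Notation A := (fun s t => minus (davie_rem Z ZZ D Y s t) (davie_rem Z' ZZ' D' Y' s t)).

Hypothesis HF : smooth K F F0.
Hypothesis HZ : driver_pair tau In p K eps Z Z' ZZ ZZ'.
Hypothesis Hp : forall x, 0 <= p x.
Hypothesis Hpm : forall x y, x <= y -> p x <= p y.
Hypothesis Hppi : forall s t, In s -> In t -> p (h s t) <= pi.
Hypothesis Hpi : pi <= 1.
Hypothesis Hlen : forall s t, In s -> In t -> h s t <= p (h s t) ^ 2.
Hypothesis HJ : forall s t, In s -> In t -> tau s <= tau t ->
  norm (davie_rem Z ZZ D Y s t) <= K * p (h s t) ^ 3.
Hypothesis HJ' : forall s t, In s -> In t -> tau s <= tau t ->
  norm (davie_rem Z' ZZ' D' Y' s t) <= K * p (h s t) ^ 3.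
Hypothesis HD : forall s t, In s -> In t -> tau s <= tau t ->
  norm (dlt D s t) <= K * (h s t) /\ norm (dlt D' s t) <= K * (h s t).
Hypothesis HDD : forall Q, 0 <= Q -> (forall r, In r -> norm (minus (Y r) (Y' r)) <= Q) ->
  forall s t, In s -> In t -> tau s <= tau t ->
  norm (minus (dlt D s t) (dlt D' s t)) <= (K * Q + eps) * (h s t).
Hypothesis Hsew : forall C, 0 <= C ->
  (forall s u t, In s -> In u -> In t -> tau s <= tau u <= tau t ->
     norm (minus (A s t) (plus (A s u) (A u t))) <= C * p (h s t) ^ 3) ->
  forall s t, In s -> In t -> tau s <= tau t ->
     norm (A s t) <= S * C * p (h s t) ^ 3 + eps * p (h s t) ^ 2.
Hypothesis Ha : In a.
Hypothesis Hamin : forall t, In t -> tau a <= tau t.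
Hypothesis Hq : norm (minus (Y a) (Y' a)) <= q.
Hypothesis HS : 1 <= S.
Hypothesis Hsmall : 120 * S * K ^ 6 * pi <= 1.

Let K1 : 1 <= K := sm_K HF.
Let e0 : 0 <= eps := dp_eps HZ.
Let q0 : 0 <= q := norm_le_ge_0 _ _ Hq.

Lemma davie_rem_defect (Z0 : I -> U) ZZ0 D0 Y0 s u t :
  minus (davie_rem Z0 ZZ0 D0 Y0 s t) (plus (davie_rem Z0 ZZ0 D0 Y0 s u) (davie_rem Z0 ZZ0 D0 Y0 u t))
  = minus (plus (germ F Z0 ZZ0 Y0 s u) (germ F Z0 ZZ0 Y0 u t)) (germ F Z0 ZZ0 Y0 s t).
Proof. unfold davie_rem, dlt. vec. Qed.

Lemma p_le_1 s t : In s -> In t -> 0 <= p (h s t) <= 1.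
Proof. intros. split; auto. eapply Rle_trans; [apply Hppi|]; auto. Qed.

Lemma pow2_le_pow1 x : 0 <= x <= 1 -> 0 <= x ^ 2 <= x.
Proof. intros. nra. Qed.

Lemma pow3_le_pow2 x : 0 <= x <= 1 -> 0 <= x ^ 3 <= x ^ 2.
Proof. intros. simpl. assert (0 <= x * x) by nra. nra. Qed.

Lemma first_rem_bound (Z0 : I -> U) (ZZ0 : I -> I -> BB -> W) (D0 Y0 : I -> W) s t :
  In s -> In t -> tau s <= tau t ->
  (forall b, norm (ZZ0 s t b) <= K * p (h s t) ^ 2 * norm b) ->
  norm (davie_rem Z0 ZZ0 D0 Y0 s t) <= K * p (h s t) ^ 3 ->
  norm (dlt D0 s t) <= K * (h s t) ->
  norm (first_rem F Z0 Y0 s t) <= 3 * K ^ 2 * p (h s t) ^ 2.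
Proof.
  intros Hs Ht Hst H1 H2 H3.
  replace (first_rem F Z0 Y0 s t) with (plus (plus (davie_rem Z0 ZZ0 D0 Y0 s t) (dlt D0 s t))
     (ZZ0 s t (second_field F (Y0 s)))) by (unfold davie_rem, germ, first_rem; vec).
  eapply Rle_trans; [apply norm_plus_le; [apply norm_plus_le|]|].
  - apply H2.
  - eapply Rle_trans; [apply H3|]. apply Rmult_le_compat_l; [lra|]. apply Hlen; auto.
  - eapply Rle_trans; [apply H1|]. apply Rmult_le_compat_l; [|apply (sm_G HF)].
    assert (0 <= p (h s t) ^ 2) by apply pow2_ge_0. nra.
  - assert (Hpp := pow3_le_pow2 _ (p_le_1 s t Hs Ht)).
    set (x := p (h s t) ^ 2) in *. set (y := p (h s t) ^ 3) in *.
    assert (K * y <= K * K * x) by (rewrite Rmult_assoc; apply Rmult_le_compat_l; nra).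
    assert (K * x <= K * K * x) by (rewrite Rmult_assoc; apply Rmult_le_compat_l; nra).
    simpl. nra.
Qed.

Lemma increment_bound (Z0 : I -> U) (Y0 : I -> W) s t : In s -> In t ->
  norm (first_rem F Z0 Y0 s t) <= 3 * K ^ 2 * p (h s t) ^ 2 ->
  norm (dlt Z0 s t) <= K * p (h s t) ->
  norm (dlt Y0 s t) <= 4 * K ^ 2 * p (h s t).
Proof.
  intros Hs Ht H1 H2.
  replace (dlt Y0 s t) with (plus (first_rem F Z0 Y0 s t) (F (Y0 s) (dlt Z0 s t)))
    by (unfold first_rem; vec).
  eapply Rle_trans.
  { apply norm_plus_le; [apply H1|apply norm_app_le; [apply (sm_F HF)|apply H2]]. }
  assert (Hpp := pow2_le_pow1 _ (p_le_1 s t Hs Ht)).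
  assert (3 * K ^ 2 * p (h s t) ^ 2 <= 3 * K ^ 2 * p (h s t)).
  { apply Rmult_le_compat_l; [nra|lra]. }
  replace (4 * K ^ 2 * p (h s t)) with (3 * K ^ 2 * p (h s t) + K * (K * p (h s t))) by ring.
  lra.
Qed.

(** The defect of [A] is of order three with a factor linear in [B], and sewing
    returns it with the small factor [pi]; so a bound [B] on the difference of
    the first-order remainders improves itself to half its size plus a multiple
    of the distance of the data. *)
Lemma stability_step B : 0 <= B ->
  (forall s t, In s -> In t -> tau s <= tau t ->
     norm (minus (first_rem F Z Y s t) (first_rem F Z' Y' s t)) <= B * p (h s t) ^ 2) ->
  (forall t, In t -> norm (minus (Y t) (Y' t)) <= 2 * K ^ 2 * (q + eps) + B * pi) /\
  (forall s t, In s -> In t -> tau s <= tau t ->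
     norm (minus (dlt Y s t) (dlt Y' s t)) <=
     (B * pi + K ^ 2 * (2 * K ^ 2 * (q + eps) + B * pi) + K * eps) * p (h s t)) /\
  (forall s t, In s -> In t -> tau s <= tau t ->
     norm (minus (first_rem F Z Y s t) (first_rem F Z' Y' s t)) <=
     (B / 2 + 13 * K ^ 4 * (q + eps)) * p (h s t) ^ 2).
Proof.
  intros HB Hr.
  assert (Hpi0 : 0 <= pi) by (eapply Rle_trans; [apply (Hp (h a a))|apply Hppi; auto]).
  assert (inc : forall s t Q0, In s -> In t -> tau s <= tau t ->
    norm (minus (Y s) (Y' s)) <= Q0 ->
    norm (minus (dlt Y s t) (dlt Y' s t)) <= (B * pi + K ^ 2 * Q0 + K * eps) * p (h s t)).
  { intros s t Q0 Hs Ht Hst HQ0.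
    destruct (pair_bound_app _ _ _ _ _ _ _ _ (sm_F_pair HF _ _ _ HQ0) (dp_Z HZ s t Hs Ht Hst))
      as (_ & _ & C).
    replace (minus (dlt Y s t) (dlt Y' s t)) with
      (plus (minus (first_rem F Z Y s t) (first_rem F Z' Y' s t))
            (minus (F (Y s) (dlt Z s t)) (F (Y' s) (dlt Z' s t))))
      by (unfold first_rem; vec).
    eapply Rle_trans; [apply norm_plus_le; [apply Hr; auto|apply C]|].
    assert (Hpp := p_le_1 s t Hs Ht). assert (Hpp' := Hppi s t Hs Ht).
    set (x := p (h s t)) in *.
    assert (B * x ^ 2 <= B * (pi * x)) by (apply Rmult_le_compat_l; auto; simpl; nra).
    simpl in *. lra. }
  set (Q := 2 * K ^ 2 * (q + eps) + B * pi).
  assert (HQ : forall t, In t -> norm (minus (Y t) (Y' t)) <= Q).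
  { intros t Ht. assert (Hat := inc a t q Ha Ht (Hamin t Ht) Hq).
    replace (minus (Y t) (Y' t)) with
      (plus (minus (Y a) (Y' a)) (minus (dlt Y a t) (dlt Y' a t))) by (unfold dlt; vec).
    eapply Rle_trans; [apply norm_plus_le; [apply Hq|apply Hat]|].
    assert (Hpp := p_le_1 a t Ha Ht).
    assert (0 <= B * pi) by nra. assert (0 <= K ^ 2 * q) by nra. assert (0 <= K * eps) by nra.
    assert (K ^ 2 >= K) by nra.
    apply Rle_trans with (q + (B * pi + K ^ 2 * q + K * eps)); [|unfold Q; nra].
    apply Rplus_le_compat_l. nra. }
  assert (Q0 : 0 <= Q) by exact (norm_le_ge_0 _ _ (HQ a Ha)).
  set (H := B * pi + K ^ 2 * Q + K * eps).
  assert (H0 : 0 <= H) by (unfold H; assert (0 <= B * pi) by nra; nra).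
  assert (HY : forall s t, In s -> In t -> tau s <= tau t ->
     norm (minus (dlt Y s t) (dlt Y' s t)) <= H * p (h s t)).
  { intros. apply inc; auto. }
  split; [auto|]. split; [auto|].
  intros s t Hs Ht Hst.
  assert (K2 : K <= K ^ 2) by nra.
  assert (R1 : forall s t, In s -> In t -> tau s <= tau t ->
    norm (first_rem F Z Y s t) <= 3 * K ^ 2 * p (h s t) ^ 2).
  { intros s' t' Hs' Ht' Hst'. apply (first_rem_bound Z ZZ D Y); auto.
    - intros b. apply (dp_ZZ HZ); auto.
    - apply HD; auto. }
  assert (R2 : forall s t, In s -> In t -> tau s <= tau t ->
    norm (first_rem F Z' Y' s t) <= 3 * K ^ 2 * p (h s t) ^ 2).
  { intros s' t' Hs' Ht' Hst'. apply (first_rem_bound Z' ZZ' D' Y'); auto.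
    - intros b. apply (dp_ZZ HZ); auto.
    - apply HD; auto. }
  assert (CA : norm (A s t) <=
    S * (28 * K ^ 6 * (Q + H + eps + B)) * p (h s t) ^ 3 + eps * p (h s t) ^ 2).
  { assert (K6 : 0 <= K ^ 6) by (apply pow_le; lra).
    apply Hsew; auto; [nra|].
    intros s' u t' Hs' Hu Ht' Hsut.
    assert (CG := germ_defect_pair_bound F F0 tau In p K eps Z Z' ZZ ZZ' Y Y' HF HZ Hp Hpm
      s' u t' (3 * K ^ 2) B (4 * K ^ 2) H Q Hs' Hu Ht' Hsut (HQ s' Hs')).
    destruct CG as (_ & _ & CG); try nra.
    { repeat split.
      - apply (increment_bound Z Y); auto. apply R1; auto; lra.
        apply (dp_Z HZ); auto; lra.
      - apply (increment_bound Z' Y'); auto. apply R2; auto; lra.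
        apply (dp_Z HZ); auto; lra.
      - apply HY; auto; lra. }
    { repeat split; [apply R1|apply R2|apply Hr]; auto; lra. }
    apply (norm_le_of_eq _ (minus
      (minus (plus (germ F Z ZZ Y s' u) (germ F Z ZZ Y u t')) (germ F Z ZZ Y s' t'))
      (minus (plus (germ F Z' ZZ' Y' s' u) (germ F Z' ZZ' Y' u t')) (germ F Z' ZZ' Y' s' t')))).
    { rewrite <- (davie_rem_defect Z ZZ D Y), <- (davie_rem_defect Z' ZZ' D' Y'). vec. }
    eapply Rle_trans; [apply CG|]. apply Rmult_le_compat_r; [apply pow_le; auto|].
    assert (Kp : forall n, (n <= 6)%nat -> 0 <= K ^ n <= K ^ 6).
    { intros n Hn. split; [apply pow_le; lra|]. now apply Rle_pow. }
    assert (k1 := Kp 1%nat ltac:(lia)). assert (k2 := Kp 2%nat ltac:(lia)).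
    assert (k3 := Kp 3%nat ltac:(lia)). assert (k4 := Kp 4%nat ltac:(lia)).
    assert (k5 := Kp 5%nat ltac:(lia)).
    assert (cmp : forall x y, 0 <= x -> 0 <= y <= K ^ 6 -> y * x <= K ^ 6 * x).
    { intros x y Hx Hy. apply Rmult_le_compat_r; lra. }
    assert (E : K ^ 2 * ((4 * K ^ 2) ^ 2 * Q + 2 * (4 * K ^ 2) * H) + K * (4 * K ^ 2) ^ 2 * eps +
      K ^ 2 * (Q * (3 * K ^ 2) + B) + K * (3 * K ^ 2) * eps +
      (eps * K * (4 * K ^ 2) + K ^ 2 * (H + 2 * (4 * K ^ 2) * Q)) + (eps * K + K ^ 2 * Q)
      = 16 * (K ^ 6 * Q) + 11 * (K ^ 4 * Q) + K ^ 2 * Q + 8 * (K ^ 4 * H) + K ^ 2 * H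
        + 16 * (K ^ 5 * eps) + 7 * (K ^ 3 * eps) + K ^ 1 * eps + K ^ 2 * B) by ring.
    rewrite E.
    assert (a1 := cmp Q _ Q0 k4). assert (a2 := cmp Q _ Q0 k2).
    assert (a3 := cmp H _ H0 k4). assert (a4 := cmp H _ H0 k2).
    assert (a5 := cmp eps _ e0 k5). assert (a6 := cmp eps _ e0 k3).
    assert (a7 := cmp eps _ e0 k1). assert (a8 := cmp B _ HB k2).
    assert (0 <= K ^ 6 * Q) by nra. assert (0 <= K ^ 6 * H) by nra.
    assert (0 <= K ^ 6 * eps) by nra. assert (0 <= K ^ 6 * B) by nra.
    (* 28 = 16 + 11 + 1 is the largest total coefficient, that of [Q] *)
    replace (28 * K ^ 6 * (Q + H + eps + B)) with
      (28 * (K ^ 6 * Q) + 28 * (K ^ 6 * H) + 28 * (K ^ 6 * eps) + 28 * (K ^ 6 * B)) by ring.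
    lra. }
  assert (CZ : norm (minus (ZZ s t (second_field F (Y s))) (ZZ' s t (second_field F (Y' s))))
      <= eps * p (h s t) ^ 2 * K + K * p (h s t) ^ 2 * (K * Q)).
  { apply (second_order_pair_bound F F0 tau In p K eps Z Z' ZZ ZZ' HF HZ s t _ _ _ _ Hs Ht Hst
      (sm_G_pair HF _ _ _ (HQ s Hs))). }
  assert (CD := HDD Q Q0 HQ s t Hs Ht Hst).
  assert (Hl := Hlen s t Hs Ht).
  assert (CD' : norm (minus (dlt D s t) (dlt D' s t)) <= (K * Q + eps) * p (h s t) ^ 2).
  { eapply Rle_trans; [apply CD|]. apply Rmult_le_compat_l; [nra|auto]. }
  replace (minus (first_rem F Z Y s t) (first_rem F Z' Y' s t)) with
    (plus (plus (A s t) (minus (dlt D s t) (dlt D' s t)))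
       (minus (ZZ s t (second_field F (Y s))) (ZZ' s t (second_field F (Y' s)))))
    by (unfold first_rem, davie_rem, germ; vec).
  eapply Rle_trans; [apply norm_plus_le; [apply norm_plus_le; [apply CA|apply CD']|apply CZ]|].
  assert (Hpp := p_le_1 s t Hs Ht). assert (Hpp' := Hppi s t Hs Ht).
  set (x := p (h s t)) in *.
  assert (x3 : x ^ 3 <= pi * x ^ 2).
  { simpl. assert (0 <= x * x) by nra. nra. }
  assert (x2 : 0 <= x ^ 2) by apply pow2_ge_0.
  assert (K6 : 0 <= K ^ 6) by (apply pow_le; lra).
  set (X := Q + H + eps + B) in *.
  assert (X0 : 0 <= X) by (unfold X; lra).
  assert (SK0 : 0 <= S * K ^ 6) by nra.
  assert (L1 : S * (28 * K ^ 6 * X) * x ^ 3 <= 28 * (S * K ^ 6 * pi) * X * x ^ 2).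
  { replace (28 * (S * K ^ 6 * pi) * X * x ^ 2) with (28 * (S * K ^ 6) * X * (pi * x ^ 2)) by ring.
    replace (S * (28 * K ^ 6 * X) * x ^ 3) with (28 * (S * K ^ 6) * X * x ^ 3) by ring.
    apply Rmult_le_compat_l; [|auto]. repeat apply Rmult_le_pos; lra. }
  apply Rle_trans with ((28 * (S * K ^ 6 * pi) * X + eps + (K * Q + eps) + (eps * K + K * (K * Q))) * x ^ 2).
  { lra. }
  apply Rmult_le_compat_r; auto.
  set (th := S * K ^ 6 * pi) in *.
  assert (th0 : 0 <= th) by (unfold th; nra).
  assert (th1 : 120 * th <= 1) by (unfold th; lra).
  assert (BP : B * pi <= B) by nra.
  assert (X1 : X <= 2 * B + 2 * K ^ 2 * Q + 2 * K * eps).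
  { unfold X, H. assert (Q <= K ^ 2 * Q) by nra. nra. }
  assert (KQ : 0 <= K ^ 2 * Q) by nra.
  assert (Ke : 0 <= K * eps) by nra.
  assert (T1 : 28 * th * X <= 56 * th * B + 56 * th * (K ^ 2 * Q) + 56 * th * (K * eps)).
  { apply Rle_trans with (28 * th * (2 * B + 2 * K ^ 2 * Q + 2 * K * eps)).
    - apply Rmult_le_compat_l; lra.
    - right; ring. }
  assert (T2 : 56 * th * (K ^ 2 * Q) <= K ^ 2 * Q) by nra.
  assert (T3 : 56 * th * (K * eps) <= K * eps) by nra.
  assert (T4 : K ^ 2 * Q = 2 * (K ^ 4 * (q + eps)) + K ^ 2 * pi * B) by (unfold Q; ring).
  assert (T5 : K ^ 2 * pi <= th).
  { unfold th. assert (K ^ 2 <= K ^ 6) by (apply Rle_pow; auto; lia).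
    assert (K ^ 2 * pi <= K ^ 6 * pi) by (apply Rmult_le_compat_r; auto).
    assert (0 <= K ^ 6 * pi) by nra. nra. }
  assert (T6 : K ^ 2 * pi * B <= th * B) by (apply Rmult_le_compat_r; auto).
  (* [B] enters with total coefficient [56 * th + 3 * th], three times through
     [K ^ 2 * Q]; the constant 120 makes this at most one half *)
  assert (T7 : 120 * th * B <= B) by nra.
  assert (T8 : K * eps <= K ^ 4 * (q + eps)).
  { assert (K ^ 1 <= K ^ 4) by (apply Rle_pow; auto; lia).
    assert (0 <= K ^ 4 * q) by (apply Rmult_le_pos; auto; apply pow_le; lra).
    assert (K ^ 1 * eps <= K ^ 4 * eps) by (apply Rmult_le_compat_r; auto). lra. }
  assert (T9 : eps <= K * eps) by nra.
  assert (T10 : K * Q <= K ^ 2 * Q) by nra.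
  assert (T11 : K * (K * Q) = K ^ 2 * Q) by ring.
  rewrite T11. unfold Rdiv.
  lra.
Qed.

(** Iterate [stability_step] from the bound [6 K^2] that holds a priori, each
    remainder being at most [3 K^2] in size.  The iterates decrease to the fixed
    point [26 K^4 (q + eps)], and one more step bounds the paths themselves. *)
Lemma local_stability :
  (forall t, In t -> norm (minus (Y t) (Y' t)) <= 55 * K ^ 6 * (q + eps)) /\
  (forall s t, In s -> In t -> tau s <= tau t ->
     norm (minus (dlt Y s t) (dlt Y' s t)) <= 55 * K ^ 6 * (q + eps) * p (h s t)) /\
  (forall s t, In s -> In t -> tau s <= tau t ->
     norm (minus (first_rem F Z Y s t) (first_rem F Z' Y' s t)) <=
     55 * K ^ 6 * (q + eps) * p (h s t) ^ 2).
Proof.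
  assert (K4 : 0 <= K ^ 4) by (apply pow_le; lra).
  assert (E0 : 0 <= K ^ 4 * (q + eps)) by nra.
  assert (Hpi0 : 0 <= pi) by (eapply Rle_trans; [apply (Hp (h a a))|apply Hppi; auto]).
  assert (iter : forall n s t, In s -> In t -> tau s <= tau t ->
     norm (minus (first_rem F Z Y s t) (first_rem F Z' Y' s t)) <=
     (6 * K ^ 2 * (1 / 2) ^ n + 26 * K ^ 4 * (q + eps)) * p (h s t) ^ 2).
  { induction n as [|n IH]; intros s t Hs Ht Hst.
    - assert (P2 := pow2_ge_0 (p (h s t))).
      eapply Rle_trans.
      { apply norm_minus_le.
        - apply (first_rem_bound Z ZZ D Y); auto.
          + intros b. apply (dp_ZZ HZ); auto.
          + apply HD; auto.
        - apply (first_rem_bound Z' ZZ' D' Y'); auto.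
          + intros b. apply (dp_ZZ HZ); auto.
          + apply HD; auto. }
      rewrite <- Rmult_plus_distr_r. apply Rmult_le_compat_r; auto. simpl pow at 4. lra.
    - apply stability_step in IH.
      + eapply Rle_trans; [apply IH; auto|].
        apply Rmult_le_compat_r; [apply pow2_ge_0|]. change ((1/2) ^ Datatypes.S n) with (1/2 * (1/2) ^ n). unfold Rdiv. lra.
      + assert (0 <= (1/2) ^ n) by (apply pow_le; lra).
        assert (0 <= K ^ 2) by apply pow2_ge_0.
        assert (0 <= 6 * K ^ 2 * (1/2) ^ n) by (repeat apply Rmult_le_pos; lra). lra. }
  assert (lim : forall s t, In s -> In t -> tau s <= tau t ->
     norm (minus (first_rem F Z Y s t) (first_rem F Z' Y' s t)) <=
     26 * K ^ 4 * (q + eps) * p (h s t) ^ 2).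
  { intros s t Hs Ht Hst.
    assert (P2 := pow2_ge_0 (p (h s t))).
    apply le_of_pow_error with (6 * K ^ 2 * p (h s t) ^ 2) (1 / 2); [lra| |].
    - apply Rmult_le_pos; auto. assert (0 <= K ^ 2) by apply pow2_ge_0. lra.
    - exists O. intros n _. eapply Rle_trans; [apply (iter n); auto|]. right; ring. }
  apply stability_step in lim; [|lra].
  destruct lim as (L1 & L2 & L3).
  assert (K46 : K ^ 4 <= K ^ 6) by (apply Rle_pow; auto; lia).
  assert (K24 : K ^ 2 <= K ^ 4) by (apply Rle_pow; auto; lia).
  assert (K14 : K ^ 1 <= K ^ 4) by (apply Rle_pow; auto; lia).
  assert (X0 : 0 <= q + eps) by lra.
  assert (M46 : K ^ 4 * (q + eps) <= K ^ 6 * (q + eps)) by (apply Rmult_le_compat_r; auto).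
  assert (M24 : K ^ 2 * (q + eps) <= K ^ 4 * (q + eps)) by (apply Rmult_le_compat_r; auto).
  assert (BP : 26 * K ^ 4 * (q + eps) * pi <= 26 * (K ^ 4 * (q + eps))) by nra.
  assert (QB : 2 * K ^ 2 * (q + eps) + 26 * K ^ 4 * (q + eps) * pi <= 28 * (K ^ 4 * (q + eps))) by lra.
  repeat split.
  - intros t Ht. eapply Rle_trans; [apply L1, Ht|]. lra.
  - intros s t Hs Ht Hst. eapply Rle_trans; [apply L2; auto|].
    apply Rmult_le_compat_r; auto.
    assert (QB' : K ^ 2 * (2 * K ^ 2 * (q + eps) + 26 * K ^ 4 * (q + eps) * pi)
       <= K ^ 2 * (28 * (K ^ 4 * (q + eps)))) by (apply Rmult_le_compat_l; auto; apply pow2_ge_0).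
    replace (K ^ 2 * (28 * (K ^ 4 * (q + eps)))) with (28 * (K ^ 6 * (q + eps))) in QB' by ring.
    assert (Ke : K ^ 1 * eps <= K ^ 4 * (q + eps)).
    { apply Rmult_le_compat; try lra. }
    rewrite pow_1 in Ke. lra.
  - intros s t Hs Ht Hst. eapply Rle_trans; [apply L3; auto|].
    apply Rmult_le_compat_r; [apply pow2_ge_0|]. unfold Rdiv. lra.
Qed.
End LocalStability.

(** * The driver of a controlled path *)

Section ControlledDriver.
Context {U V W VV : NormedSpace} (tens : V -> V -> VV).
Notation BB := (lin_NormedModule U (lin_NormedModule U W)).
Notation VU := (lin_NormedModule V U).
Hypothesis Ht : is_tensor_square tens.

(** To order three [Z] moves on [[s, t]] like [Z' s] applied to [X], so its
    iterated integral against [b] is the one of [X] seen through [Z' s]. *)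
Definition second_order (XX : R -> R -> VV) (Z' : R -> lin V U) (s t : R) (b : BB) : W :=
  contract tens b (Z' s) (Z' s) (XX s t).

Definition chen_relation (T : R) (X : R -> V) (XX : R -> R -> VV) : Prop :=
  forall s u t, 0 <= s -> s <= u -> u <= t -> t <= T ->
    XX s t = plus (plus (XX s u) (XX u t)) (tens (incr X s u) (incr X u t)).

(** By Chen's relation for [XX], the defect is only caused by freezing [Z'] at the
    left end point: every term contains an increment of [Z'] next to [XX] or to
    two increments, or a remainder of [Z] next to an increment. *)
Lemma controlled_chen_defect T X XX (Z : R -> U) (Z' : R -> lin V U) s u t b :
  chen_relation T X XX -> 0 <= s -> s <= u -> u <= t -> t <= T ->
  chen_defect Z (second_order XX Z') s u t b =
  opp (plus (plus (contract tens b (incr (A := VU) Z' s u) (Z' s) (XX u t))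
                  (contract tens b (Z' u) (incr (A := VU) Z' s u) (XX u t)))
            (plus ((b (remainder X Z Z' s u) : lin U W) (Z' s (incr X u t)))
                  ((b (incr Z s u) : lin U W)
                     (plus (remainder X Z Z' u t) (incr (A := VU) Z' s u (incr X u t)))))).
Proof.
  intros HC Hs Hsu Hut HtT. unfold chen_defect, second_order.
  rewrite (HC s u t) by auto.
  rewrite !contract_plus, contract_tens by auto.
  change (incr (A := VU) Z' s u) with (minus (Z' u) (Z' s)).
  rewrite contract_minus_1, contract_minus_2 by auto.
  change (dlt Z s u) with (incr Z s u). change (dlt Z u t) with (incr Z u t).
  change (minus (Z' u) (Z' s) (incr X u t))
    with (minus (Z' u (incr X u t)) (Z' s (incr X u t))).
  replace (plus (remainder X Z Z' u t) (minus (Z' u (incr X u t)) (Z' s (incr X u t))))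
    with (minus (incr Z u t) (Z' s (incr X u t))) by (unfold remainder; vec).
  rewrite lin_minus_arg. unfold remainder. rewrite (lin_minus_arg b).
  change (minus (b (incr Z s u)) (b (Z' s (incr X s u))) (Z' s (incr X u t))) with
    (minus ((b (incr Z s u) : lin U W) (Z' s (incr X u t)))
           ((b (Z' s (incr X s u)) : lin U W) (Z' s (incr X u t)))).
  vec.
Qed.

Section SolutionOfControlledDriver.
Context (F : W -> lin U W) (X : R -> V) (Z : R -> U) (Z' : R -> lin V U)
  (Y : R -> W) (Y' : R -> lin V W) (s t : R).
Hypothesis Es : Y' s = lin_comp (F (Y s)) (Z' s).

Lemma remainder_first_rem :
  remainder X Y Y' s t = plus (first_rem F Z Y s t) (F (Y s) (remainder X Z Z' s t)).
Proof.
  unfold first_rem, remainder. rewrite Es, lin_minus_arg.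
  change (lin_comp (F (Y s)) (Z' s) (incr X s t)) with (F (Y s) (Z' s (incr X s t))).
  change (dlt Z s t) with (incr Z s t). change (dlt Y s t) with (incr Y s t). vec.
Qed.

Lemma derivative_increment : Y' t = lin_comp (F (Y t)) (Z' t) ->
  incr (A := lin_NormedModule V W) Y' s t =
  plus (lin_comp (minus (F (Y t)) (F (Y s))) (Z' t))
       (lin_comp (F (Y s)) (incr (A := VU) Z' s t)).
Proof.
  intros Et. unfold incr. rewrite Es, Et. apply lin_ext. intros x.
  change (minus (F (Y t) (Z' t x)) (F (Y s) (Z' s x)) =
    plus (minus (F (Y t) (Z' t x)) (F (Y s) (Z' t x)))
         (F (Y s) (minus (Z' t x) (Z' s x)))).
  rewrite lin_minus_arg. vec.
Qed.
End SolutionOfControlledDriver.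

(** The hypotheses on two sets of data as pointwise bounds, diagonal included,
    with a single size [B] and a single distance [e] in place of the many norms
    and seminorms. *)
Record data_pair (T B e : R) (p : R -> R) (X X2 : R -> V) (XX XX2 : R -> R -> VV)
    (Z Z2 : R -> U) (Z' Z2' : R -> lin V U) : Prop := {
  da_B : 1 <= B;
  da_e : 0 <= e;
  da_chen : chen_relation T X XX;
  da_chen2 : chen_relation T X2 XX2;
  da_X : forall s t, 0 <= s -> s <= t -> t <= T ->
    pair_bound (B * p (t - s)) (e * p (t - s)) (incr X s t) (incr X2 s t);
  da_XX : forall s t, 0 <= s -> s <= t -> t <= T ->
    pair_bound (B * p (t - s) ^ 2) (e * p (t - s) ^ 2) (XX s t) (XX2 s t);
  da_Z' : forall s, 0 <= s <= T -> pair_bound (A := VU) B e (Z' s) (Z2' s);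
  da_Z'_inc : forall s t, 0 <= s -> s <= t -> t <= T ->
    pair_bound (B * p (t - s)) (e * p (t - s)) (incr (A := VU) Z' s t) (incr (A := VU) Z2' s t);
  da_rem : forall s t, 0 <= s -> s <= t -> t <= T ->
    pair_bound (B * p (t - s) ^ 2) (e * p (t - s) ^ 2)
      (remainder X Z Z' s t) (remainder X2 Z2 Z2' s t)
}.

Arguments da_B {T B e p X X2 XX XX2 Z Z2 Z' Z2'}.
Arguments da_e {T B e p X X2 XX XX2 Z Z2 Z' Z2'}.
Arguments da_chen {T B e p X X2 XX XX2 Z Z2 Z' Z2'}.
Arguments da_chen2 {T B e p X X2 XX XX2 Z Z2 Z' Z2'}.
Arguments da_X {T B e p X X2 XX XX2 Z Z2 Z' Z2'}.
Arguments da_XX {T B e p X X2 XX XX2 Z Z2 Z' Z2'}.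
Arguments da_Z' {T B e p X X2 XX XX2 Z Z2 Z' Z2'}.
Arguments da_Z'_inc {T B e p X X2 XX XX2 Z Z2 Z' Z2'}.
Arguments da_rem {T B e p X X2 XX XX2 Z Z2 Z' Z2'}.

Section DriverOfData.
Context (C T B e : R) (p : R -> R) (X X2 : R -> V) (XX XX2 : R -> R -> VV)
  (Z Z2 : R -> U) (Z' Z2' : R -> lin V U).
Hypothesis HC0 : 0 <= C.
Hypothesis HC : contract_bounded (U := U) (W := W) tens C.
Hypothesis HD : data_pair T B e p X X2 XX XX2 Z Z2 Z' Z2'.
Hypothesis Hp : forall x, 0 <= p x.
Hypothesis Hpm : forall x y, x <= y -> p x <= p y.

Let B1 : 1 <= B := da_B HD.
Let e0 : 0 <= e := da_e HD.

(** The contractions in [controlled_chen_defect] contribute [6 C], the products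
    of linear maps [8 + 7]; the other bounds on the driver are smaller. *)
Definition driver_const : R := (6 * C + 15) * B ^ 4.

Lemma increment_of_remainder (X0 : R -> V) (Z0 : R -> U) (Z0' : R -> lin V U) s t :
  incr Z0 s t = plus (Z0' s (incr X0 s t)) (remainder X0 Z0 Z0' s t).
Proof. unfold remainder. vec. Qed.

Lemma driver_increment s t : 0 <= s -> s <= t -> t <= T -> p (t - s) <= 1 ->
  pair_bound (2 * B ^ 2 * p (t - s)) (3 * B * e * p (t - s)) (incr Z s t) (incr Z2 s t).
Proof.
  intros Hs Hst HtT H1.
  rewrite (increment_of_remainder X Z Z'), (increment_of_remainder X2 Z2 Z2').
  assert (P0 := Hp (t - s)). set (P := p (t - s)) in *.
  eapply pair_bound_le.
  { apply pair_bound_plus.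
    - apply pair_bound_app; [apply (da_Z' HD); lra|].
      apply (da_X HD); auto.
    - apply (da_rem HD); auto. }
  - fold P. assert (P ^ 2 <= P) by nra. assert (B <= B ^ 2) by nra. nra.
  - fold P. assert (P ^ 2 <= P) by nra. assert (0 <= e * P) by nra.
    assert (e * P ^ 2 <= e * P) by nra.
    assert (e * P <= B * (e * P)) by nra. nra.
Qed.

Lemma driver_second_order s t b : 0 <= s -> s <= t -> t <= T ->
  pair_bound (C * B ^ 3 * p (t - s) ^ 2 * norm b) (3 * C * B ^ 2 * e * p (t - s) ^ 2 * norm b)
    (second_order XX Z' s t b) (second_order XX2 Z2' s t b).
Proof.
  intros Hs Hst HtT.
  eapply pair_bound_le.
  { apply contract_pair_bound; [apply Ht|apply HC|apply pair_bound_refl, Rle_refl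
      |apply (da_Z' HD); lra
      |apply (da_Z' HD); lra
      |apply (da_XX HD); auto]. }
  - right; ring.
  - right; ring.
Qed.

Lemma driver_chen_defect s u t b : 0 <= s -> s <= u -> u <= t -> t <= T -> p (t - s) <= 1 ->
  pair_bound (driver_const * (p (u - s) * p (t - u) * p (t - s)) * norm b)
    (driver_const * e * (p (u - s) * p (t - u) * p (t - s)) * norm b)
    (chen_defect Z (second_order XX Z') s u t b) (chen_defect Z2 (second_order XX2 Z2') s u t b).
Proof.
  intros Hs Hsu Hut HtT H1.
  rewrite (controlled_chen_defect T X), (controlled_chen_defect T X2); auto;
    try apply HD.
  assert (P0 := Hp (t - s)). assert (P10 := Hp (u - s)). assert (P20 := Hp (t - u)).
  assert (L1 : p (u - s) <= p (t - s)) by (apply Hpm; lra).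
  assert (L2 : p (t - u) <= p (t - s)) by (apply Hpm; lra).
  assert (CX := da_X HD u t ltac:(lra) Hut HtT).
  assert (CXX := da_XX HD u t ltac:(lra) Hut HtT).
  assert (CR1 := da_rem HD s u Hs Hsu ltac:(lra)).
  assert (CR2 := da_rem HD u t ltac:(lra) Hut HtT).
  assert (Cs := da_Z' HD s ltac:(lra)).
  assert (Cu := da_Z' HD u ltac:(lra)).
  assert (CI := da_Z'_inc HD s u Hs Hsu ltac:(lra)).
  assert (CZ := driver_increment s u Hs Hsu ltac:(lra) ltac:(lra)).
  set (P := p (t - s)) in *. set (P1 := p (u - s)) in *. set (P2 := p (t - u)) in *.
  assert (Q1 : P1 ^ 2 <= P1 * P) by nra. assert (Q2 : P2 ^ 2 <= P2 * P) by nra.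
  assert (CXX' : pair_bound (B * (P2 * P)) (e * (P2 * P)) (XX u t) (XX2 u t)).
  { eapply pair_bound_le; [apply CXX| |]; apply Rmult_le_compat_l; lra. }
  assert (CR1' : pair_bound (B * (P1 * P)) (e * (P1 * P))
     (remainder X Z Z' s u) (remainder X2 Z2 Z2' s u)).
  { eapply pair_bound_le; [apply CR1| |]; apply Rmult_le_compat_l; lra. }
  assert (CR2' : pair_bound (B * (P2 * P)) (e * (P2 * P))
     (remainder X Z Z' u t) (remainder X2 Z2 Z2' u t)).
  { eapply pair_bound_le; [apply CR2| |]; apply Rmult_le_compat_l; lra. }
  assert (CI' : pair_bound (B * P) (e * P) (incr (A := VU) Z' s u) (incr (A := VU) Z2' s u)).
  { eapply pair_bound_le; [apply CI| |]; apply Rmult_le_compat_l; lra. }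
  assert (Cb := pair_bound_refl (norm b) b (Rle_refl _)).
  assert (b0 := norm_ge_0 b).
  eapply pair_bound_le.
  { apply pair_bound_opp. apply pair_bound_plus; apply pair_bound_plus.
    - apply (contract_pair_bound tens Ht C b b (norm b) 0 _ _ _ _ _ _ _ _ _ _ _ _ HC Cb CI Cs CXX').
    - apply (contract_pair_bound tens Ht C b b (norm b) 0 _ _ _ _ _ _ _ _ _ _ _ _ HC Cb Cu CI CXX').
    - apply pair_bound_app; [apply (pair_bound_app _ _ _ _ _ _ _ _ Cb CR1')|].
      apply pair_bound_app; [apply Cs|apply CX].
    - apply pair_bound_app; [apply (pair_bound_app _ _ _ _ _ _ _ _ Cb CZ)|].
      apply pair_bound_plus; [apply CR2'|].
      apply pair_bound_app; [apply CI'|apply CX]. }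
  - unfold driver_const.
    assert (k : forall n, (n <= 4)%nat -> 0 <= B ^ n <= B ^ 4).
    { intros n Hn. split; [apply pow_le; lra|]. now apply Rle_pow. }
    assert (k3 := k 3%nat ltac:(lia)).
    assert (H0 : 0 <= P1 * P2 * P * norm b) by (repeat apply Rmult_le_pos; auto).
    match goal with |- ?l <= _ => replace l with
      ((2 * C * B ^ 3 + 3 * B ^ 3 + 2 * B ^ 4) * (P1 * P2 * P * norm b)) by ring end.
    replace ((6 * C + 15) * B ^ 4 * (P1 * P2 * P) * norm b) with
      ((6 * (C * B ^ 4) + 15 * B ^ 4) * (P1 * P2 * P * norm b)) by ring.
    apply Rmult_le_compat_r; auto.
    assert (C * B ^ 3 <= C * B ^ 4) by (apply Rmult_le_compat_l; lra).
    assert (0 <= C * B ^ 4) by nra. lra.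
  - unfold driver_const.
    assert (k : forall n, (n <= 4)%nat -> 0 <= B ^ n <= B ^ 4).
    { intros n Hn. split; [apply pow_le; lra|]. now apply Rle_pow. }
    assert (k3 := k 3%nat ltac:(lia)). assert (k2 := k 2%nat ltac:(lia)).
    assert (H0 : 0 <= e * (P1 * P2 * P * norm b)) by (repeat apply Rmult_le_pos; auto).
    match goal with |- ?l <= _ => replace l with
      ((6 * C * B ^ 2 + 8 * B ^ 2 + 7 * B ^ 3) * (e * (P1 * P2 * P * norm b))) by ring end.
    replace ((6 * C + 15) * B ^ 4 * e * (P1 * P2 * P) * norm b) with
      ((6 * (C * B ^ 4) + 15 * B ^ 4) * (e * (P1 * P2 * P * norm b))) by ring.
    apply Rmult_le_compat_r; auto.
    assert (C * B ^ 2 <= C * B ^ 4) by (apply Rmult_le_compat_l; lra). lra.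
Qed.

Lemma driver_of_data {I : Type} (tau : I -> R) (In : I -> Prop) K :
  driver_const <= K ->
  (forall i, In i -> 0 <= tau i <= T) ->
  (forall s t, In s -> In t -> p (tau t - tau s) <= 1) ->
  driver_pair tau In p K (driver_const * e) (fun i => Z (tau i)) (fun i => Z2 (tau i))
    (fun i j => second_order XX Z' (tau i) (tau j))
    (fun i j => second_order XX2 Z2' (tau i) (tau j)).
Proof.
  intros HK HIn H1.
  assert (k : forall n, (n <= 4)%nat -> 0 <= B ^ n <= B ^ 4).
  { intros n Hn. split; [apply pow_le; lra|]. now apply Rle_pow. }
  assert (k3 := k 3%nat ltac:(lia)). assert (k2 := k 2%nat ltac:(lia)).
  assert (k1 := k 1%nat ltac:(lia)). rewrite pow_1 in k1.
  assert (CB : 0 <= C * B ^ 4) by nra.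
  assert (CB3 : C * B ^ 3 <= C * B ^ 4) by (apply Rmult_le_compat_l; lra).
  assert (CB2 : C * B ^ 2 <= C * B ^ 4) by (apply Rmult_le_compat_l; lra).
  assert (ED : driver_const = 6 * (C * B ^ 4) + 15 * B ^ 4) by (unfold driver_const; ring).
  split.
  - rewrite ED. apply Rmult_le_pos; lra.
  - intros s t Hs Ht' Hst. specialize (H1 s t Hs Ht').
    destruct (HIn s Hs), (HIn t Ht'). assert (P0 := Hp (tau t - tau s)).
    eapply pair_bound_le; [apply (driver_increment (tau s) (tau t)); auto| |].
    + apply Rmult_le_compat_r; lra.
    + apply Rmult_le_compat_r; auto. apply Rmult_le_compat_r; lra.
  - intros. apply contract_minus_b. exact Ht.
  - intros. apply contract_minus_b. exact Ht.
  - intros s t b Hs Ht' Hst. destruct (HIn s Hs), (HIn t Ht').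
    assert (P2 := pow2_ge_0 (p (tau t - tau s))).
    eapply pair_bound_le; [apply (driver_second_order (tau s) (tau t) b); auto| |].
    + apply Rmult_le_compat_r; [apply norm_ge_0|]. apply Rmult_le_compat_r; lra.
    + apply Rmult_le_compat_r; [apply norm_ge_0|]. apply Rmult_le_compat_r; auto.
      apply Rmult_le_compat_r; lra.
  - intros s u t b Hs Hu Ht' Hst. specialize (H1 s t Hs Ht').
    destruct (HIn s Hs), (HIn t Ht').
    assert (P0 := Hp (tau t - tau s)). assert (P1 := Hp (tau u - tau s)).
    assert (P2 := Hp (tau t - tau u)).
    assert (L1 : p (tau u - tau s) <= p (tau t - tau s)) by (apply Hpm; lra).
    assert (L2 : p (tau t - tau u) <= p (tau t - tau s)) by (apply Hpm; lra).
    assert (Hcube : p (tau u - tau s) * p (tau t - tau u) * p (tau t - tau s)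
        <= p (tau t - tau s) ^ 3).
    { replace (p (tau t - tau s) ^ 3) with
        (p (tau t - tau s) * p (tau t - tau s) * p (tau t - tau s)) by ring.
      apply Rmult_le_compat_r; auto. apply Rmult_le_compat; auto. }
    assert (Hprod : 0 <= p (tau u - tau s) * p (tau t - tau u) * p (tau t - tau s))
      by (repeat apply Rmult_le_pos; auto).
    eapply pair_bound_le; [apply (driver_chen_defect (tau s) (tau u) (tau t) b); auto; lra| |].
    + apply Rmult_le_compat_r; [apply norm_ge_0|]. apply Rmult_le_compat; auto; lra.
    + apply Rmult_le_compat_r; [apply norm_ge_0|]. apply Rmult_le_compat; auto; try lra.
      rewrite ED. apply Rmult_le_pos; lra.
Qed.
End DriverOfData.
End ControlledDriver.
Arguments da_B {U V VV tens T B e p X X2 XX XX2 Z Z2 Z' Z2'}.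
Arguments da_e {U V VV tens T B e p X X2 XX XX2 Z Z2 Z' Z2'}.
Arguments da_chen {U V VV tens T B e p X X2 XX XX2 Z Z2 Z' Z2'}.
Arguments da_chen2 {U V VV tens T B e p X X2 XX XX2 Z Z2 Z' Z2'}.
Arguments da_X {U V VV tens T B e p X X2 XX XX2 Z Z2 Z' Z2'}.
Arguments da_XX {U V VV tens T B e p X X2 XX XX2 Z Z2 Z' Z2'}.
Arguments da_Z' {U V VV tens T B e p X X2 XX XX2 Z Z2 Z' Z2'}.
Arguments da_Z'_inc {U V VV tens T B e p X X2 XX XX2 Z Z2 Z' Z2'}.
Arguments da_rem {U V VV tens T B e p X X2 XX XX2 Z Z2 Z' Z2'}.

Section GlobalStability.
Context {U W : NormedSpace} (F : W -> lin U W) (F0 : W -> W).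
Notation BB := (lin_NormedModule U (lin_NormedModule U W)).
Context {I : Type}.
Context (tau : I -> R) (Val : I -> Prop) (p : R -> R) (K S delta eps : R)
  (Z Z' : I -> U) (ZZ ZZ' : I -> I -> BB -> W) (Y Y' D D' : I -> W).

Notation h s t := (tau t - tau s).
Notation window a := (fun i => Val i /\ tau a <= tau i <= tau a + delta).
Notation A := (fun s t => minus (davie_rem F Z ZZ D Y s t) (davie_rem F Z' ZZ' D' Y' s t)).

Definition pair_in (s t : I) : Prop := Val s /\ Val t /\ tau s <= tau t <= tau s + delta.

Hypothesis HF : smooth K F F0.
Hypothesis HZ : forall a, Val a -> driver_pair tau (window a) p K eps Z Z' ZZ ZZ'.
Hypothesis Hp : forall x, 0 <= p x.
Hypothesis Hpm : forall x y, x <= y -> p x <= p y.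
Hypothesis Hd1 : 0 < delta.
Hypothesis Hpd1 : p delta <= 1.
Hypothesis Hlen : forall x, x <= delta -> x <= p x ^ 2.
Hypothesis HJ : forall s t, pair_in s t ->
  norm (davie_rem F Z ZZ D Y s t) <= K * p (h s t) ^ 3.
Hypothesis HJ' : forall s t, pair_in s t ->
  norm (davie_rem F Z' ZZ' D' Y' s t) <= K * p (h s t) ^ 3.
Hypothesis HD : forall s t, pair_in s t ->
  norm (dlt D s t) <= K * (h s t) /\ norm (dlt D' s t) <= K * (h s t).
Hypothesis HDD : forall Q s t, 0 <= Q -> pair_in s t ->
  (forall r, Val r -> tau s <= tau r <= tau t -> norm (minus (Y r) (Y' r)) <= Q) ->
  norm (minus (dlt D s t) (dlt D' s t)) <= (K * Q + eps) * (h s t).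
Hypothesis Hsew : forall s t C, 0 <= C -> pair_in s t ->
  (forall s' u t', Val s' -> Val u -> Val t' ->
     tau s <= tau s' -> tau s' <= tau u <= tau t' -> tau t' <= tau t ->
     norm (minus (A s' t') (plus (A s' u) (A u t'))) <= C * p (h s' t') ^ 3) ->
  norm (A s t) <= S * C * p (h s t) ^ 3 + eps * p (h s t) ^ 2.
Hypothesis HS : 1 <= S.
Hypothesis Hsmall : 120 * S * K ^ 6 * p delta <= 1.

Let g : R := 55 * K ^ 6.

Lemma window_stability a q : Val a -> norm (minus (Y a) (Y' a)) <= q ->
  (forall t, window a t -> norm (minus (Y t) (Y' t)) <= g * (q + eps)) /\
  (forall t, window a t ->
     norm (minus (dlt Y a t) (dlt Y' a t)) <= g * (q + eps) * p (h a t)) /\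
  (forall t, window a t ->
     norm (minus (first_rem F Z Y a t) (first_rem F Z' Y' a t)) <=
     g * (q + eps) * p (h a t) ^ 2).
Proof.
  intros Ha Hq.
  assert (Hw : forall s t, window a s -> window a t -> tau s <= tau t -> pair_in s t).
  { intros s t [Vs Ws] [Vt Wt] Hst. repeat split; auto; lra. }
  assert (Hself : window a a) by (split; auto; lra).
  destruct (local_stability F F0 tau (window a) p K S (p delta) eps q Z Z' ZZ ZZ' Y Y' D D' a)
    as (L1 & L2 & L3); auto.
  - intros s t [_ Ws] [_ Wt]. apply Hpm; lra.
  - intros s t [_ Ws] [_ Wt]. apply Hlen; lra.
  - intros Q HQ HQ' s t Ws Wt Hst. apply HDD; auto.
    intros r Vr Hr. apply HQ'. split; auto. destruct Ws, Wt; lra.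
  - intros C HC HA s t Ws Wt Hst. apply Hsew; auto.
    intros s' u t' Vs Vu Vt H1 H2 H3. destruct Ws as [_ Ws], Wt as [_ Wt].
    assert (tau u <= tau t') by lra. assert (tau s' <= tau u) by lra.
    apply HA; auto; split; auto; lra.
  - intros t [_ Wt]. lra.
  - split; [|split]; intros t Ht.
    + apply L1, Ht.
    + apply L2; auto. destruct Ht; lra.
    + apply L3; auto. destruct Ht; lra.
Qed.

Context (pt : nat -> I) (T : R).
Hypothesis HVal : forall i, Val i -> 0 <= tau i <= T.
Hypothesis Hpt : forall j, INR j * delta <= T -> Val (pt j) /\ tau (pt j) = INR j * delta.

(** Each window of length [delta] multiplies the error by a constant. *)
Lemma global_stability q m :
  0 <= eps -> (forall i, Val i -> tau i = 0 -> norm (minus (Y i) (Y' i)) <= q) -> 0 <= q ->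
  forall i, Val i -> tau i <= INR m * delta ->
  norm (minus (Y i) (Y' i)) <= (2 * g) ^ m * (q + eps).
Proof.
  intros He Hq Hq0. assert (HK := sm_K HF).
  assert (g1 : 1 <= g).
  { unfold g. assert (1 <= K ^ 6) by (apply pow_R1_Rle; lra). lra. }
  assert (main : forall m i, Val i -> tau i <= INR m * delta ->
    norm (minus (Y i) (Y' i)) + eps <= (2 * g) ^ m * (q + eps)).
  2: { intros i Hi Hm. generalize (main m i Hi Hm). lra. }
  clear m. induction m as [|m IH]; intros i Hi Hm.
  - simpl in *. assert (tau i = 0) by (generalize (HVal i Hi); lra).
    generalize (Hq i Hi H). lra.
  - assert (gm : 1 <= (2 * g) ^ m) by (apply pow_R1_Rle; lra).
    assert (X0 : 0 <= (2 * g) ^ m * (q + eps)) by nra.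
    destruct (Rle_dec (tau i) (INR m * delta)) as [L|L].
    { eapply Rle_trans; [apply IH; auto|]. simpl. nra. }
    rewrite S_INR in Hm.
    assert (HT := HVal i Hi).
    destruct (Hpt m ltac:(lra)) as [Vm Em].
    assert (B := IH (pt m) Vm ltac:(lra)).
    destruct (window_stability (pt m) _ Vm (Rle_refl _)) as [L1 _].
    assert (norm (minus (Y i) (Y' i)) <= g * (norm (minus (Y (pt m)) (Y' (pt m))) + eps)).
    { apply L1. split; auto. lra. }
    assert (g * (norm (minus (Y (pt m)) (Y' (pt m))) + eps) <= g * ((2 * g) ^ m * (q + eps)))
      by (apply Rmult_le_compat_l; lra).
    assert (eps <= g * ((2 * g) ^ m * (q + eps))).
    { apply Rle_trans with (q + eps); [lra|]. nra. }
    simpl. lra.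
Qed.
End GlobalStability.

(** * Hölder seminorms *)

Lemma lub_upper (E : R -> Prop) x : is_finite (Lub_Rbar E) -> E x -> x <= Lub_Rbar E.
Proof.
  intros H Hx. destruct (Lub_Rbar_correct E) as [ub _].
  specialize (ub x Hx). now rewrite <- H in ub.
Qed.

Lemma lub_least (E : R -> Prop) c : (forall x, E x -> x <= c) -> Rbar_le (Lub_Rbar E) c.
Proof.
  intros H. destruct (Lub_Rbar_correct E) as [_ least]. apply least. exact H.
Qed.

Lemma lub_finite (E : R -> Prop) c x0 : E x0 -> (forall x, E x -> x <= c) ->
  is_finite (Lub_Rbar E).
Proof.
  intros H0 H. destruct (Lub_Rbar_correct E) as [ub _].
  specialize (ub x0 H0). assert (L := lub_least E c H).
  destruct (Lub_Rbar E); simpl in *; try tauto. reflexivity.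
Qed.

Lemma eq_or_lt s t : s <= t -> s = t \/ s < t.
Proof. intros [H|H]; auto. Qed.

Section Seminorms.
Context {A : NormedSpace} (T a : R).
Hypothesis HT : 0 < T.
Implicit Types (X : R -> A) (XX : R -> R -> A).

Lemma incr_diag X t : incr X t t = zero.
Proof. unfold incr. vec. Qed.

Lemma quotient_le n c b : 0 < b -> n <= c * b -> n / b <= c.
Proof.
  intros Hb H. apply Rmult_le_reg_r with b; auto.
  unfold Rdiv. rewrite Rmult_assoc, Rinv_l by lra. lra.
Qed.

Lemma le_of_quotient n c b : 0 < b -> n / b <= c -> n <= c * b.
Proof.
  intros Hb H. apply Rmult_le_compat_r with (r := b) in H; [|lra].
  unfold Rdiv in H. rewrite Rmult_assoc, Rinv_l in H by lra. lra.
Qed.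

Lemma hoelder_bound X : is_finite (hoelder T a X) ->
  forall s t, 0 <= s -> s <= t -> t <= T ->
  norm (incr X s t) <= hoelder T a X * pw a (t - s).
Proof.
  intros H s t Hs Hst Ht. destruct (eq_or_lt s t Hst) as [->|N].
  - rewrite incr_diag, norm_zero_eq. replace (t - t) with 0 by ring. rewrite pw_zero. lra.
  - rewrite pw_pos by lra. apply le_of_quotient; [apply Rpower_gt_0|].
    apply lub_upper; auto. exists s, t. rewrite Rabs_right by lra. repeat split; auto; lra.
Qed.

Lemma hoelder_ge_0 X : is_finite (hoelder T a X) -> 0 <= hoelder T a X.
Proof.
  intros H. assert (B := hoelder_bound X H 0 T ltac:(lra) ltac:(lra) ltac:(lra)).
  rewrite pw_pos in B by lra.
  assert (N := norm_ge_0 (incr X 0 T)). assert (P := Rpower_gt_0 (T - 0) a).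
  destruct (Rle_dec 0 (hoelder T a X)); auto. nra.
Qed.

Lemma hoelder_le X c :
  (forall s t, 0 <= s -> s <= t -> t <= T -> norm (incr X s t) <= c * pw a (t - s)) ->
  Rbar_le (hoelder T a X) c /\ is_finite (hoelder T a X).
Proof.
  intros H.
  assert (U : forall x, (exists s t, 0 <= s <= T /\ 0 <= t <= T /\ s <> t /\
    x = norm (incr X s t) / Rpower (Rabs (t - s)) a) -> x <= c).
  { intros x (s & t & Hs & Ht & N & ->). apply quotient_le; [apply Rpower_gt_0|].
    destruct (Rle_dec s t) as [L|L].
    - rewrite Rabs_right by lra. rewrite <- pw_pos by lra. apply H; lra.
    - rewrite Rabs_left by lra. rewrite <- pw_pos by lra.
      replace (- (t - s)) with (s - t) by ring.
      unfold incr. rewrite norm_minus_sym. apply H; lra. }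
  split; [now apply lub_least|].
  apply (lub_finite _ c (norm (incr X 0 T) / Rpower (Rabs (T - 0)) a)); auto.
  exists 0, T. repeat split; lra.
Qed.

Lemma hoelder2_bound XX : is_finite (hoelder2 T (2 * a) XX) ->
  forall s t, 0 <= s -> s < t -> t <= T ->
  norm (XX s t) <= hoelder2 T (2 * a) XX * pw a (t - s) ^ 2.
Proof.
  intros H s t Hs Hst Ht. rewrite pw_sqr.
  rewrite pw_pos by lra. apply le_of_quotient; [apply Rpower_gt_0|].
  apply lub_upper; auto. exists s, t. rewrite Rabs_right by lra. repeat split; auto; lra.
Qed.

Lemma hoelder2_ge_0 XX : is_finite (hoelder2 T (2 * a) XX) -> 0 <= hoelder2 T (2 * a) XX.
Proof.
  intros H. assert (B := hoelder2_bound XX H 0 T ltac:(lra) ltac:(lra) ltac:(lra)).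
  rewrite pw_sqr, pw_pos in B by lra.
  assert (N := norm_ge_0 (XX 0 T)). assert (P := Rpower_gt_0 (T - 0) (2 * a)).
  destruct (Rle_dec 0 (hoelder2 T (2 * a) XX)); auto. nra.
Qed.

Lemma hoelder2_le XX c :
  (forall s t, 0 <= s -> s < t -> t <= T -> norm (XX s t) <= c * pw a (t - s) ^ 2) ->
  Rbar_le (hoelder2 T (2 * a) XX) c /\ is_finite (hoelder2 T (2 * a) XX).
Proof.
  intros H.
  assert (U : forall x, (exists s t, 0 <= s /\ s < t /\ t <= T /\
    x = norm (XX s t) / Rpower (Rabs (t - s)) (2 * a)) -> x <= c).
  { intros x (s & t & Hs & Hst & Ht & ->). apply quotient_le; [apply Rpower_gt_0|].
    rewrite Rabs_right by lra. rewrite <- pw_pos by lra. rewrite <- pw_sqr. now apply H. }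
  split; [now apply lub_least|].
  apply (lub_finite _ c (norm (XX 0 T) / Rpower (Rabs (T - 0)) (2 * a))); auto.
  exists 0, T. repeat split; lra.
Qed.

Lemma sup_on_bound X : is_finite (sup_on T X) -> forall t, 0 <= t <= T ->
  norm (X t) <= sup_on T X.
Proof. intros H t Ht. apply lub_upper; auto. now exists t. Qed.

Lemma sup_on_finite X : 0 <= a -> is_finite (hoelder T a X) -> is_finite (sup_on T X).
Proof.
  intros Ha H. apply (lub_finite _ (norm (X 0) + hoelder T a X * pw a T) (norm (X 0))).
  - exists 0. split; auto; lra.
  - intros x (t & Ht & ->). replace (X t) with (plus (X 0) (incr X 0 t)) by (unfold incr; vec).
    apply norm_plus_le; [lra|].
    eapply Rle_trans; [apply (hoelder_bound X H); lra|].
    apply Rmult_le_compat_l; [now apply hoelder_ge_0|]. apply pw_mono; lra.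
Qed.
End Seminorms.

Lemma pw_le_self a x : 0 <= a <= 1 -> 1 <= x -> pw a x <= x.
Proof.
  intros Ha Hx. rewrite pw_pos by lra. apply Rle_trans with (Rpower x 1).
  - apply Rle_Rpower; lra.
  - rewrite Rpower_1; lra.
Qed.

(** * Size and distance of rough data *)

Section DataSize.
Context {U V VV : NormedSpace} (tens : V -> V -> VV).
Notation VU := (lin_NormedModule V U).
Hypothesis Ht : is_tensor_square tens.

Record data_size (T B : R) (p : R -> R) (X : R -> V) (XX : R -> R -> VV)
    (Z : R -> U) (Z' : R -> lin V U) : Prop := {
  ds_chen : chen_relation tens T X XX;
  ds_X : forall s t, 0 <= s -> s <= t -> t <= T -> norm (incr X s t) <= B * p (t - s);
  ds_XX : forall s t, 0 <= s -> s <= t -> t <= T -> norm (XX s t) <= B * p (t - s) ^ 2;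
  ds_Z' : forall s, 0 <= s <= T -> norm (Z' s) <= B;
  ds_Z'_inc : forall s t, 0 <= s -> s <= t -> t <= T ->
    norm (incr (A := VU) Z' s t) <= B * p (t - s);
  ds_rem : forall s t, 0 <= s -> s <= t -> t <= T ->
    norm (remainder X Z Z' s t) <= B * p (t - s) ^ 2
}.

Arguments ds_chen {T B p X XX Z Z'}.
Arguments ds_X {T B p X XX Z Z'}.
Arguments ds_XX {T B p X XX Z Z'}.
Arguments ds_Z' {T B p X XX Z Z'}.
Arguments ds_Z'_inc {T B p X XX Z Z'}.
Arguments ds_rem {T B p X XX Z Z'}.

Lemma data_pair_refl T B p X XX Z Z' : 1 <= B -> data_size T B p X XX Z Z' ->
  data_pair tens T B 0 p X X XX XX Z Z Z' Z'.
Proof.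
  intros HB [H1 H2 H3 H4 H5 H6]. split; auto; try lra; intros; try rewrite Rmult_0_l;
    apply pair_bound_refl; auto.
Qed.

Lemma chen_diag T X XX s : chen_relation tens T X XX -> 0 <= s <= T -> XX s s = zero.
Proof.
  intros HC Hs. assert (E := HC s s s ltac:(lra) ltac:(lra) ltac:(lra) ltac:(lra)).
  assert (Z : tens (incr X s s) (incr X s s) = zero).
  { rewrite incr_diag.
    exact (linear_map_comb (fun v => tens v zero) (fun _ => 0) nil (proj1 (proj1 Ht) zero)). }
  rewrite Z in E.
  transitivity (minus (plus (plus (XX s s) (XX s s)) zero) (XX s s)); [vec|].
  rewrite <- E. vec.
Qed.

Lemma remainder_diag X (Z : R -> U) (Z' : R -> lin V U) s : remainder X Z Z' s s = zero.
Proof. unfold remainder. rewrite !incr_diag, lin_zero_arg. vec. Qed.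

Lemma Rmax_le_iff a b c : Rmax a b <= c -> a <= c /\ b <= c.
Proof. intros H. split; eapply Rle_trans; [apply Rmax_l|apply H|apply Rmax_r|apply H]. Qed.

Lemma le_of_sqrt_le x c : 0 <= x -> sqrt x <= c -> x <= c ^ 2.
Proof.
  intros Hx H. rewrite <- (sqrt_sqrt x Hx). simpl. rewrite Rmult_1_r.
  apply Rmult_le_compat; auto; apply sqrt_pos.
Qed.

Lemma controlled_norm_bounds {A : NormedSpace} T alpha B X (Z : R -> A) (Z' : R -> lin V A) :
  0 < T -> 0 <= alpha -> controlled T alpha X Z Z' -> controlled_norm T alpha X Z Z' <= B ->
  (forall s, 0 <= s <= T -> norm (Z' s) <= B) /\
  (forall s t, 0 <= s -> s <= t -> t <= T ->
    norm (incr (A := lin_NormedModule V A) Z' s t) <= B * pw alpha (t - s)) /\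
  (forall s t, 0 <= s -> s <= t -> t <= T ->
    norm (remainder X Z Z' s t) <= B * pw alpha (t - s) ^ 2).
Proof.
  intros HT Ha [F1 F2] H.
  apply Rmax_le_iff in H as [H1 H2]. apply Rmax_le_iff in H1 as [_ H1].
  apply Rmax_le_iff in H2 as [H2 H3].
  assert (F0 := sup_on_finite T alpha HT (A := lin_NormedModule V A) Z' Ha F1).
  repeat split.
  - intros s Hs. eapply Rle_trans; [apply (sup_on_bound T (A := lin_NormedModule V A) Z' F0 s Hs)|].
    exact H1.
  - intros s t Hs Hst Ht'.
    eapply Rle_trans; [apply (hoelder_bound T alpha (A := lin_NormedModule V A) Z' F1); auto|].
    apply Rmult_le_compat_r; [apply pw_ge_0|auto].
  - intros s t Hs Hst Ht'. destruct (eq_or_lt s t Hst) as [->|N].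
    + unfold remainder. rewrite !incr_diag, lin_zero_arg.
      apply (norm_le_of_eq _ zero); [vec|]. rewrite norm_zero_eq.
      replace (t - t) with 0 by ring. rewrite pw_zero. lra.
    + eapply Rle_trans; [apply (hoelder2_bound T alpha _ F2); auto|].
      apply Rmult_le_compat_r; [apply pow2_ge_0|auto].
Qed.

Lemma data_size_of_norms T alpha B X XX (Z : R -> U) (Z' : R -> lin V U) :
  0 < T -> 0 <= alpha -> 1 <= B ->
  rough_path T alpha tens X XX -> controlled T alpha X Z Z' ->
  rough_norm T alpha X XX <= B -> controlled_norm T alpha X Z Z' <= B ->
  data_size T (B ^ 2) (pw alpha) X XX Z Z'.
Proof.
  intros HT Ha HB (F1 & F2 & HC) HZ HX HZn.
  destruct (controlled_norm_bounds T alpha B X Z Z' HT Ha HZ HZn) as (Z1 & Z2 & Z3).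
  apply Rmax_le_iff in HX as [X1 X2].
  apply le_of_sqrt_le in X2; [|now apply hoelder2_ge_0].
  assert (BB : B <= B ^ 2) by nra.
  assert (up : forall x y, 0 <= y -> x <= B * y -> x <= B ^ 2 * y) by (intros; nra).
  split; auto.
  - intros s t Hs Hst Ht'. apply up; [apply pw_ge_0|].
    eapply Rle_trans; [apply (hoelder_bound T alpha X F1); auto|].
    apply Rmult_le_compat_r; [apply pw_ge_0|auto].
  - intros s t Hs Hst Ht'. destruct (eq_or_lt s t Hst) as [->|N].
    + rewrite (chen_diag T X) by (auto; lra). rewrite norm_zero_eq.
      apply Rmult_le_pos; [lra|apply pow2_ge_0].
    + eapply Rle_trans; [apply (hoelder2_bound T alpha _ F2); auto|].
      apply Rmult_le_compat_r; [apply pow2_ge_0|auto].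
  - intros s Hs. eapply Rle_trans; [apply Z1, Hs|auto].
  - intros s t Hs Hst Ht'. apply up; [apply pw_ge_0|now apply Z2].
  - intros s t Hs Hst Ht'. apply up; [apply pow2_ge_0|now apply Z3].
Qed.

(** The distance of rough paths only controls the square root of the seminorm of
    [XX - XX2].  As this seminorm is also at most [2 B^2], it is at most
    [2 B] times its square root, so the dependence on [d] remains linear. *)
Lemma data_pair_of_norms T alpha B d X XX X2 XX2 (Z Z2 : R -> U) (Z' Z2' : R -> lin V U) :
  0 < T <= B -> 0 <= alpha <= 1 -> 1 <= B ->
  rough_path T alpha tens X XX -> rough_path T alpha tens X2 XX2 ->
  controlled T alpha X Z Z' -> controlled T alpha X2 Z2 Z2' ->
  rough_norm T alpha X XX <= B -> rough_norm T alpha X2 XX2 <= B ->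
  controlled_norm T alpha X Z Z' <= B -> controlled_norm T alpha X2 Z2 Z2' <= B ->
  real (controlled_dist T alpha X Z Z' X2 Z2 Z2') <= d ->
  rough_dist T alpha X XX X2 XX2 <= d ->
  norm (minus (Z' 0) (Z2' 0)) <= d ->
  data_pair tens T (B ^ 2) (2 * B * d) (pw alpha) X X2 XX XX2 Z Z2 Z' Z2'.
Proof.
  intros [HT HTB] Ha HB RX RX2 CZ CZ2 NX NX2 NZ NZ2 D1 D2 D3.
  assert (S1 := data_size_of_norms T alpha B X XX Z Z' HT (proj1 Ha) HB RX CZ NX NZ).
  assert (S2 := data_size_of_norms T alpha B X2 XX2 Z2 Z2' HT (proj1 Ha) HB RX2 CZ2 NX2 NZ2).
  assert (d0 : 0 <= d) by exact (norm_le_ge_0 (A := VU) _ _ D3).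
  assert (Bd : d <= B * d) by nra.
  apply Rmax_le_iff in D2 as [DX DXX].
  set (dX := fun t => minus (X t) (X2 t)) in *.
  set (dXX := fun s t => minus (XX s t) (XX2 s t)) in *.
  assert (FX : is_finite (hoelder T alpha dX)).
  { apply (hoelder_le T alpha HT dX (B ^ 2 + B ^ 2)). intros s t Hs Hst Ht'.
    unfold dX, incr. apply (norm_le_of_eq _ (minus (incr X s t) (incr X2 s t)));
      [unfold incr; vec|].
    rewrite Rmult_plus_distr_r. apply norm_minus_le; [apply (ds_X S1)|apply (ds_X S2)]; auto. }
  assert (FXX' : Rbar_le (hoelder2 T (2 * alpha) dXX) (2 * B ^ 2) /\
                 is_finite (hoelder2 T (2 * alpha) dXX)).
  { apply (hoelder2_le T alpha HT dXX). intros s t Hs Hst Ht'.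
    unfold dXX. replace (2 * B ^ 2) with (B ^ 2 + B ^ 2) by ring.
    rewrite Rmult_plus_distr_r. apply norm_minus_le; [apply (ds_XX S1)|apply (ds_XX S2)]; auto; lra. }
  destruct FXX' as [LXX FXX].
  set (dZ' := fun t => minus (Z' t) (Z2' t)) in *.
  set (dR := fun s t => minus (remainder X Z Z' s t) (remainder X2 Z2 Z2' s t)).
  assert (FZ : is_finite (hoelder T alpha (A := VU) dZ')).
  { apply (hoelder_le T alpha HT (A := VU) dZ' (B ^ 2 + B ^ 2)). intros s t Hs Hst Ht'.
    apply (norm_le_of_eq (A := VU) _ (minus (incr (A := VU) Z' s t) (incr (A := VU) Z2' s t)));
      [unfold incr, dZ'; vec|].
    rewrite Rmult_plus_distr_r.
    apply norm_minus_le; [apply (ds_Z'_inc S1)|apply (ds_Z'_inc S2)]; auto. }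
  assert (FR : is_finite (hoelder2 T (2 * alpha) dR)).
  { apply (hoelder2_le T alpha HT dR (B ^ 2 + B ^ 2)). intros s t Hs Hst Ht'. unfold dR.
    rewrite Rmult_plus_distr_r.
    apply norm_minus_le; [apply (ds_rem S1)|apply (ds_rem S2)]; auto; lra. }
  assert (DZ : hoelder2 T (2 * alpha) dR <= d /\ hoelder T alpha (A := VU) dZ' <= d).
  { unfold controlled_dist in D1.
    change (real (Rbar_plus (hoelder2 T (2 * alpha) dR) (hoelder T alpha (A := VU) dZ')) <= d) in D1.
    rewrite <- FZ, <- FR in D1. simpl in D1.
    assert (N1 := hoelder_ge_0 T alpha HT (A := VU) dZ' FZ).
    assert (N2 := hoelder2_ge_0 T alpha HT dR FR). split; lra. }
  destruct DZ as [DR DZ].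
  assert (NXX := hoelder2_ge_0 T alpha HT dXX FXX).
  assert (KXX : hoelder2 T (2 * alpha) dXX <= 2 * B * d).
  { rewrite <- (sqrt_sqrt _ NXX). apply Rmult_le_compat; try apply sqrt_pos; auto.
    rewrite <- FXX in LXX. simpl in LXX.
    rewrite <- (sqrt_pow2 (2 * B)) by lra. apply sqrt_le_1_alt. nra. }
  assert (HpT : pw alpha T <= B).
  { apply Rle_trans with (pw alpha B); [apply pw_mono; lra|]. apply pw_le_self; auto. }
  assert (IZ : forall s t, 0 <= s -> s <= t -> t <= T ->
    norm (minus (incr (A := VU) Z' s t) (incr (A := VU) Z2' s t)) <= d * pw alpha (t - s)).
  { intros s t Hs Hst Ht'.
    apply (norm_le_of_eq (A := VU) _ (incr (A := VU) dZ' s t)); [unfold incr, dZ'; vec|].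
    eapply Rle_trans; [apply (hoelder_bound T alpha (A := VU) dZ' FZ); auto|].
    apply Rmult_le_compat_r; [apply pw_ge_0|auto]. }
  split.
  - nra.
  - apply Rmult_le_pos; lra.
  - apply S1.
  - apply S2.
  - intros s t Hs Hst Ht'.
    split; [apply (ds_X S1)|split; [apply (ds_X S2)|]]; auto.
    apply (norm_le_of_eq _ (incr dX s t)); [unfold dX, incr; vec|].
    eapply Rle_trans; [apply (hoelder_bound T alpha dX FX); auto|].
    apply Rmult_le_compat_r; [apply pw_ge_0|]. lra.
  - intros s t Hs Hst Ht'.
    split; [apply (ds_XX S1)|split; [apply (ds_XX S2)|]]; auto.
    destruct (eq_or_lt s t Hst) as [->|N].
    + rewrite (chen_diag T X) by (try apply S1; lra).
      rewrite (chen_diag T X2) by (try apply S2; lra).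
      rewrite norm_minus_diag. apply Rmult_le_pos; [nra|apply pow2_ge_0].
    + eapply Rle_trans; [apply (hoelder2_bound T alpha dXX FXX); lra|].
      apply Rmult_le_compat_r; [apply pow2_ge_0|]. lra.
  - intros s Hs.
    split; [apply (ds_Z' S1)|split; [apply (ds_Z' S2)|]]; auto.
    apply (norm_le_of_eq (A := VU) _ (plus (minus (Z' 0) (Z2' 0))
       (minus (incr (A := VU) Z' 0 s) (incr (A := VU) Z2' 0 s)))); [unfold incr; vec|].
    eapply Rle_trans; [apply (norm_plus_le (A := VU)); [apply D3|apply IZ; lra]|].
    assert (pw alpha (s - 0) <= B).
    { apply Rle_trans with (pw alpha T); [apply pw_mono; lra|auto]. }
    nra.
  - intros s t Hs Hst Ht'.
    split; [apply (ds_Z'_inc S1)|split; [apply (ds_Z'_inc S2)|]]; auto.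
    eapply Rle_trans; [apply IZ; auto|].
    apply Rmult_le_compat_r; [apply pw_ge_0|]. lra.
  - intros s t Hs Hst Ht'.
    split; [apply (ds_rem S1)|split; [apply (ds_rem S2)|]]; auto.
    destruct (eq_or_lt s t Hst) as [->|N].
    + rewrite !remainder_diag, norm_minus_diag. apply Rmult_le_pos; [nra|apply pow2_ge_0].
    + eapply Rle_trans; [apply (hoelder2_bound T alpha dR FR); lra|].
      apply Rmult_le_compat_r; [apply pow2_ge_0|]. lra.
Qed.
End DataSize.
Arguments ds_chen {U V VV tens T B p X XX Z Z'}.
Arguments ds_X {U V VV tens T B p X XX Z Z'}.
Arguments ds_XX {U V VV tens T B p X XX Z Z'}.
Arguments ds_Z' {U V VV tens T B p X XX Z Z'}.
Arguments ds_Z'_inc {U V VV tens T B p X XX Z Z'}.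
Arguments ds_rem {U V VV tens T B p X XX Z Z'}.

(** * Partitions and the sewing bound for rough integrals *)

Section Partitions.
Context {E : NormedSpace}.
Implicit Types Xi : R -> R -> E.

Lemma is_partition_app s u t p1 p2 :
  is_partition s u p1 -> is_partition u t p2 -> is_partition s t (p1 ++ p2).
Proof.
  revert s. induction p1 as [|x p1 IH]; simpl; intros s; [now intros ->|].
  intros [H1 H2] H3. split; auto.
Qed.

Lemma mesh_app s u p1 p2 d :
  is_partition s u p1 -> mesh s p1 < d -> mesh u p2 < d -> mesh s (p1 ++ p2) < d.
Proof.
  revert s. induction p1 as [|x p1 IH]; simpl; intros s; [now intros ->|].
  intros [H1 H2] H3 H4. apply Rmax_lub_lt.
  - eapply Rle_lt_trans; [apply Rmax_l|apply H3].
  - apply IH; auto. eapply Rle_lt_trans; [apply Rmax_r|apply H3].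
Qed.

Lemma partition_sum_app Xi s u p1 p2 : is_partition s u p1 ->
  partition_sum Xi s (p1 ++ p2) = plus (partition_sum Xi s p1) (partition_sum Xi u p2).
Proof.
  revert s. induction p1 as [|x p1 IH]; simpl; intros s.
  - intros ->. vec.
  - intros [_ H]. rewrite (IH x H). vec.
Qed.

Lemma partition_le s t p : is_partition s t p -> s <= t.
Proof.
  revert s. induction p as [|x p IH]; simpl; intros s; [intros ->; lra|].
  intros [H1 H2]. generalize (IH _ H2). lra.
Qed.

Fixpoint uniform (s h : R) (n : nat) : list R :=
  match n with
  | O => nil
  | S n => (s + h) :: uniform (s + h) h n
  end.

Lemma is_partition_uniform s h n : 0 < h -> is_partition s (s + INR n * h) (uniform s h n).
Proof.
  intros Hh. revert s. induction n as [|n IH]; intros s.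
  - simpl. ring.
  - cbn [uniform is_partition]. split; [lra|].
    replace (s + INR (S n) * h) with (s + h + INR n * h) by (rewrite S_INR; ring). apply IH.
Qed.

Lemma mesh_uniform s h n : 0 <= h -> mesh s (uniform s h n) <= h.
Proof.
  intros Hh. revert s. induction n as [|n IH]; intros s; simpl; auto.
  apply Rmax_lub; [lra|apply IH].
Qed.

Fixpoint uniform_sum Xi (s h : R) (n : nat) : E :=
  match n with
  | O => zero
  | S n => plus (uniform_sum Xi s h n) (Xi (s + INR n * h) (s + INR (S n) * h))
  end.

Lemma partition_sum_uniform Xi s h n :
  partition_sum Xi s (uniform s h n) = uniform_sum Xi s h n.
Proof.
  assert (shift : forall n s, uniform_sum Xi s h (S n) =
    plus (Xi s (s + h)) (uniform_sum Xi (s + h) h n)).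
  { induction n0 as [|m IH]; intros r.
    - simpl. replace (r + 0 * h) with r by ring. replace (r + 1 * h) with (r + h) by ring.
      vec.
    - change (uniform_sum Xi r h (S (S m))) with
        (plus (uniform_sum Xi r h (S m)) (Xi (r + INR (S m) * h) (r + INR (S (S m)) * h))).
      rewrite IH. cbn [uniform_sum].
      replace (r + h + INR m * h) with (r + INR (S m) * h) by (rewrite S_INR; ring).
      replace (r + h + INR (S m) * h) with (r + INR (S (S m)) * h) by (rewrite (S_INR (S m)); ring).
      vec. }
  revert s. induction n as [|n IH]; intros s; auto.
  rewrite shift. cbn [uniform partition_sum]. now rewrite IH.
Qed.

(** [mo_half] is what makes sewing converge: cutting an interval into halves
    multiplies the total of the errors of order three by [q]. *)
Record modulus (p : R -> R) (q : R) : Prop := {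
  mo_q : 0 <= q < 1;
  mo_pos : forall x, 0 <= p x;
  mo_mono : forall x y, x <= y -> p x <= p y;
  mo_half : forall x, 0 <= x -> 2 * p (x / 2) ^ 3 <= q * p x ^ 3
}.

Arguments mo_q {p q}.
Arguments mo_pos {p q}.
Arguments mo_mono {p q}.
Arguments mo_half {p q}.

Lemma cube_mono x y : 0 <= x -> x <= y -> 0 <= x ^ 3 <= y ^ 3.
Proof. intros. split; [now apply pow_le|now apply pow_incr]. Qed.

Lemma uniform_sum_sewing Xi p q M s t n :
  modulus p q -> 0 <= M -> s < t -> (0 < n)%nat ->
  (forall r, s <= r <= t -> Xi r r = zero) ->
  (forall a u b, s <= a -> a <= u -> u <= b -> b <= t ->
     norm (minus (plus (Xi a u) (Xi u b)) (Xi a b)) <= M * p (b - a) ^ 3) ->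
  norm (minus (uniform_sum Xi s ((t - s) / INR n) n) (Xi s t)) <=
  2 / (1 - q) * M * p (t - s) ^ 3.
Proof.
  intros [Hq Hp Hpm Hh] HM Hst Hn H0 HX.
  assert (Hn' : 0 < INR n) by now apply lt_0_INR.
  set (h := (t - s) / INR n).
  assert (h0 : 0 < h) by (apply Rdiv_lt_0_compat; lra).
  assert (En : INR n * h = t - s) by (unfold h; field; lra).
  set (tm := fun i : nat => s + INR i * h).
  assert (tm_le : forall i, (i <= n)%nat -> s <= tm i <= t).
  { intros i Hi. apply le_INR in Hi. assert (0 <= INR i) by apply pos_INR.
    unfold tm. split; [nra|]. assert (INR i * h <= INR n * h) by (apply Rmult_le_compat_r; lra). lra. }
  assert (tm_mono : forall i j, (i <= j)%nat -> tm i <= tm j).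
  { intros i j Hij. apply le_INR in Hij. unfold tm.
    assert (INR i * h <= INR j * h) by (apply Rmult_le_compat_r; lra). lra. }
  set (A := fun i k : nat => minus (minus (uniform_sum Xi s h k) (uniform_sum Xi s h i)) (Xi (tm i) (tm k))).
  assert (HA := discrete_sewing A (fun x => p x ^ 3) h M 0 q 0 n).
  assert (B : norm (A 0%nat n) <= 2 / (1 - q) * M * p (INR (n - 0) * h) ^ 3 + 0 * INR (n - 0)).
  { apply HA; auto; try lra; try lia.
    - intros x. now apply pow_le.
    - intros x y Hxy. apply cube_mono; auto.
    - intros i Hi. unfold A. rewrite H0 by (apply tm_le; lia). vec.
    - intros i j k Hi Hj Hk. unfold A.
      apply (norm_le_of_eq _ (minus (plus (Xi (tm i) (tm j)) (Xi (tm j) (tm k))) (Xi (tm i) (tm k)))); [vec|].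
      replace (INR (k - i) * h) with (tm k - tm i)
        by (unfold tm; rewrite minus_INR by lia; ring).
      apply HX; try apply tm_le; try apply tm_mono; lia.
    - intros i Hi. unfold A. cbn [uniform_sum]. fold (tm i) (tm (S i)).
      apply (norm_le_of_eq _ zero); [vec|]. rewrite norm_zero_eq; lra. }
  replace (n - 0)%nat with n in B by lia. rewrite En in B.
  apply (norm_le_of_eq _ (A 0%nat n)); [|lra].
  unfold A. simpl uniform_sum at 3.
  replace (tm 0%nat) with s by (unfold tm; simpl; ring).
  replace (tm n) with t by (unfold tm; lra). vec.
Qed.

(** A fine partition of [[0, s]] followed by a uniform one of [[s, t]] is a fine
    partition of [[0, t]], and its sum over [[s, t]] is within the sewing error
    of [Xi s t], whatever the mesh. *)
Lemma integral_germ_bound Xi p q M s t Is It :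
  modulus p q -> 0 <= M -> 0 <= s -> s <= t ->
  (forall r, s <= r <= t -> Xi r r = zero) ->
  (forall a u b, s <= a -> a <= u -> u <= b -> b <= t ->
     norm (minus (plus (Xi a u) (Xi u b)) (Xi a b)) <= M * p (b - a) ^ 3) ->
  is_partition_limit Xi 0 s Is -> is_partition_limit Xi 0 t It ->
  norm (minus (minus It Is) (Xi s t)) <= 2 / (1 - q) * M * p (t - s) ^ 3.
Proof.
  intros Hmo HM Hs Hst H0 HX Ls Lt.
  apply le_epsilon. intros eps He.
  destruct (Ls (eps / 2)) as [d1 [Pd1 H1]]; [lra|].
  destruct (Lt (eps / 2)) as [d2 [Pd2 H2]]; [lra|].
  set (d := Rmin d1 d2). assert (Pd : 0 < d) by now apply Rmin_pos.
  assert (fine : forall a b, a <= b -> exists n, (0 < n)%nat /\ (b - a) / INR n < d).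
  { intros a b Hab. destruct (archimed_cor1 (d / (b - a + 1))) as [n [Hn Hn']].
    { apply Rdiv_lt_0_compat; lra. }
    exists n. split; auto. assert (Pn : 0 < INR n) by now apply lt_0_INR.
    assert (Pi : 0 < / INR n) by now apply Rinv_0_lt_compat.
    unfold Rdiv. apply Rle_lt_trans with ((b - a + 1) * / INR n); [nra|].
    apply Rlt_le_trans with ((b - a + 1) * (d / (b - a + 1))).
    - apply Rmult_lt_compat_l; lra.
    - right; field; lra. }
  assert (part : forall a b, a <= b -> exists n, is_partition a b (uniform a ((b - a) / INR n) n) /\
    mesh a (uniform a ((b - a) / INR n) n) < d /\ (a < b -> (0 < n)%nat)).
  { intros a b Hab. destruct (eq_or_lt a b Hab) as [->|L].
    - exists O. simpl. repeat split; auto; lra.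
    - destruct (fine a b Hab) as [n [Hn Hd]]. exists n.
      assert (Pn : 0 < INR n) by now apply lt_0_INR.
      assert (0 < (b - a) / INR n) by (apply Rdiv_lt_0_compat; lra).
      repeat split; auto.
      + replace b with (a + INR n * ((b - a) / INR n)) at 1 by (field; lra).
        now apply is_partition_uniform.
      + eapply Rle_lt_trans; [apply mesh_uniform; lra|auto]. }
  destruct (part 0 s Hs) as (n1 & Q1 & M1 & _).
  destruct (part s t Hst) as (n2 & Q2 & M2 & N2).
  set (p1 := uniform 0 ((s - 0) / INR n1) n1) in *.
  set (p2 := uniform s ((t - s) / INR n2) n2) in *.
  assert (d <= d1) by apply Rmin_l. assert (d <= d2) by apply Rmin_r.
  specialize (H1 p1 Q1 ltac:(lra)).
  specialize (H2 (p1 ++ p2) (is_partition_app _ _ _ _ _ Q1 Q2)).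
  assert (Hmesh : mesh 0 (p1 ++ p2) < d) by (now apply (mesh_app 0 s)).
  specialize (H2 ltac:(lra)). rewrite (partition_sum_app Xi 0 s p1 p2 Q1) in H2.
  assert (HS : norm (minus (partition_sum Xi s p2) (Xi s t)) <= 2 / (1 - q) * M * p (t - s) ^ 3).
  { destruct (eq_or_lt s t Hst) as [Est|L].
    - assert (p2 = nil) as ->.
      { destruct p2 as [|x p2']; auto. exfalso. destruct Q2 as [Q2 Q3].
        apply partition_le in Q3. lra. }
      cbn [partition_sum]. rewrite <- Est, H0 by lra. rewrite norm_minus_diag.
      destruct Hmo as [Hq Hp _ _].
      assert (0 <= 2 / (1 - q)) by (apply Rdiv_le_0_compat; lra).
      apply Rmult_le_pos; [now apply Rmult_le_pos|now apply pow_le].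
    - unfold p2. rewrite partition_sum_uniform. apply (uniform_sum_sewing Xi p q M); auto. }
  replace (minus (minus It Is) (Xi s t)) with
    (plus (minus (partition_sum Xi s p2) (Xi s t))
      (minus (minus (partition_sum Xi 0 p1) Is)
             (minus (plus (partition_sum Xi 0 p1) (partition_sum Xi s p2)) It))) by vec.
  eapply Rle_trans.
  { apply norm_plus_le; [apply HS|]. apply norm_minus_le; apply Rlt_le; [apply H1|apply H2]. }
  lra.
Qed.
End Partitions.

(** * The drift term *)

Section Drift.
Context {W : NormedSpace} (F0 : W -> W) (K T : R).
Hypothesis HK : 0 <= K.
Hypothesis Hsize : forall y, norm (F0 y) <= K.
Hypothesis Hlip : forall y z, norm (minus (F0 y) (F0 z)) <= K * norm (minus y z).

Definition is_drift (Y D : R -> W) : Prop :=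
  forall t, 0 <= t <= T -> is_RInt (fun r => F0 (Y r)) 0 t (D t).

Lemma drift_interval Y D s t : is_drift Y D -> 0 <= s -> s <= t -> t <= T ->
  is_RInt (fun r => F0 (Y r)) s t (dlt D s t).
Proof.
  intros H Hs Hst Ht.
  replace (dlt D s t) with (plus (opp (D s)) (D t)) by (unfold dlt; vec).
  apply is_RInt_Chasles with 0; [apply is_RInt_swap|]; apply H; lra.
Qed.

Lemma drift_bound Y D s t : is_drift Y D -> 0 <= s -> s <= t -> t <= T ->
  norm (dlt D s t) <= K * (t - s).
Proof.
  intros H Hs Hst Ht. rewrite Rmult_comm.
  apply (norm_RInt_le_const (fun r => F0 (Y r)) s t); auto.
  now apply drift_interval.
Qed.

Lemma drift_difference Y D Y2 D2 Q s t : is_drift Y D -> is_drift Y2 D2 ->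
  0 <= s -> s <= t -> t <= T ->
  (forall r, s <= r <= t -> norm (minus (Y r) (Y2 r)) <= Q) ->
  norm (minus (dlt D s t) (dlt D2 s t)) <= K * Q * (t - s).
Proof.
  intros H H2 Hs Hst Ht HQ. rewrite (Rmult_comm (K * Q)).
  apply (norm_RInt_le_const (fun r => minus (F0 (Y r)) (F0 (Y2 r))) s t); auto.
  - intros r Hr. eapply Rle_trans; [apply Hlip|]. apply Rmult_le_compat_l; auto.
  - apply (is_RInt_minus (fun r => F0 (Y r)) (fun r => F0 (Y2 r))); now apply drift_interval.
Qed.

Lemma drift_frozen Y D Q s t : is_drift Y D -> 0 <= s -> s <= t -> t <= T ->
  (forall r, s <= r <= t -> norm (minus (Y r) (Y s)) <= Q) ->
  norm (minus (dlt D s t) (scal (t - s) (F0 (Y s)))) <= K * Q * (t - s).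
Proof.
  intros H Hs Hst Ht HQ. rewrite (Rmult_comm (K * Q)).
  apply (norm_RInt_le_const (fun r => minus (F0 (Y r)) (F0 (Y s))) s t); auto.
  - intros r Hr. eapply Rle_trans; [apply Hlip|]. apply Rmult_le_compat_l; auto.
  - apply (is_RInt_minus (fun r => F0 (Y r)) (fun r => F0 (Y s))).
    + now apply drift_interval.
    + apply (is_RInt_const s t (F0 (Y s))).
Qed.
End Drift.

(** * Davie's estimate for solutions *)

Lemma controlled_increment_bound {V W : NormedSpace} alpha B (X : R -> V) (Y : R -> W)
    (Y' : R -> lin V W) s t :
  0 <= alpha -> 1 <= B -> norm (Y' s) <= B -> norm (incr X s t) <= B * pw alpha (t - s) ->
  norm (remainder X Y Y' s t) <= B * pw alpha (t - s) ^ 2 -> t - s <= 1 ->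
  norm (dlt Y s t) <= 2 * B ^ 2 * pw alpha (t - s).
Proof.
  intros Ha HB H1 H2 H3 H4.
  assert (P0 := pw_ge_0 alpha (t - s)). assert (P1 := pw_le_1 alpha (t - s) Ha H4).
  set (P := pw alpha (t - s)) in *.
  replace (dlt Y s t) with (plus (Y' s (incr X s t)) (remainder X Y Y' s t))
    by (unfold remainder, incr, dlt; vec).
  eapply Rle_trans; [apply norm_plus_le; [apply norm_app_le; [apply H1|apply H2]|apply H3]|].
  assert (B * P ^ 2 <= B ^ 2 * P) by (apply Rmult_le_compat; nra).
  replace (B * (B * P)) with (B ^ 2 * P) by ring. lra.
Qed.

(** The coefficient of [germ_defect_pair_bound] for a path with increments of
    size [2 B^2] and first-order remainders of size [2 K B]. *)
Definition germ_const (B K : R) : R :=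
  K ^ 2 * (2 * B ^ 2) ^ 2 + K ^ 2 * (2 * K * B) + K ^ 2 * (2 * B ^ 2) + K ^ 2.

Lemma germ_const_ge_0 B K : 0 <= B -> 0 <= K -> 0 <= germ_const B K.
Proof. intros. unfold germ_const. nonneg. Qed.

Section Solutions.
Context {U V W VV : NormedSpace} (tens : V -> V -> VV).
Notation BB := (lin_NormedModule U (lin_NormedModule U W)).
Hypothesis Ht : is_tensor_square tens.
Context (C T alpha B K q : R) (F : W -> lin U W) (F0 : W -> W)
  (X : R -> V) (XX : R -> R -> VV) (Z : R -> U) (Z' : R -> lin V U).
Notation p := (pw alpha).
Notation ZZ := (second_order (U := U) (W := W) tens XX Z').

Hypothesis HC0 : 0 <= C.
Hypothesis HC : contract_bounded (U := U) (W := W) tens C.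
Hypothesis HB : 1 <= B.
Hypothesis HT : 0 < T.
Hypothesis Ha : 0 <= alpha.
Hypothesis HX : data_size tens T B p X XX Z Z'.
Hypothesis HF : smooth K F F0.
Hypothesis HK : driver_const C B <= K.
Hypothesis Hmo : modulus p q.

Lemma germ_diag Y s : 0 <= s <= T -> germ F Z ZZ Y s s = zero.
Proof.
  intros Hs. unfold germ, second_order.
  replace (dlt Z s s) with (zero : U) by (unfold dlt; vec).
  rewrite lin_zero_arg, (chen_diag tens Ht T X XX s) by (auto; apply HX).
  assert (E : contract tens (second_field F (Y s)) (Z' s) (Z' s) zero = zero).
  { exact (linear_map_comb _ (fun _ => 0) nil (contract_linear tens Ht _ _ _)). }
  rewrite E. vec.
Qed.

Lemma unit_interval_driver a :
  0 <= a -> driver_pair (fun r : R => r) (fun r => a <= r <= a + 1 /\ r <= T) p K 0 Z Z ZZ ZZ.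
Proof.
  intros Ha0. rewrite <- (Rmult_0_r (driver_const C B)).
  apply (driver_of_data tens Ht C T B 0 p X X XX XX Z Z Z' Z' HC0 HC
    (data_pair_refl tens T B p X XX Z Z' HB HX)); auto; try apply Hmo.
  - intros i Hi; lra.
  - intros s t Hs Htt. apply pw_le_1; lra.
Qed.

Lemma controlled_defect_bound Y Y' s u t :
  0 <= s -> s <= u -> u <= t -> t <= T -> t - s <= 1 ->
  norm (Y' s) <= B -> Y' s = lin_comp (F (Y s)) (Z' s) ->
  norm (remainder X Y Y' s u) <= B * p (u - s) ^ 2 ->
  norm (minus (plus (germ F Z ZZ Y s u) (germ F Z ZZ Y u t)) (germ F Z ZZ Y s t)) <=
  germ_const B K * p (t - s) ^ 3.
Proof.
  intros Hs Hsu Hut HtT Hts HY' EY HR.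
  assert (HK1 := sm_K HF).
  assert (P2 := pow2_ge_0 (p (u - s))).
  assert (X1 := ds_X HX s u Hs Hsu ltac:(lra)).
  assert (X2 := ds_rem HX s u Hs Hsu ltac:(lra)).
  assert (I1 : norm (dlt Y s u) <= 2 * B ^ 2 * p (u - s)).
  { apply (controlled_increment_bound alpha B X Y Y'); auto; lra. }
  assert (I2 : norm (first_rem F Z Y s u) <= 2 * K * B * p (u - s) ^ 2).
  { replace (first_rem F Z Y s u) with
      (minus (remainder X Y Y' s u) (F (Y s) (remainder X Z Z' s u))).
    - eapply Rle_trans.
      { apply norm_minus_le; [apply HR|apply norm_app_le; [apply (sm_F HF)|apply X2]]. }
      assert (B * p (u - s) ^ 2 <= K * B * p (u - s) ^ 2) by (apply Rmult_le_compat_r; nra).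
      lra.
    - rewrite (remainder_first_rem F X Z Z' Y Y' s u EY). vec. }
  assert (HP : forall x, 0 <= p x) by apply Hmo.
  assert (HPm : forall x y, x <= y -> p x <= p y) by apply Hmo.
  destruct (germ_defect_pair_bound F F0 (fun r : R => r) (fun r => s <= r <= s + 1 /\ r <= T) p K 0
    Z Z ZZ ZZ Y Y HF (unit_interval_driver s Hs) HP HPm s u t (2 * K * B) 0 (2 * B ^ 2) 0 0)
    as [G _]; try lra; try nra.
  - rewrite norm_minus_diag; lra.
  - rewrite Rmult_0_l. now apply pair_bound_refl.
  - rewrite Rmult_0_l. now apply pair_bound_refl.
  - exact G.
Qed.

(** A solution is its initial value plus its drift plus a rough integral whose
    increments are the germ up to order [3 alpha]. *)
Lemma davie_of_solution y0 Y Y' :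
  is_solution T alpha tens X XX Z Z' F F0 y0 Y Y' ->
  (forall s, 0 <= s <= T -> norm (Y' s) <= B) ->
  (forall s t, 0 <= s -> s <= t -> t <= T ->
     norm (remainder X Y Y' s t) <= B * p (t - s) ^ 2) ->
  Y 0 = y0 /\ exists D, is_drift F0 T Y D /\
    forall s t, 0 <= s -> s <= t -> t <= T -> t - s <= 1 ->
      norm (davie_rem F Z ZZ D Y s t) <= 2 / (1 - q) * germ_const B K * p (t - s) ^ 3.
Proof.
  intros [_ Hsol] H1 H2.
  assert (HK1 := sm_K HF).
  assert (Hex : forall t, exists IJ : W * W, 0 <= t <= T ->
    is_rough_integral tens XX Z Z' F Y Y' 0 t (fst IJ) /\
    is_RInt (fun r => F0 (Y r)) 0 t (snd IJ) /\ Y t = plus (plus y0 (fst IJ)) (snd IJ)).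
  { intros t. destruct (Classical_Prop.classic (0 <= t <= T)) as [Htt|N].
    - destruct (Hsol t Htt) as [(I & J & HIJ) _]. now exists (I, J).
    - exists (zero, zero). tauto. }
  destruct (choice_function _ Hex) as [IJ HIJ].
  split.
  - destruct (HIJ 0 ltac:(lra)) as (I0 & J0 & E0).
    assert (Z1 : fst (IJ 0) = zero).
    { apply minus_zero_iff. apply le_epsilon. intros eps He.
      destruct (I0 eps He) as [d [Pd Hd]]. specialize (Hd nil eq_refl Pd). simpl in Hd.
      rewrite norm_minus_sym. rewrite Rplus_0_l. now apply Rlt_le. }
    assert (Z2 : snd (IJ 0) = zero).
    { apply norm_eq_zero. apply Rle_antisym; [|apply norm_ge_0].
      apply Rle_trans with ((0 - 0) * K); [|right; ring].
      apply (norm_RInt_le_const (fun r => F0 (Y r)) 0 0); auto; [lra|].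
      intros r _. apply (sm_F0 HF). }
    rewrite E0, Z1, Z2. vec.
  - exists (fun t => snd (IJ t)). split.
    + intros t Htt. now apply HIJ.
    + intros s t Hs Hst HtT H1ts.
      destruct (HIJ s ltac:(lra)) as (Is & _ & Es). destruct (HIJ t ltac:(lra)) as (It & _ & Et).
      replace (davie_rem F Z ZZ (fun t => snd (IJ t)) Y s t) with
        (minus (minus (fst (IJ t)) (fst (IJ s))) (germ F Z ZZ Y s t)).
      2: { unfold davie_rem, dlt. rewrite Es, Et. vec. }
      assert (Eg : forall u v, 0 <= u <= T ->
        rough_germ tens XX Z Z' F Y Y' u v = germ F Z ZZ Y u v).
      { intros u v Hu. unfold rough_germ, germ, second_order, contract.
        destruct (Hsol u Hu) as [_ ->]. reflexivity. }
      rewrite <- Eg by lra.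
      assert (M0 : 0 <= germ_const B K) by (apply germ_const_ge_0; lra).
      apply (integral_germ_bound (rough_germ tens XX Z Z' F Y Y') p q (germ_const B K) s t); auto.
      * intros r Hr. rewrite Eg by lra. apply germ_diag; lra.
      * intros a u b Hsa Hau Hub Hbt. rewrite !Eg by lra.
        apply (controlled_defect_bound Y Y'); try lra.
        -- apply H1; lra.
        -- apply (proj2 (Hsol a ltac:(lra))).
        -- apply H2; lra.
Qed.
End Solutions.
Arguments mo_q {p q}. Arguments mo_pos {p q}. Arguments mo_mono {p q}. Arguments mo_half {p q}.

(** * The Euler scheme *)

Lemma smooth_mono {U W : NormedSpace} K K' (F : W -> lin U W) (F0 : W -> W) :
  smooth K F F0 -> K <= K' -> smooth K' F F0.
Proof.
  intros H HK.
  assert (up : forall a x, 0 <= x -> a <= K * x -> a <= K' * x) by (intros; nra).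
  destruct H as [H1 H2 H3 H4 H5 H6 H7 H8 H9 H10 H11 H12].
  split; [lra| | | | | | | | | | |];
    intros; try (eapply Rle_trans; [solve [eauto]|exact HK]); apply up; auto;
    repeat first [apply norm_ge_0|apply pow2_ge_0|apply Rplus_le_le_0_compat|apply Rmult_le_pos].
Qed.

Section Euler.
Context {U W : NormedSpace} (F : W -> lin U W) (F0 : W -> W).
Notation BB := (lin_NormedModule U (lin_NormedModule U W)).
Context (Z : R -> U) (ZZ : R -> R -> BB -> W) (T K q : R) (p : R -> R).

(** The Chen defect is bounded by a product rather than by the cube of
    [p (t - s)]: it has to be small as soon as one of the two subintervals is
    short, which is what makes [ZZ] continuous in its end points. *)
Record rough_driver : Prop := {
  rd_lin : forall s t x y, ZZ s t (minus x y) = minus (ZZ s t x) (ZZ s t y);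
  rd_diag : forall s b, 0 <= s <= T -> ZZ s s b = zero;
  rd_Z : forall s t, 0 <= s -> s <= t -> t <= T -> t - s <= 1 ->
    norm (dlt Z s t) <= K * p (t - s);
  rd_ZZ : forall s t b, 0 <= s -> s <= t -> t <= T -> t - s <= 1 ->
    norm (ZZ s t b) <= K * p (t - s) ^ 2 * norm b;
  rd_N : forall s u t b, 0 <= s -> s <= u -> u <= t -> t <= T -> t - s <= 1 ->
    norm (chen_defect Z ZZ s u t b) <= K * (p (u - s) * p (t - u) * p (t - s)) * norm b
}.

Hypothesis HD : rough_driver.
Hypothesis HF : smooth K F F0.
Hypothesis Hmo : modulus p q.
Hypothesis Hp1 : forall x, x <= 1 -> p x <= 1.
Hypothesis Hlen : forall x, x <= 1 -> x <= p x ^ 2.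
Hypothesis HT : 0 < T.

Let Hp : forall x, 0 <= p x := mo_pos Hmo.
Let Hpm : forall x y, x <= y -> p x <= p y := mo_mono Hmo.
Let K1 : 1 <= K := sm_K HF.

Lemma driver_pair_same {I : Type} (tau : I -> R) (In : I -> Prop) K' eps :
  K <= K' -> 0 <= eps -> (forall i, In i -> 0 <= tau i <= T) ->
  (forall s t, In s -> In t -> tau t - tau s <= 1) ->
  driver_pair tau In p K' eps (fun i => Z (tau i)) (fun i => Z (tau i))
    (fun i j => ZZ (tau i) (tau j)) (fun i j => ZZ (tau i) (tau j)).
Proof.
  intros HK He HIn H1.
  assert (same : forall (x : W) m m' d, norm x <= m -> m <= m' -> 0 <= d -> pair_bound m' d x x).
  { intros x m m' d Hx Hm Hd. eapply pair_bound_le; [apply pair_bound_refl, Hx|auto|auto]. }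
  split; auto.
  - intros s t Hs Ht Hst. specialize (H1 s t Hs Ht). destruct (HIn s Hs), (HIn t Ht).
    assert (P0 := Hp (tau t - tau s)).
    eapply pair_bound_le; [apply pair_bound_refl; apply (rd_Z HD); auto| |].
    + apply Rmult_le_compat_r; auto.
    + now apply Rmult_le_pos.
  - intros. apply (rd_lin HD).
  - intros. apply (rd_lin HD).
  - intros s t b Hs Ht Hst. specialize (H1 s t Hs Ht). destruct (HIn s Hs), (HIn t Ht).
    assert (P2 := pow2_ge_0 (p (tau t - tau s))). assert (b0 := norm_ge_0 b).
    eapply same; [apply (rd_ZZ HD); auto| |].
    + apply Rmult_le_compat_r; auto. apply Rmult_le_compat_r; auto.
    + repeat apply Rmult_le_pos; auto; lra.
  - intros s u t b Hs Hu Ht Hst. specialize (H1 s t Hs Ht). destruct (HIn s Hs), (HIn t Ht).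
    assert (P3 := pow_le (p (tau t - tau s)) 3 (Hp _)). assert (b0 := norm_ge_0 b).
    eapply same; [apply (rd_N HD (tau s) (tau u) (tau t) b); auto; lra| |].
    + apply Rmult_le_compat_r; auto. apply Rle_trans with (K * p (tau t - tau s) ^ 3).
      * apply Rmult_le_compat_l; [lra|].
        replace (p (tau t - tau s) ^ 3) with
          (p (tau t - tau s) * p (tau t - tau s) * p (tau t - tau s)) by ring.
        apply Rmult_le_compat_r; auto.
        apply Rmult_le_compat; auto; apply Hpm; lra.
      * apply Rmult_le_compat_r; auto.
    + repeat apply Rmult_le_pos; auto; lra.
Qed.

(** [rho_const] and [kappa_const] are the sizes of first-order remainders and of
    increments on blocks where Davie's estimate is at most one, and
    [davie_const] is the constant that sewing returns for paths of these sizes;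
    that it does not depend on the constant assumed on shorter blocks closes the
    induction in [euler_davie]. *)
Definition rho_const : R := 1 + K + K ^ 2.
Definition kappa_const : R := K ^ 2 + rho_const.
Definition davie_const : R := 2 / (1 - q) *
  (K ^ 2 * kappa_const ^ 2 + K ^ 2 * rho_const + K ^ 2 * kappa_const + K ^ 2).

Context (y0 : W).

Section Grid.
Context (h : R).
Hypothesis Hh : 0 < h.

Definition tm (k : nat) : R := INR k * h.

Fixpoint euler (k : nat) : W :=
  match k with
  | O => y0
  | S k => plus (plus (euler k) (scal h (F0 (euler k))))
      (plus (F (euler k) (dlt Z (tm k) (tm (S k)))) (ZZ (tm k) (tm (S k)) (second_field F (euler k))))
  end.

Fixpoint euler_drift (k : nat) : W :=
  match k with
  | O => zero
  | S k => plus (euler_drift k) (scal h (F0 (euler k)))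
  end.

Notation Zg := (fun k => Z (tm k)).
Notation ZZg := (fun k l => ZZ (tm k) (tm l)).
Notation J := (davie_rem F Zg ZZg euler_drift euler).

Lemma tm_mono k l : (k <= l)%nat -> tm k <= tm l.
Proof. intros H. apply le_INR in H. unfold tm. nra. Qed.

Lemma tm_lt k l : (k < l)%nat -> tm k < tm l.
Proof. intros H. apply lt_INR in H. unfold tm. nra. Qed.

Lemma tm_ge_0 k : 0 <= tm k.
Proof. unfold tm. assert (0 <= INR k) by apply pos_INR. nra. Qed.

Lemma tm_le_inv k l : tm k <= tm l -> (k <= l)%nat.
Proof.
  intros H. destruct (Nat.le_gt_cases k l) as [|L]; auto. apply tm_lt in L. lra.
Qed.

Lemma tm_minus k l : (k <= l)%nat -> tm l - tm k = INR (l - k) * h.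
Proof. intros H. unfold tm. rewrite minus_INR by auto. ring. Qed.

Lemma euler_one_step k : J k (S k) = zero.
Proof. unfold davie_rem, germ, dlt. cbn [euler euler_drift]. unfold dlt. vec. Qed.

Lemma euler_rem_diag k : tm k <= T -> J k k = zero.
Proof.
  intros Hk. unfold davie_rem, germ.
  replace (dlt (fun k => Z (tm k)) k k) with (zero : U) by (unfold dlt; vec).
  rewrite lin_zero_arg, (rd_diag HD) by (generalize (tm_ge_0 k); lra).
  unfold dlt. vec.
Qed.

Lemma euler_drift_bound k l : (k <= l)%nat ->
  norm (dlt euler_drift k l) <= K * (tm l - tm k).
Proof.
  induction 1 as [|l Hkl IH].
  - unfold dlt. rewrite norm_minus_diag. lra.
  - apply (norm_le_of_eq _ (plus (dlt euler_drift k l) (scal h (F0 (euler l)))));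
      [unfold dlt; cbn [euler_drift]; vec|].
    eapply Rle_trans; [apply norm_plus_le; [apply IH|apply norm_scal_le]|].
    assert (norm (F0 (euler l)) <= K) by apply (sm_F0 HF).
    rewrite Rabs_right by lra. unfold tm. rewrite S_INR. nra.
Qed.

Lemma euler_rem_consequences k l L : (k <= l)%nat -> tm l <= T -> tm l - tm k <= 1 ->
  norm (J k l) <= L * p (tm l - tm k) ^ 3 -> L * p (tm l - tm k) <= 1 ->
  norm (first_rem F Zg euler k l) <= rho_const * p (tm l - tm k) ^ 2 /\
  norm (dlt euler k l) <= kappa_const * p (tm l - tm k).
Proof.
  intros Hkl HlT H1 HJ HL.
  assert (T0 := tm_ge_0 k). assert (Tm := tm_mono k l Hkl).
  assert (P0 := Hp (tm l - tm k)). assert (P1 := Hp1 _ H1). assert (P2 := Hlen _ H1).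
  assert (Rr : norm (first_rem F Zg euler k l) <= rho_const * p (tm l - tm k) ^ 2).
  { replace (first_rem F Zg euler k l) with
      (plus (plus (J k l) (dlt euler_drift k l)) (ZZ (tm k) (tm l) (second_field F (euler k))))
      by (unfold davie_rem, germ, first_rem; vec).
    eapply Rle_trans.
    { apply norm_plus_le; [apply norm_plus_le; [apply HJ|apply euler_drift_bound; auto]|].
      eapply Rle_trans; [apply (rd_ZZ HD); auto; lra|].
      apply Rmult_le_compat_l; [|apply (sm_G HF)].
      apply Rmult_le_pos; [lra|apply pow2_ge_0]. }
    set (x := p (tm l - tm k)) in *.
    assert (0 <= x ^ 2) by apply pow2_ge_0.
    assert (L * x ^ 3 <= 1 * x ^ 2).
    { replace (L * x ^ 3) with (L * x * x ^ 2) by ring. apply Rmult_le_compat_r; auto. }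
    assert (K * (tm l - tm k) <= K * x ^ 2) by (apply Rmult_le_compat_l; lra).
    unfold rho_const. replace ((1 + K + K ^ 2) * x ^ 2) with
      (1 * x ^ 2 + K * x ^ 2 + K * x ^ 2 * K) by ring. lra. }
  split; auto.
  replace (dlt euler k l) with (plus (first_rem F Zg euler k l) (F (euler k) (dlt Zg k l)))
    by (unfold first_rem; vec).
  eapply Rle_trans.
  { apply norm_plus_le; [apply Rr|].
    apply norm_app_le; [apply (sm_F HF)|]. apply (rd_Z HD); auto; lra. }
  set (x := p (tm l - tm k)) in *.
  assert (0 <= rho_const) by (unfold rho_const; nra).
  assert (rho_const * x ^ 2 <= rho_const * x) by (apply Rmult_le_compat_l; auto; nra).
  unfold kappa_const. lra.
Qed.

(** Davie's estimate for the scheme, by induction on the number of steps: the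
    defects inside a block only involve shorter blocks. *)
Lemma euler_davie delta : delta <= 1 -> davie_const * p delta <= 1 ->
  forall k l, (k <= l)%nat -> tm l <= T -> tm l - tm k <= delta ->
  norm (J k l) <= davie_const * p (tm l - tm k) ^ 3.
Proof.
  intros Hd1 Hd.
  assert (Hq := mo_q Hmo).
  assert (R0 : 0 <= rho_const) by (unfold rho_const; nra).
  assert (Ka0 : 0 <= kappa_const) by (unfold kappa_const; nra).
  set (M := K ^ 2 * kappa_const ^ 2 + K ^ 2 * rho_const + K ^ 2 * kappa_const + K ^ 2).
  assert (M0 : 0 <= M) by (unfold M; nonneg).
  assert (L0 : 0 <= davie_const).
  { unfold davie_const. fold M. apply Rmult_le_pos; auto. apply Rdiv_le_0_compat; lra. }
  assert (main : forall g k l, (l - k <= g)%nat -> (k <= l)%nat -> tm l <= T -> tm l - tm k <= delta ->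
    norm (J k l) <= davie_const * p (tm l - tm k) ^ 3).
  2: { intros k l. apply (main (l - k)%nat). auto. }
  induction g as [|g IH]; intros k l Hg Hkl HlT Hdl.
  { replace l with k by lia. rewrite euler_rem_diag by (generalize (tm_mono k l Hkl); lra).
    rewrite norm_zero_eq. apply Rmult_le_pos; auto. apply pow_le, Hp. }
  assert (D := discrete_sewing J (fun x => p x ^ 3) h M 0 q k l).
  assert (B : norm (J k l) <= 2 / (1 - q) * M * p (INR (l - k) * h) ^ 3 + 0 * INR (l - k)).
  2: { rewrite <- tm_minus in B by auto. unfold davie_const. fold M. lra. }
  apply D; auto; try lra.
  - intros x. now apply pow_le.
  - intros x y Hxy. apply cube_mono; auto.
  - apply (mo_half Hmo).
  - intros i Hi. apply euler_rem_diag. generalize (tm_mono i l ltac:(lia)); lra.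
  - intros i j m Hi Hj Hm. rewrite <- tm_minus by lia.
    assert (Tim : tm m <= T) by (generalize (tm_mono m l ltac:(lia)); lra).
    assert (Tjm := tm_mono j m ltac:(lia)). assert (Tij := tm_mono i j ltac:(lia)).
    assert (Tki := tm_mono k i ltac:(lia)). assert (Tml := tm_mono m l ltac:(lia)).
    assert (T0 := tm_ge_0 i).
    assert (Jij : norm (J i j) <= davie_const * p (tm j - tm i) ^ 3) by (apply IH; try lia; lra).
    assert (Pij : p (tm j - tm i) <= p delta) by (apply Hpm; lra).
    destruct (euler_rem_consequences i j davie_const) as [C1 C2]; auto; try lra; try lia.
    { apply Rle_trans with (davie_const * p delta); auto. apply Rmult_le_compat_l; auto. }
    rewrite davie_rem_defect.
    destruct (germ_defect_pair_bound F F0 tm (fun r => tm i <= tm r <= tm m) p K 0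
      Zg Zg ZZg ZZg euler euler HF) with (s := i) (u := j) (t := m)
      (rho := rho_const) (drho := 0) (kap := kappa_const) (eta := 0) (Q := 0) as [G _];
      auto; try lra.
    + apply driver_pair_same; try lra; intros; lra.
    + rewrite norm_minus_diag; lra.
    + rewrite Rmult_0_l. now apply pair_bound_refl.
    + rewrite Rmult_0_l. now apply pair_bound_refl.
  - intros i Hi. rewrite euler_one_step, norm_zero_eq. lra.
Qed.

Lemma euler_drift_frozen k l Q : (k <= l)%nat ->
  (forall i, (k <= i <= l)%nat -> norm (dlt euler k i) <= Q) ->
  norm (minus (dlt euler_drift k l) (scal (tm l - tm k) (F0 (euler k)))) <=
  K * Q * (tm l - tm k).
Proof.
  induction 1 as [|l Hkl IH]; intros HQ.
  - apply (norm_le_of_eq _ zero); [unfold dlt; vec|]. rewrite norm_zero_eq. right; ring.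
  - apply (norm_le_of_eq _ (plus (minus (dlt euler_drift k l) (scal (tm l - tm k) (F0 (euler k))))
       (scal h (minus (F0 (euler l)) (F0 (euler k)))))).
    + replace (tm (S l)) with (tm l + h) by (unfold tm; rewrite S_INR; ring).
      unfold dlt; cbn [euler_drift]; vec.
    + eapply Rle_trans.
      { apply norm_plus_le; [apply IH; intros; apply HQ; lia|].
        eapply Rle_trans; [apply norm_scal_le|]. rewrite Rabs_right by lra.
        apply Rmult_le_compat_l; [lra|].
        eapply Rle_trans; [apply (sm_F0_lip HF)|].
        apply Rmult_le_compat_l; [lra|]. apply (HQ l). lia. }
      replace (tm (S l)) with (tm l + h) by (unfold tm; rewrite S_INR; ring).
      right; ring.
Qed.
End Grid.
End Euler.
Arguments rd_lin {U W Z ZZ T K p}.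
Arguments rd_diag {U W Z ZZ T K p}.
Arguments rd_Z {U W Z ZZ T K p}.
Arguments rd_ZZ {U W Z ZZ T K p}.
Arguments rd_N {U W Z ZZ T K p}.

Lemma Rpower_half_cube a : 2 * Rpower (1 / 2) a ^ 3 = Rpower 2 (1 - 3 * a).
Proof.
  rewrite Rpower_pow_nat. replace (1 / 2) with (/ 2) by field.
  replace (Rpower (/ 2) (INR 3 * a)) with (Rpower 2 (- (3 * a))).
  - rewrite <- (Rpower_1 2) at 1 by lra. rewrite <- Rpower_plus. f_equal.
  - unfold Rpower. rewrite ln_Rinv by lra. f_equal. simpl. ring.
Qed.

(** [2 * (1 / 2) ^ (3 a)], which is less than one exactly when [3 a > 1]. *)
Definition sewing_ratio (a : R) : R := Rpower 2 (1 - 3 * a).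

Lemma pw_modulus a q : 0 <= a -> sewing_ratio a <= q -> q < 1 -> modulus (pw a) q.
Proof.
  intros Ha Hq H1. assert (0 < sewing_ratio a) by apply Rpower_gt_0. split.
  - lra.
  - apply pw_ge_0.
  - intros x y. now apply pw_mono.
  - intros x Hx. replace (x / 2) with (1 / 2 * x) by field. rewrite pw_mult by lra.
    rewrite Rpow_mult_distr, <- Rmult_assoc, Rpower_half_cube.
    apply Rmult_le_compat_r; auto. apply pow_le, pw_ge_0.
Qed.

Lemma sewing_ratio_lt_1 a : 1 / 3 < a -> sewing_ratio a < 1.
Proof.
  intros Ha. unfold sewing_ratio. apply Rlt_le_trans with (Rpower 2 0).
  - apply Rpower_lt; lra.
  - rewrite Rpower_O; lra.
Qed.

Lemma pw_half_ratio a x : a <= 1 / 2 -> pw a (x / 2) <= sewing_ratio a * pw a x.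
Proof.
  intros Ha. replace (x / 2) with (1 / 2 * x) by field. rewrite pw_mult by lra.
  apply Rmult_le_compat_r; [apply pw_ge_0|]. unfold sewing_ratio.
  replace (1 / 2) with (/ 2) by field.
  replace (Rpower (/ 2) a) with (Rpower 2 (- a)).
  - apply Rle_Rpower; lra.
  - unfold Rpower. rewrite ln_Rinv by lra. f_equal. ring.
Qed.

Lemma pw_double a x : 0 <= a <= 1 -> pw a (2 * x) <= 2 * pw a x.
Proof.
  intros Ha. rewrite pw_mult by lra. apply Rmult_le_compat_r; [apply pw_ge_0|].
  rewrite <- (Rpower_1 2) at 2 by lra. apply Rle_Rpower; lra.
Qed.

(** * Refinement of the grid *)

Section EulerLimit.
Context {U W : NormedSpace} (F : W -> lin U W) (F0 : W -> W).
Notation BB := (lin_NormedModule U (lin_NormedModule U W)).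
Context (Z : R -> U) (ZZ : R -> R -> BB -> W) (T K alpha : R) (y0 : W).
Notation p := (pw alpha).
Notation q := (sewing_ratio alpha).
Notation L := (davie_const K q).
Notation kap := (kappa_const K).

Hypothesis HD : rough_driver Z ZZ T K p.
Hypothesis HF : smooth K F F0.
Hypothesis Ha : 1 / 3 < alpha <= 1 / 2.
Hypothesis HT : 0 < T.

Let K1 : 1 <= K := sm_K HF.
Let Hq1 : q < 1 := sewing_ratio_lt_1 alpha (proj1 Ha).
Let Hq0 : 0 < q := Rpower_gt_0 _ _.

Lemma alpha_modulus : modulus p q.
Proof. apply pw_modulus; lra. Qed.

Let Hp := pw_ge_0 alpha.
Lemma alpha_mono x y : x <= y -> p x <= p y.
Proof. apply pw_mono; lra. Qed.
Lemma alpha_le_1 x : x <= 1 -> p x <= 1.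
Proof. apply pw_le_1; lra. Qed.
Lemma alpha_len x : x <= 1 -> x <= p x ^ 2.
Proof. apply le_pw_sqr; lra. Qed.

Lemma kappa_ge_0 : 0 <= kap.
Proof. unfold kappa_const, rho_const. nra. Qed.

Lemma davie_const_ge_0 : 0 <= L.
Proof.
  assert (Hk := kappa_ge_0). assert (0 <= rho_const K) by (unfold rho_const; nra).
  unfold davie_const. nonneg.
Qed.

(** A common bound for the driver and for the Davie remainders of the scheme, as
    stability is applied with a single constant. *)
Definition K2 : R := K + L.

Context (delta : R) (N : nat).
Hypothesis HN : INR N * delta = T.
Hypothesis Hd : 0 < delta <= 1.
Hypothesis HdL : L * p delta <= 1.
Hypothesis HdS : 120 * (2 / (1 - q)) * K2 ^ 6 * p delta <= 1.

Definition step (n : nat) : R := delta / 2 ^ n.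
Notation y n := (euler F F0 Z ZZ y0 (step n)).
Notation d n := (euler_drift F F0 Z ZZ y0 (step n)).
Notation tau n := (tm (step n)).

Lemma step_pos n : 0 < step n.
Proof. apply Rdiv_lt_0_compat; [lra|]. apply pow_lt; lra. Qed.

Lemma step_S n : step (S n) = step n / 2.
Proof. unfold step. simpl. field. apply pow_nonzero; lra. Qed.

Lemma tm_double n k : tau (S n) (2 * k) = tau n k.
Proof. unfold tm. rewrite step_S, mult_INR. simpl (INR 2). field. Qed.

Lemma step_le n : step n <= delta.
Proof.
  induction n as [|n IH]; [unfold step; simpl; lra|]. rewrite step_S.
  generalize (step_pos n); lra.
Qed.

Lemma p_step n : p (step n) <= p delta * q ^ n.
Proof.
  induction n as [|n IH].
  - replace (step 0) with delta by (unfold step; simpl; field). simpl; lra.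
  - rewrite step_S. eapply Rle_trans; [apply pw_half_ratio; lra|].
    simpl. assert (q * p (step n) <= q * (p delta * q ^ n)) by (apply Rmult_le_compat_l; lra).
    lra.
Qed.

Lemma p_step_cube n : p (step n) ^ 3 <= p delta ^ 3 / delta * q ^ n * step n.
Proof.
  induction n as [|n IH].
  - replace (step 0) with delta by (unfold step; simpl; field).
    rewrite pow_O. right; field; lra.
  - rewrite step_S. 
    assert (H := mo_half alpha_modulus (step n) (Rlt_le _ _ (step_pos n))).
    assert (q * p (step n) ^ 3 <= q * (p delta ^ 3 / delta * q ^ n * step n))
      by (apply Rmult_le_compat_l; lra).
    change (q ^ S n) with (q * q ^ n). lra.
Qed.

Lemma euler_J n k l : (k <= l)%nat -> tau n l <= T -> tau n l - tau n k <= delta ->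
  norm (davie_rem F (fun k => Z (tau n k)) (fun k l => ZZ (tau n k) (tau n l)) (d n) (y n) k l)
  <= L * p (tau n l - tau n k) ^ 3.
Proof.
  intros. apply (euler_davie F F0 Z ZZ T K q p HD HF alpha_modulus alpha_le_1 alpha_len y0
    (step n) (step_pos n) delta); auto; lra.
Qed.

Lemma euler_increment n k l : (k <= l)%nat -> tau n l <= T -> tau n l - tau n k <= delta ->
  norm (dlt (y n) k l) <= kap * p (tau n l - tau n k).
Proof.
  intros Hkl HlT Hdl.
  apply (euler_rem_consequences F F0 Z ZZ T K q p HD HF alpha_modulus alpha_le_1 alpha_len y0
    (step n) (step_pos n) k l L); auto; try lra.
  - now apply euler_J.
  - apply Rle_trans with (L * p delta); auto. apply Rmult_le_compat_l; [apply davie_const_ge_0|].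
    now apply alpha_mono.
Qed.

(** The two sources of error in passing from the grid of step [h] to that of step
    [h / 2]: the drift, evaluated once more inside each interval, and the Davie
    remainder of the finer scheme over one interval, where that of the coarser
    one vanishes.  Both are of order [q ^ n] at level [n]. *)
Definition refine_const : R := K * kap * p delta + L * (p delta ^ 3 / delta).

Lemma refine_const_ge_0 : 0 <= refine_const.
Proof.
  unfold refine_const. assert (H1 := davie_const_ge_0). assert (H2 := kappa_ge_0).
  assert (H3 := Hp delta).
  assert (0 <= p delta ^ 3 / delta) by (apply Rdiv_le_0_compat; [now apply pow_le|lra]).
  assert (0 <= K * kap) by (apply Rmult_le_pos; lra).
  apply Rplus_le_le_0_compat; apply Rmult_le_pos; auto.
Qed.

Lemma refine_const_spec n :
  K * kap * p (step n) <= refine_const * q ^ n /\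
  L * p (step n) ^ 3 <= refine_const * q ^ n * step n.
Proof.
  assert (H1 := davie_const_ge_0). assert (H2 := kappa_ge_0). assert (H3 := Hp delta).
  assert (H4 : 0 <= p delta ^ 3 / delta) by (apply Rdiv_le_0_compat; [now apply pow_le|lra]).
  assert (Q0 : 0 <= q ^ n) by (apply pow_le; lra).
  assert (S0 := step_pos n).
  assert (KK : 0 <= K * kap) by (apply Rmult_le_pos; lra).
  split.
  - apply Rle_trans with (K * kap * (p delta * q ^ n)).
    + apply Rmult_le_compat_l; auto. apply p_step.
    + unfold refine_const.
      assert (0 <= L * (p delta ^ 3 / delta) * q ^ n)
        by (apply Rmult_le_pos; auto; apply Rmult_le_pos; auto). lra.
  - apply Rle_trans with (L * (p delta ^ 3 / delta * q ^ n * step n)).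
    + apply Rmult_le_compat_l; auto. apply p_step_cube.
    + unfold refine_const.
      assert (0 <= K * kap * p delta) by (apply Rmult_le_pos; auto).
      assert (0 <= K * kap * p delta * q ^ n) by (apply Rmult_le_pos; auto).
      assert (0 <= K * kap * p delta * q ^ n * step n) by (apply Rmult_le_pos; lra).
      lra.
Qed.

Lemma drift_refinement n k l Q : (k <= l)%nat -> tau n l <= T ->
  (forall i, (k <= i <= l)%nat -> norm (minus (y n i) (y (S n) (2 * i))) <= Q) ->
  norm (minus (dlt (d n) k l) (dlt (fun i => d (S n) (2 * i)) k l)) <=
  (K * Q + refine_const * q ^ n) * (tau n l - tau n k).
Proof.
  assert (h0 := step_pos n).
  induction 1 as [|l Hkl IH]; intros HlT HQ.
  - apply (norm_le_of_eq _ zero); [unfold dlt; vec|]. rewrite norm_zero_eq. right; ring.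
  - assert (El : tau n (S l) = tau n l + step n) by (unfold tm; rewrite S_INR; ring).
    set (f := F0 (y n l)). set (f1 := F0 (y (S n) (2 * l))). set (f2 := F0 (y (S n) (S (2 * l)))).
    apply (norm_le_of_eq _ (plus (minus (dlt (d n) k l) (dlt (fun i => d (S n) (2 * i)) k l))
      (scal (step n) (plus (minus f f1) (scal (/ 2) (minus f1 f2)))))).
    { unfold dlt. replace (2 * S l)%nat with (S (S (2 * l))) by lia.
      cbn [euler_drift]. fold f f1 f2. rewrite step_S. vec; field. }
    assert (B1 : norm (minus f f1) <= K * Q).
    { eapply Rle_trans; [apply (sm_F0_lip HF)|]. apply Rmult_le_compat_l; [lra|].
      apply HQ; lia. }
    assert (B2 : norm (minus f1 f2) <= K * (kap * p (step n))).
    { eapply Rle_trans; [apply (sm_F0_lip HF)|]. apply Rmult_le_compat_l; [lra|].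
      rewrite norm_minus_sym.
      assert (E2 : tau (S n) (S (2 * l)) - tau (S n) (2 * l) = step (S n))
        by (unfold tm; rewrite S_INR; ring).
      assert (Hs := step_S n). assert (Hle := step_le n).
      assert (E3 := tm_double n l).
      eapply Rle_trans.
      { apply (euler_increment (S n) (2 * l) (S (2 * l))); [lia| |]; lra. }
      apply Rmult_le_compat_l; [apply kappa_ge_0|]. apply alpha_mono. lra. }
    eapply Rle_trans.
    { apply norm_plus_le.
      - apply IH; [lra|]. intros i Hi; apply HQ; lia.
      - eapply Rle_trans; [apply norm_scal_le|]. rewrite Rabs_right by lra.
        apply Rmult_le_compat_l; [lra|]. apply norm_plus_le; [apply B1|].
        eapply Rle_trans; [apply norm_scal_le|]. rewrite Rabs_right by lra.
        apply Rmult_le_compat_l; [lra|apply B2]. }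
    destruct (refine_const_spec n) as [R1 _].
    assert (N0 : 0 <= K * (kap * p (step n))).
    { apply Rmult_le_pos; [lra|]. apply Rmult_le_pos; [apply kappa_ge_0|apply Hp]. }
    rewrite El.
    assert (step n * (K * Q + / 2 * (K * (kap * p (step n)))) <=
            step n * (K * Q + refine_const * q ^ n)) by (apply Rmult_le_compat_l; lra).
    lra.
Qed.

Definition euler_rate : R := (2 * (55 * K2 ^ 6)) ^ N * refine_const.

(** Two consecutive grids carry approximate solutions of the same equation on
    the coarser one, up to a geometrically small error. *)
Lemma euler_refinement n k : tau n k <= T ->
  norm (minus (y n k) (y (S n) (2 * k))) <= euler_rate * q ^ n.
Proof.
  intros Hk. assert (h0 := step_pos n).
  set (eps := refine_const * q ^ n).
  assert (Q0 : 0 <= q ^ n) by (apply pow_le; lra).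
  assert (e0 : 0 <= eps) by (apply Rmult_le_pos; auto; apply refine_const_ge_0).
  destruct (refine_const_spec n) as [R1 R2]. fold eps in R1, R2.
  assert (L0 := davie_const_ge_0).
  assert (KK2 : K <= K2) by (unfold K2; lra). assert (LK2 : L <= K2) by (unfold K2; lra).
  set (S0 := 2 / (1 - q)) in *.
  assert (HS0 : 1 <= S0).
  { unfold S0. apply Rmult_le_reg_r with (1 - q); [lra|].
    unfold Rdiv. rewrite Rmult_assoc, Rinv_l by lra. lra. }
  set (Y' := fun k => y (S n) (2 * k)). set (D' := fun k => d (S n) (2 * k)).
  set (Zg := fun k => Z (tau n k)). set (ZZg := fun k l => ZZ (tau n k) (tau n l)).
  assert (EJ : forall k l, davie_rem F Zg ZZg D' Y' k l =
    davie_rem F (fun k : nat => Z (tau (S n) k)) (fun k l : nat => ZZ (tau (S n) k) (tau (S n) l))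
      (d (S n)) (y (S n)) (2 * k)%nat (2 * l)%nat).
  { intros i j. unfold davie_rem, germ, dlt, Zg, ZZg, D', Y'. now rewrite !tm_double. }
  assert (inv : forall i j, tau n i <= tau n j -> (i <= j)%nat) by (apply tm_le_inv; auto).
  assert (HJ' : forall s t, pair_in (tau n) (fun k => tau n k <= T) delta s t ->
    norm (davie_rem F Zg ZZg D' Y' s t) <= L * p (tau n t - tau n s) ^ 3).
  { intros s t (Hs & Ht & Hst). rewrite EJ. rewrite <- (tm_double n s), <- (tm_double n t).
    apply euler_J; rewrite ?tm_double; auto; try lra.
    assert (s <= t)%nat by (apply inv; lra). lia. }
  assert (G := global_stability F F0 (tau n) (fun k => tau n k <= T) p K2 S0 delta eps
    Zg Zg ZZg ZZg (y n) Y' (d n) D').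
  replace (euler_rate * q ^ n) with ((2 * (55 * K2 ^ 6)) ^ N * (0 + eps))
    by (unfold euler_rate, eps; ring).
  apply G with (pt := fun j => (j * 2 ^ n)%nat) (T := T); auto; try lra; clear G.
  - now apply smooth_mono with K.
  - intros a Ha'. apply (driver_pair_same F F0 Z ZZ T K q p HD HF alpha_modulus); auto.
    + intros i [Hi _]. split; auto. apply tm_ge_0; auto.
    + intros s t [_ Hs] [_ Ht]. lra.
  - apply alpha_mono.
  - apply alpha_le_1; lra.
  - intros x Hx. apply alpha_len. lra.
  - intros s t (Hs & Ht & Hst). eapply Rle_trans.
    + apply euler_J; auto; try lra. apply inv; lra.
    + apply Rmult_le_compat_r; auto. apply pow_le, Hp.
  - intros s t Hst. eapply Rle_trans; [apply HJ', Hst|].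
    apply Rmult_le_compat_r; auto. apply pow_le, Hp.
  - intros s t (Hs & Ht & Hst).
    assert (Hle : (s <= t)%nat) by (apply inv; lra). split.
    + eapply Rle_trans; [apply (euler_drift_bound F F0 Z ZZ K HF y0 (step n) h0 s t Hle)|].
      apply Rmult_le_compat_r; lra.
    + change (dlt D' s t) with (dlt (d (S n)) (2 * s)%nat (2 * t)%nat).
      eapply Rle_trans.
      { apply (euler_drift_bound F F0 Z ZZ K HF y0 (step (S n)) (step_pos (S n)) (2 * s) (2 * t)). lia. }
      rewrite !tm_double. apply Rmult_le_compat_r; lra.
  - intros Q s t HQ (Hs & Ht & Hst) HY.
    assert (Hle : (s <= t)%nat) by (apply inv; lra).
    eapply Rle_trans; [apply (drift_refinement n s t Q Hle Ht)|].
    + intros i Hi. assert (tau n s <= tau n i) by (apply tm_mono; [auto|lia]).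
      assert (tau n i <= tau n t) by (apply tm_mono; [auto|lia]).
      apply HY; [lra|split; auto].
    + apply Rmult_le_compat_r; [lra|]. fold eps.
      assert (K * Q <= K2 * Q) by (apply Rmult_le_compat_r; auto). lra.
  - intros s t C HC (Hs & Ht & Hst) HA.
    assert (Hle : (s <= t)%nat) by (apply inv; lra).
    set (A := fun s t => minus (davie_rem F Zg ZZg (d n) (y n) s t) (davie_rem F Zg ZZg D' Y' s t)).
    destruct alpha_modulus as [Mq Mp Mm Mh].
    assert (B := discrete_sewing A (fun x => p x ^ 3) (step n) C (L * p (step n) ^ 3) q s t).
    assert (B' : norm (A s t) <= S0 * C * p (INR (t - s) * step n) ^ 3 +
       L * p (step n) ^ 3 * INR (t - s)).
    { apply B; auto; try lra; clear B.
      - intros x. now apply pow_le.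
      - intros x x' Hxy. apply cube_mono; auto.
      - intros i Hi. unfold A.
        assert (tau n i <= tau n t) by (apply tm_mono; [auto|lia]).
        rewrite EJ.
        rewrite (euler_rem_diag F F0 Z ZZ T K p HD y0 (step n) h0) by lra.
        rewrite (euler_rem_diag F F0 Z ZZ T K p HD y0 (step (S n)) (step_pos _))
          by (rewrite tm_double; lra).
        vec.
      - intros i j m Hi Hj Hm. rewrite <- tm_minus by lia.
        assert (tau n s <= tau n i) by (apply tm_mono; [auto|lia]).
        assert (tau n i <= tau n j) by (apply tm_mono; [auto|lia]).
        assert (tau n j <= tau n m) by (apply tm_mono; [auto|lia]).
        assert (tau n m <= tau n t) by (apply tm_mono; [auto|lia]).
        apply HA; auto; lra.
      - intros i Hi. unfold A.
        rewrite (euler_one_step F F0 Z ZZ y0 (step n)).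
        apply (norm_le_of_eq _ (opp (davie_rem F Zg ZZg D' Y' i (S i)))); [vec|].
        rewrite norm_opp.
        assert (tau n s <= tau n i) by (apply tm_mono; [auto|lia]).
        assert (tau n (S i) <= tau n t) by (apply tm_mono; [auto|lia]).
        assert (Ei : tau n (S i) - tau n i = step n) by (unfold tm; rewrite S_INR; ring).
        rewrite <- Ei at 1. apply HJ'. split; [lra|]. split; [lra|].
        generalize (step_le n); lra. }
    rewrite <- tm_minus in B' by auto.
    eapply Rle_trans; [apply B'|]. apply Rplus_le_compat_l.
    assert (EI : tau n t - tau n s = INR (t - s) * step n) by now apply tm_minus.
    assert (I0 : 0 <= INR (t - s)) by apply pos_INR.
    apply Rle_trans with (eps * step n * INR (t - s)).
    + apply Rmult_le_compat_r; auto.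
    + replace (eps * step n * INR (t - s)) with (eps * (tau n t - tau n s)) by (rewrite EI; ring).
      apply Rmult_le_compat_l; auto. apply alpha_len. lra.
  - intros i Hi. split; auto. apply tm_ge_0; auto.
  - intros j Hj. assert (E : tau n (j * 2 ^ n) = INR j * delta).
    { unfold tm, step. rewrite mult_INR, pow_INR. change (INR 2) with 2. field.
      apply pow_nonzero; lra. }
    split; auto. lra.
  - intros i Hi Hi0.
    assert (i = 0)%nat as ->.
    { assert (i <= 0)%nat; [|lia]. apply inv. unfold tm at 2. simpl. lra. }
    unfold Y'. simpl. rewrite norm_minus_diag. lra.
Qed.
End EulerLimit.

(** * The limit of the Euler scheme *)

Section DriverContinuity.
Context {U W : NormedSpace}.
Notation BB := (lin_NormedModule U (lin_NormedModule U W)).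
Context (Z : R -> U) (ZZ : R -> R -> BB -> W) (T K alpha : R).
Notation p := (pw alpha).
Hypothesis HD : rough_driver Z ZZ T K p.
Hypothesis Ha : 0 <= alpha.
Hypothesis K1 : 1 <= K.

(** By Chen's relation the change is made up of the two short pieces, of products
    with an increment over one of them, and of Chen defects; each has a factor
    [p eta]. *)
Lemma driver_continuity a s b t eta x : 0 <= a -> a <= s -> s <= b -> b <= t -> t <= T ->
  t - a <= 1 -> s - a <= eta -> t - b <= eta ->
  norm (minus (dlt Z s t) (dlt Z a b)) <= 2 * K * p eta /\
  norm (minus (ZZ s t x) (ZZ a b x)) <= 6 * K ^ 2 * p eta * norm x.
Proof.
  intros H0 Has Hsb Hbt HtT H1 Hs Ht.
  assert (Hp := pw_ge_0 alpha).
  assert (P1 : p (s - a) <= p eta) by (apply pw_mono; lra).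
  assert (P2 : p (t - b) <= p eta) by (apply pw_mono; lra).
  assert (Q1 : p (s - a) <= 1) by (apply pw_le_1; lra).
  assert (Q2 : p (t - b) <= 1) by (apply pw_le_1; lra).
  assert (Q3 : p (b - s) <= 1) by (apply pw_le_1; lra).
  assert (Q4 : p (b - a) <= 1) by (apply pw_le_1; lra).
  assert (Q5 : p (t - s) <= 1) by (apply pw_le_1; lra).
  assert (Zas := rd_Z HD a s ltac:(lra) Has ltac:(lra) ltac:(lra)).
  assert (Zbt := rd_Z HD b t ltac:(lra) Hbt ltac:(lra) ltac:(lra)).
  assert (Zsb := rd_Z HD s b ltac:(lra) Hsb ltac:(lra) ltac:(lra)).
  assert (Zas' : norm (dlt Z a s) <= K * p eta).
  { eapply Rle_trans; [apply Zas|]. apply Rmult_le_compat_l; lra. }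
  assert (Zbt' : norm (dlt Z b t) <= K * p eta).
  { eapply Rle_trans; [apply Zbt|]. apply Rmult_le_compat_l; lra. }
  assert (Zsb' : norm (dlt Z s b) <= K).
  { eapply Rle_trans; [apply Zsb|]. rewrite <- (Rmult_1_r K) at 2.
    apply Rmult_le_compat_l; lra. }
  assert (pe := Hp eta). assert (x0 := norm_ge_0 x).
  split.
  - apply (norm_le_of_eq _ (minus (dlt Z b t) (dlt Z a s))); [unfold dlt; vec|].
    eapply Rle_trans; [apply norm_minus_le; [apply Zbt'|apply Zas']|]. lra.
  - assert (Z1 : norm (ZZ a s x) <= K * p eta * norm x).
    { eapply Rle_trans; [apply (rd_ZZ HD); lra|].
      apply Rmult_le_compat_r; auto. apply Rmult_le_compat_l; [lra|].
      assert (0 <= p (s - a)) by auto. nra. }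
    assert (Z2 : norm (ZZ b t x) <= K * p eta * norm x).
    { eapply Rle_trans; [apply (rd_ZZ HD); lra|].
      apply Rmult_le_compat_r; auto. apply Rmult_le_compat_l; [lra|].
      assert (0 <= p (t - b)) by auto. nra. }
    assert (prod : forall u v w, 0 <= u <= p eta -> 0 <= v <= 1 -> 0 <= w <= 1 -> u * v * w <= p eta).
    { intros u v w Hu Hv Hw. assert (0 <= u * v <= u) by nra. nra. }
    assert (N1 : norm (chen_defect Z ZZ a s b x) <= K * p eta * norm x).
    { eapply Rle_trans; [apply (rd_N HD); lra|].
      apply Rmult_le_compat_r; auto. apply Rmult_le_compat_l; [lra|]. apply prod; auto. }
    assert (N2 : norm (chen_defect Z ZZ s b t x) <= K * p eta * norm x).
    { eapply Rle_trans; [apply (rd_N HD); lra|].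
      apply Rmult_le_compat_r; auto. apply Rmult_le_compat_l; [lra|].
      rewrite (Rmult_comm (p (b - s))). apply prod; auto. }
    assert (B1 : norm ((x (dlt Z a s) : lin U W) (dlt Z s b)) <= norm x * (K * p eta) * K).
    { apply norm_app_le; auto. apply norm_app_le; auto. apply Rle_refl. }
    assert (B2 : norm ((x (dlt Z s b) : lin U W) (dlt Z b t)) <= norm x * K * (K * p eta)).
    { apply norm_app_le; auto. apply norm_app_le; auto. apply Rle_refl. }
    replace (minus (ZZ s t x) (ZZ a b x)) with
      (minus (plus (plus (ZZ b t x) (chen_defect Z ZZ s b t x))
                   ((x (dlt Z s b) : lin U W) (dlt Z b t)))
             (plus (plus (ZZ a s x) (chen_defect Z ZZ a s b x))
                   ((x (dlt Z a s) : lin U W) (dlt Z s b)))).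
    2: { unfold chen_defect. vec. }
    eapply Rle_trans.
    { apply norm_minus_le; (apply norm_plus_le; [apply norm_plus_le|]);
        [apply Z2|apply N2|apply B2|apply Z1|apply N1|apply B1]. }
    assert (0 <= p eta * norm x) by now apply Rmult_le_pos.
    assert (K * (p eta * norm x) <= K ^ 2 * (p eta * norm x)) by (apply Rmult_le_compat_r; nra).
    lra.
Qed.
End DriverContinuity.

Section EulerPath.
Context {U W : NormedSpace} (F : W -> lin U W) (F0 : W -> W).
Notation BB := (lin_NormedModule U (lin_NormedModule U W)).
Context (Z : R -> U) (ZZ : R -> R -> BB -> W) (T K alpha : R) (y0 : W).
Notation p := (pw alpha).
Notation q := (sewing_ratio alpha).
Notation L := (davie_const K q).
Notation kap := (kappa_const K).

Hypothesis HD : rough_driver Z ZZ T K p.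
Hypothesis HF : smooth K F F0.
Hypothesis Ha : 1 / 3 < alpha <= 1 / 2.
Hypothesis HT : 0 < T.
Hypothesis complete : forall (u : nat -> W) c r, 0 <= r < 1 ->
  (forall k, norm (minus (u (S k)) (u k)) <= c * r ^ k) ->
  exists l : W, forall k, norm (minus (u k) l) <= c / (1 - r) * r ^ k.
Context (delta : R) (N : nat).
Hypothesis HN : INR N * delta = T.
Hypothesis Hd : 0 < delta <= 1.
Hypothesis HdL : L * p delta <= 1.
Hypothesis HdS : 120 * (2 / (1 - q)) * K2 K alpha ^ 6 * p delta <= 1.

Let K1 : 1 <= K := sm_K HF.
Let Hq1 : q < 1 := sewing_ratio_lt_1 alpha (proj1 Ha).
Let Hq0 : 0 < q := Rpower_gt_0 _ _.
Notation h n := (step delta n).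
Notation tau n := (tm (step delta n)).
Notation y n := (euler F F0 Z ZZ y0 (step delta n)).

Lemma grid_index n t : exists k, 0 <= t -> tau n k <= t < tau n k + h n.
Proof.
  destruct (Rle_dec 0 t) as [H|H]; [|exists O; lra].
  assert (h0 := step_pos delta Hd n).
  destruct (nfloor_ex (t / h n)) as [k [H1 H2]].
  { apply Rdiv_le_0_compat; auto. }
  exists k. intros _. unfold tm.
  replace t with (t / h n * h n) by (field; lra).
  split; [apply Rmult_le_compat_r; lra|].
  replace (INR k * h n + h n) with ((INR k + 1) * h n) by ring.
  apply Rmult_lt_compat_r; auto.
Qed.

Definition idx n t : nat := proj1_sig (constructive_indefinite_description _ (grid_index n t)).

Lemma idx_spec n t : 0 <= t -> tau n (idx n t) <= t < tau n (idx n t) + h n.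
Proof. apply (proj2_sig (constructive_indefinite_description _ (grid_index n t))). Qed.

Lemma idx_refine n t : 0 <= t ->
  idx (S n) t = (2 * idx n t)%nat \/ idx (S n) t = S (2 * idx n t).
Proof.
  intros Ht. assert (H1 := idx_spec n t Ht). assert (H2 := idx_spec (S n) t Ht).
  assert (h0 := step_pos delta Hd (S n)).
  assert (E := tm_double delta n (idx n t)). assert (Es := step_S delta n).
  set (k := idx n t) in *. set (k' := idx (S n) t) in *.
  assert (A1 : (2 * k < S k')%nat).
  { destruct (Nat.lt_ge_cases (2 * k) (S k')) as [|G]; auto. exfalso.
    apply (tm_mono _ h0) in G. unfold tm in G at 1. rewrite S_INR in G. unfold tm in *. lra. }
  assert (A2 : (k' < S (S (2 * k)))%nat).
  { destruct (Nat.lt_ge_cases k' (S (S (2 * k)))) as [|G]; auto. exfalso.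
    apply (tm_mono _ h0) in G. unfold tm in G at 1. rewrite !S_INR in G. unfold tm in *. lra. }
  lia.
Qed.

Definition path_rate : R := euler_rate K alpha delta N + kap * p delta.

Lemma path_cauchy n t : 0 <= t <= T ->
  norm (minus (y (S n) (idx (S n) t)) (y n (idx n t))) <= path_rate * q ^ n.
Proof.
  intros [H0 HtT]. assert (H1 := idx_spec n t H0). assert (H2 := idx_spec (S n) t H0).
  assert (R1 := euler_refinement F F0 Z ZZ T K alpha y0 HD HF Ha delta N HN Hd HdL HdS
    n (idx n t) ltac:(lra)).
  assert (ka := kappa_ge_0 F F0 K HF).
  assert (Q0 : 0 <= q ^ n) by (apply pow_le; lra).
  set (i := idx n t) in *.
  replace (minus (y (S n) (idx (S n) t)) (y n i)) with
    (minus (dlt (y (S n)) (2 * i)%nat (idx (S n) t)) (minus (y n i) (y (S n) (2 * i)%nat)))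
    by (unfold dlt; vec).
  unfold path_rate. rewrite Rmult_plus_distr_r, Rplus_comm.
  apply norm_minus_le; auto.
  assert (Pn : p (h (S n)) <= p delta * q ^ n).
  { apply Rle_trans with (p (h n)); [|now apply p_step].
    apply pw_mono; [lra|]. rewrite step_S. generalize (step_pos delta Hd n); lra. }
  destruct (idx_refine n t H0) as [E|E]; rewrite E in *; fold i.
  - unfold dlt. rewrite norm_minus_diag.
    assert (0 <= p delta) by apply pw_ge_0. repeat apply Rmult_le_pos; auto.
  - fold i in H2.
    assert (E2 : tau (S n) (S (2 * i)) - tau (S n) (2 * i) = h (S n))
      by (unfold tm; rewrite S_INR; ring).
    eapply Rle_trans.
    { apply (euler_increment F F0 Z ZZ T K alpha y0 HD HF Ha delta Hd HdL (S n) (2 * i) (S (2 * i)));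
        [lia|lra|]. rewrite E2. apply step_le; auto. }
    rewrite E2, Rmult_assoc. apply Rmult_le_compat_l; auto.
Qed.

Definition limit_rate : R := path_rate / (1 - q).

Lemma euler_path : exists Y : R -> W, Y 0 = y0 /\
  forall t, 0 <= t <= T -> forall n, norm (minus (y n (idx n t)) (Y t)) <= limit_rate * q ^ n.
Proof.
  assert (Hex : forall t, exists l, 0 <= t <= T ->
    forall n, norm (minus (y n (idx n t)) l) <= limit_rate * q ^ n).
  { intros t. destruct (Classical_Prop.classic (0 <= t <= T)) as [Ht|N0].
    - destruct (complete (fun n => y n (idx n t)) path_rate q) as [l Hl]; [lra| |].
      + intros k. now apply path_cauchy.
      + now exists l.
    - exists zero. tauto. }
  destruct (choice_function _ Hex) as [Y HY]. exists Y. split; auto.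
  symmetry. apply minus_zero_iff.
  assert (H0 := HY 0 ltac:(lra)).
  apply le_of_pow_error with limit_rate q; [lra| |].
  - generalize (norm_le_ge_0 _ _ (H0 O)). simpl. lra.
  - exists O. intros n _. rewrite Rplus_0_l.
    assert (E : idx n 0 = O).
    { assert (H1 := idx_spec n 0 (Rle_refl _)). assert (h0 := step_pos delta Hd n).
      assert (idx n 0 <= 0)%nat; [|lia]. apply (tm_le_inv (h n) h0).
      unfold tm at 2. simpl. lra. }
    specialize (H0 n). rewrite E in H0. exact H0.
Qed.

(** At the grid points next to [s] and [t] the scheme satisfies Davie's estimate,
    and every term of it converges geometrically to its value for [Y]. *)
Lemma euler_path_davie Y :
  (forall t, 0 <= t <= T -> forall n, norm (minus (y n (idx n t)) (Y t)) <= limit_rate * q ^ n) ->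
  forall s t, 0 <= s -> s < t -> t <= T -> t - s <= delta / 2 ->
  norm (minus (minus (dlt Y s t) (scal (t - s) (F0 (Y s)))) (germ F Z ZZ Y s t)) <=
  8 * (L + K * kap) * p (t - s) ^ 3.
Proof.
  intros HY s t Hs Hst HtT Hdl.
  assert (ka := kappa_ge_0 F F0 K HF). assert (L0 := davie_const_ge_0 F F0 K alpha HF Ha).
  assert (Hp := pw_ge_0 alpha).
  assert (c0 : 0 <= limit_rate).
  { generalize (norm_le_ge_0 _ _ (HY 0 ltac:(lra) O)). simpl. lra. }
  apply le_of_pow_error with
    (2 * limit_rate + (K + K * limit_rate) + (K * limit_rate * K + K * (2 * K)) +
     (K * (K * limit_rate) + 6 * K ^ 2 * K)) q; [lra| |].
  { nonneg. }
  (* fine grids have [b - a <= 2 * (t - s)], whence the factor [8 = 2 ^ 3] *)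
  destruct (pow_small q 1 (t - s)) as [n0 Hn0]; [lra|lra|lra|].
  exists n0. intros n Hn.
  assert (Q0 : 0 <= q ^ n) by (apply pow_le; lra).
  assert (h0 := step_pos delta Hd n).
  assert (pn : p (h n) <= q ^ n).
  { eapply Rle_trans; [apply p_step; auto|].
    assert (p delta <= 1) by (apply pw_le_1; lra). 
    assert (0 <= p delta) by auto. nra. }
  assert (hp : h n <= p (h n)).
  { assert (Hle := step_le delta Hd n).
    assert (h n <= p (h n) ^ 2) by (apply le_pw_sqr; lra).
    assert (p (h n) <= 1) by (apply pw_le_1; lra). assert (0 <= p (h n)) by auto. nra. }
  assert (hst : h n <= t - s).
  { specialize (Hn0 n Hn). lra. }
  assert (Is := idx_spec n s Hs). assert (It := idx_spec n t ltac:(lra)).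
  assert (Ys := HY s ltac:(lra) n). assert (Yt := HY t ltac:(lra) n).
  set (i := idx n s) in *. set (j := idx n t) in *.
  set (a := tau n i) in *. set (b := tau n j) in *.
  assert (a0 : 0 <= a) by (apply tm_ge_0; auto).
  assert (ij : (i <= j)%nat).
  { apply (tm_le_inv (h n) h0). fold a b. lra. }
  assert (ab : b - a <= 2 * (t - s)) by lra.
  set (e := q ^ n) in *.
  assert (BJ := euler_J F F0 Z ZZ T K alpha y0 HD HF Ha delta Hd HdL n i j ij ltac:(fold b; lra)
    ltac:(fold a b; lra)).
  assert (BD := euler_drift_frozen F F0 Z ZZ K HF y0 (h n) h0 i j (kap * p (b - a)) ij).
  fold a b in BJ, BD.
  assert (BD' : norm (minus (dlt (euler_drift F F0 Z ZZ y0 (h n)) i j) (scal (b - a) (F0 (y n i))))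
     <= K * (kap * p (b - a)) * (b - a)).
  { apply BD. intros k Hk.
    assert (T1 : tau n k <= b) by (apply tm_mono; [auto|lia]).
    assert (T2 : a <= tau n k) by (apply tm_mono; [auto|lia]).
    eapply Rle_trans.
    { apply (euler_increment F F0 Z ZZ T K alpha y0 HD HF Ha delta Hd HdL n i k); [lia|lra|].
      fold a; lra. }
    apply Rmult_le_compat_l; auto. apply pw_mono; [lra|]. fold a. lra. }
  assert (pab : p (b - a) ^ 3 <= 8 * p (t - s) ^ 3).
  { replace (8 * p (t - s) ^ 3) with ((2 * p (t - s)) ^ 3) by ring.
    apply pow_incr. split; auto. eapply Rle_trans; [|apply pw_double; lra]. apply pw_mono; lra. }
  assert (BD3 : K * (kap * p (b - a)) * (b - a) <= K * kap * p (b - a) ^ 3).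
  { replace (K * kap * p (b - a) ^ 3) with (K * (kap * p (b - a)) * p (b - a) ^ 2) by ring.
    apply Rmult_le_compat_l.
    - apply Rmult_le_pos; [lra|]. now apply Rmult_le_pos.
    - apply le_pw_sqr; lra. }
  assert (E1 : norm (minus (minus (Y t) (y n j)) (minus (Y s) (y n i))) <= 2 * limit_rate * e).
  { eapply Rle_trans; [apply norm_minus_le; rewrite norm_minus_sym; [apply Yt|apply Ys]|]. lra. }
  assert (E2 : norm (minus (scal (t - s) (F0 (Y s))) (scal (b - a) (F0 (y n i))))
    <= (K + K * limit_rate) * e).
  { apply (norm_le_of_eq _ (plus (scal ((t - s) - (b - a)) (F0 (Y s)))
      (scal (b - a) (minus (F0 (Y s)) (F0 (y n i)))))); [vec|].
    eapply Rle_trans; [apply norm_plus_le; apply norm_scal_le|].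
    assert (Rabs (t - s - (b - a)) <= e) by (apply Rabs_le; lra).
    assert (norm (F0 (Y s)) <= K) by apply (sm_F0 HF).
    assert (norm (minus (F0 (Y s)) (F0 (y n i))) <= K * (limit_rate * e)).
    { eapply Rle_trans; [apply (sm_F0_lip HF)|]. apply Rmult_le_compat_l; [lra|].
      rewrite norm_minus_sym. apply Ys. }
    assert (BA : b - a <= 1) by lra.
    assert (AB : 0 <= b - a) by (generalize (tm_mono (h n) h0 i j ij); fold a b; lra).
    rewrite (Rabs_right (b - a)) by lra.
    assert (Rabs (t - s - (b - a)) * norm (F0 (Y s)) <= e * K)
      by (apply Rmult_le_compat; auto; [apply Rabs_pos|apply norm_ge_0]).
    assert ((b - a) * norm (minus (F0 (Y s)) (F0 (y n i))) <= 1 * (K * (limit_rate * e)))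
      by (apply Rmult_le_compat; auto; apply norm_ge_0).
    lra. }
  destruct (driver_continuity Z ZZ T K alpha HD ltac:(lra) K1 a s b t (h n)
    (second_field F (y n i))) as [C1 C2]; try lra.
  assert (HYs : norm (minus (Y s) (y n i)) <= limit_rate * e) by (rewrite norm_minus_sym; auto).
  assert (E3 : norm (minus (F (Y s) (dlt Z s t)) (F (y n i) (dlt Z a b)))
     <= (K * limit_rate * K + K * (2 * K)) * e).
  { apply (norm_le_of_eq _ (plus ((minus (F (Y s)) (F (y n i))) (dlt Z s t))
      (F (y n i) (minus (dlt Z s t) (dlt Z a b))))).
    - rewrite lin_minus_arg.
      change (minus (F (Y s)) (F (y n i)) (dlt Z s t)) with
        (minus (F (Y s) (dlt Z s t)) (F (y n i) (dlt Z s t))). vec.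
    - assert (Zst : norm (dlt Z s t) <= K).
      { eapply Rle_trans; [apply (rd_Z HD); lra|].
        assert (p (t - s) <= 1) by (apply pw_le_1; lra). assert (0 <= p (t - s)) by auto. nra. }
      assert (G1 : norm (minus (F (Y s)) (F (y n i))) <= K * (limit_rate * e)).
      { eapply Rle_trans; [apply (sm_F_lip HF)|]. apply Rmult_le_compat_l; lra. }
      assert (G2 : norm (minus (dlt Z s t) (dlt Z a b)) <= 2 * K * e).
      { eapply Rle_trans; [apply C1|]. apply Rmult_le_compat_l; lra. }
      eapply Rle_trans.
      { apply norm_plus_le; [|apply norm_app_le; [apply (sm_F HF)|apply G2]].
        apply norm_app_le; [apply G1|apply Zst]. }
      lra. }
  set (x := second_field F (y n i)) in *.
  assert (E4 : norm (minus (ZZ s t (second_field F (Y s))) (ZZ a b x))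
     <= (K * (K * limit_rate) + 6 * K ^ 2 * K) * e).
  { apply (norm_le_of_eq _ (plus (ZZ s t (minus (second_field F (Y s)) x))
      (minus (ZZ s t x) (ZZ a b x)))).
    - rewrite (rd_lin HD). vec.
    - assert (G1 : norm (minus (second_field F (Y s)) x) <= K * (limit_rate * e)).
      { eapply Rle_trans; [apply (sm_G_lip HF)|]. apply Rmult_le_compat_l; lra. }
      assert (G2 : norm x <= K) by apply (sm_G HF).
      assert (g0 := norm_ge_0 (minus (second_field F (Y s)) x)).
      assert (x0 := norm_ge_0 x).
      assert (p1 : p (t - s) ^ 2 <= 1).
      { assert (p (t - s) <= 1) by (apply pw_le_1; lra). assert (0 <= p (t - s)) by auto. nra. }
      assert (p2 := pow2_ge_0 (p (t - s))). assert (K20 := pow2_ge_0 K).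
      assert (G3 : norm (ZZ s t (minus (second_field F (Y s)) x)) <= K * (K * (limit_rate * e))).
      { eapply Rle_trans; [apply (rd_ZZ HD); lra|]. apply Rmult_le_compat; auto.
        - apply Rmult_le_pos; lra.
        - nra. }
      assert (G4 : norm (minus (ZZ s t x) (ZZ a b x)) <= 6 * K ^ 2 * e * K).
      { eapply Rle_trans; [apply C2|]. assert (0 <= p (h n)) by auto.
        apply Rmult_le_compat; auto.
        - apply Rmult_le_pos; lra.
        - apply Rmult_le_compat_l; lra. }
      eapply Rle_trans; [apply norm_plus_le; [apply G3|apply G4]|]. lra. }
  set (Jn := davie_rem F (fun k => Z (tau n k)) (fun k l => ZZ (tau n k) (tau n l))
    (euler_drift F F0 Z ZZ y0 (h n)) (y n) i j) in *.
  replace (minus (minus (dlt Y s t) (scal (t - s) (F0 (Y s)))) (germ F Z ZZ Y s t)) with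
    (plus (plus Jn (minus (dlt (euler_drift F F0 Z ZZ y0 (h n)) i j) (scal (b - a) (F0 (y n i)))))
      (minus (minus (minus (minus (minus (Y t) (y n j)) (minus (Y s) (y n i)))
         (minus (scal (t - s) (F0 (Y s))) (scal (b - a) (F0 (y n i)))))
         (minus (F (Y s) (dlt Z s t)) (F (y n i) (dlt Z a b))))
         (minus (ZZ s t (second_field F (Y s))) (ZZ a b x)))).
  2: { unfold Jn, davie_rem, germ.
       change (dlt (fun k => Z (tau n k)) i j) with (dlt Z a b).
       change (tau n i) with a. change (tau n j) with b. fold x. unfold dlt. vec. }
  eapply Rle_trans.
  { apply norm_plus_le; [apply norm_plus_le; [apply BJ|apply BD']|].
    apply norm_minus_le; [|apply E4]. apply norm_minus_le; [|apply E3].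
    apply norm_minus_le; [apply E1|apply E2]. }
  assert (L * p (b - a) ^ 3 <= L * (8 * p (t - s) ^ 3)) by (apply Rmult_le_compat_l; auto).
  assert (K * kap * p (b - a) ^ 3 <= K * kap * (8 * p (t - s) ^ 3)).
  { apply Rmult_le_compat_l; auto. apply Rmult_le_pos; lra. }
  lra.
Qed.
End EulerPath.

(** * From Davie's estimate to solutions *)

Lemma pw_small_at b c : 0 < b -> 0 < c -> exists d, 0 < d /\ pw b d <= c.
Proof.
  intros Hb Hc. exists (Rpower c (/ b)). assert (P := Rpower_gt_0 c (/ b)). split; auto.
  rewrite pw_pos by auto. rewrite Rpower_mult, Rinv_l by lra. rewrite Rpower_1; lra.
Qed.

Lemma pw_cube_split a x : 0 < x -> pw a x ^ 3 = x * pw (3 * a - 1) x.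
Proof.
  intros Hx. rewrite pw_cube, !pw_pos by auto.
  replace (3 * a) with (1 + (3 * a - 1)) at 1 by ring.
  rewrite Rpower_plus, Rpower_1; auto.
Qed.

Lemma partition_telescope {E : NormedSpace} (Xi : R -> R -> E) (G : R -> E) d th part s t :
  is_partition s t part -> mesh s part < d ->
  (forall u v, s <= u -> u < v -> v <= t -> v - u < d ->
     norm (minus (Xi u v) (dlt G u v)) <= th * (v - u)) ->
  norm (minus (partition_sum Xi s part) (dlt G s t)) <= th * (t - s).
Proof.
  revert s. induction part as [|x part IH]; simpl; intros s Hp Hm H.
  - subst t. apply (norm_le_of_eq _ zero); [unfold dlt; vec|]. rewrite norm_zero_eq. right; ring.
  - destruct Hp as [H1 H2]. assert (H3 := partition_le _ _ _ H2).
    assert (M1 : x - s < d) by (eapply Rle_lt_trans; [apply Rmax_l|apply Hm]).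
    assert (M2 : mesh x part < d) by (eapply Rle_lt_trans; [apply Rmax_r|apply Hm]).
    apply (norm_le_of_eq _ (plus (minus (Xi s x) (dlt G s x))
      (minus (partition_sum Xi x part) (dlt G x t)))); [unfold dlt; vec|].
    replace (th * (t - s)) with (th * (x - s) + th * (t - x)) by ring.
    apply norm_plus_le; [apply H; lra|]. apply IH; auto.
    intros u v Hu Huv Hv Hd. apply H; lra.
Qed.

Section HoelderPaths.
Context {W : NormedSpace} (T alpha delta kap : R) (Y : R -> W).
Hypothesis HT : 0 < T.
Hypothesis Ha : 0 < alpha.
Hypothesis Hd : 0 < delta.
Hypothesis Hk : 0 <= kap.
Hypothesis HY : forall s t, 0 <= s -> s <= t -> t <= T -> t - s <= delta ->
  norm (dlt Y s t) <= kap * pw alpha (t - s).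

Lemma bounded_of_local_hoelder : exists M, 0 <= M /\
  forall s t, 0 <= s -> s <= t -> t <= T -> norm (dlt Y s t) <= M.
Proof.
  assert (c0 : 0 <= kap * pw alpha delta) by (apply Rmult_le_pos; auto; apply pw_ge_0).
  destruct (nfloor_ex (T / delta)) as [n [_ Hn]].
  { apply Rdiv_le_0_compat; lra. }
  assert (En : T <= INR (S n) * delta).
  { rewrite S_INR. replace T with (T / delta * delta) at 1 by (field; lra).
    apply Rmult_le_compat_r; lra. }
  assert (main : forall m s t, 0 <= s -> s <= t -> t <= T -> t - s <= INR m * delta ->
    norm (dlt Y s t) <= INR m * (kap * pw alpha delta)).
  { induction m as [|m IH]; intros s t H0 Hst Ht Hm.
    - simpl in *. replace t with s by lra. unfold dlt. rewrite norm_minus_diag. lra.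
    - rewrite S_INR in *. assert (0 <= INR m) by apply pos_INR.
      destruct (Rle_dec (t - s) (INR m * delta)) as [L|L].
      + assert (B := IH s t H0 Hst Ht L). nra.
      + set (u := s + INR m * delta).
        assert (Hu : s <= u <= t) by (unfold u; nra).
        replace (dlt Y s t) with (plus (dlt Y s u) (dlt Y u t)) by (unfold dlt; vec).
        rewrite Rmult_plus_distr_r. apply norm_plus_le.
        * apply IH; unfold u in *; lra.
        * eapply Rle_trans; [apply HY; unfold u in *; lra|]. rewrite Rmult_1_l.
          apply Rmult_le_compat_l; auto. apply pw_mono; unfold u in *; lra. }
  exists (INR (S n) * (kap * pw alpha delta)). split.
  - apply Rmult_le_pos; auto. apply pos_INR.
  - intros s t H0 Hst Ht. apply main; auto. lra.
Qed.

Definition clamp (r : R) : R := Rmax 0 (Rmin T r).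

Lemma clamp_in r : 0 <= clamp r <= T.
Proof.
  unfold clamp. split; [apply Rmax_l|]. apply Rmax_lub; [lra|apply Rmin_l].
Qed.

Lemma clamp_id r : 0 <= r <= T -> clamp r = r.
Proof. intros H. unfold clamp. rewrite Rmin_right, Rmax_right; lra. Qed.

Lemma clamp_cases r :
  (r <= 0 /\ clamp r = 0) \/ (0 <= r <= T /\ clamp r = r) \/ (T <= r /\ clamp r = T).
Proof.
  destruct (Rle_dec r 0) as [L|L].
  - left. unfold clamp. rewrite Rmin_right, Rmax_left; lra.
  - right. destruct (Rle_dec r T) as [L'|L'].
    + left. split; [lra|]. apply clamp_id; lra.
    + right. unfold clamp. rewrite Rmin_left, Rmax_right; lra.
Qed.

Lemma clamp_contract r z : Rabs (clamp r - clamp z) <= Rabs (r - z).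
Proof.
  destruct (clamp_cases r) as [[H ->]|[[H ->]|[H ->]]];
    destruct (clamp_cases z) as [[H' ->]|[[H' ->]|[H' ->]]];
    unfold Rabs; repeat match goal with |- context [Rcase_abs ?a] => destruct (Rcase_abs a) end; lra.
Qed.

Lemma hoelder_abs r z : 0 <= r <= T -> 0 <= z <= T -> Rabs (r - z) <= delta ->
  norm (minus (Y r) (Y z)) <= kap * pw alpha (Rabs (r - z)).
Proof.
  intros Hr Hz Hrz. destruct (Rle_dec z r) as [L|L].
  - rewrite Rabs_right in * by lra. apply HY; lra.
  - rewrite Rabs_left in * by lra. rewrite norm_minus_sym.
    replace (- (r - z)) with (z - r) in * by ring. apply HY; lra.
Qed.
End HoelderPaths.

(** Integrability is derived from continuity at both sides of every point, while
    [Y] is only controlled on [[0, T]]; clamping the time extends it by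
    constants. *)
Lemma drift_exists {W : BanachSpace} (F0 : W -> W) (K T alpha delta kap : R) (Y : R -> W) :
  0 < T -> 0 < alpha -> 0 < delta -> 0 <= kap -> 0 <= K ->
  (forall y z, norm (minus (F0 y) (F0 z)) <= K * norm (minus y z)) ->
  (forall s t, 0 <= s -> s <= t -> t <= T -> t - s <= delta ->
    norm (minus (Y t) (Y s)) <= kap * pw alpha (t - s)) ->
  exists D : R -> W, is_drift (W := W) F0 T Y D.
Proof.
  intros HT Ha Hd Hk HK HF HY.
  set (f := fun r => F0 (Y (clamp T r))).
  assert (C : forall z, continuous f z).
  { intros z. apply filterlim_locally. intros eps.
    destruct (pw_small_at alpha (eps / (K * kap + 1)) Ha) as [d [Pd Hd']].
    { assert (0 <= K * kap) by now apply Rmult_le_pos.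
      apply Rdiv_lt_0_compat; [apply cond_pos|lra]. }
    assert (Pm : 0 < Rmin d delta) by now apply Rmin_pos.
    exists (mkposreal _ Pm). intros r Hr.
    assert (Hr' : Rabs (r - z) < Rmin d delta) by exact Hr.
    assert (Rmin d delta <= d) by apply Rmin_l. assert (Rmin d delta <= delta) by apply Rmin_r.
    apply (@norm_compat1 R_AbsRing (CompleteNormedModule.NormedModule _ W)).
    assert (Hc := clamp_contract T HT r z).
    eapply Rle_lt_trans; [apply HF|].
    apply Rle_lt_trans with (K * (kap * pw alpha d)).
    - apply Rmult_le_compat_l; auto.
      eapply Rle_trans.
      { apply (hoelder_abs (W := W) T alpha delta kap Y HY); try (apply clamp_in; exact HT); auto; lra. }
      apply Rmult_le_compat_l; auto. apply pw_mono; lra.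
    - assert (0 <= K * kap) by now apply Rmult_le_pos.
      apply Rle_lt_trans with (K * kap * (eps / (K * kap + 1))); [nra|].
      assert (E := cond_pos eps).
      apply Rmult_lt_reg_r with (K * kap + 1); [lra|].
      replace (K * kap * (eps / (K * kap + 1)) * (K * kap + 1)) with (K * kap * eps)
        by (field; lra). nra. }
  exists (fun t => RInt f 0 t). intros t Ht.
  apply is_RInt_ext with f.
  - intros r Hr. rewrite Rmin_left, Rmax_right in Hr by lra. unfold f.
    rewrite clamp_id by lra. reflexivity.
  - apply RInt_correct. apply ex_RInt_continuous. intros; apply C.
Qed.

Section DavieSolution.
Context {U V W VV : NormedSpace} (tens : V -> V -> VV).
Notation BB := (lin_NormedModule U (lin_NormedModule U W)).
Hypothesis Ht : is_tensor_square tens.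
Context (C T alpha B K : R) (F : W -> lin U W) (F0 : W -> W)
  (X : R -> V) (XX : R -> R -> VV) (Z : R -> U) (Z' : R -> lin V U).
Notation p := (pw alpha).
Notation ZZ := (second_order (U := U) (W := W) tens XX Z').

Hypothesis HC0 : 0 <= C.
Hypothesis HC : contract_bounded (U := U) (W := W) tens C.
Hypothesis HB : 1 <= B.
Hypothesis HT : 0 < T.
Hypothesis Ha : 1 / 3 < alpha <= 1 / 2.
Hypothesis HX : data_size tens T B p X XX Z Z'.
Hypothesis HF : smooth K F F0.
Hypothesis HK : driver_const C B <= K.

Lemma rough_driver_of_data : rough_driver Z ZZ T K p.
Proof.
  assert (Hmo := alpha_modulus alpha Ha).
  assert (unit : forall s u t b, 0 <= s -> s <= u -> u <= t -> t <= T -> t - s <= 1 ->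
    norm (chen_defect Z ZZ s u t b) <= K * (p (u - s) * p (t - u) * p (t - s)) * norm b).
  { intros s u t b H0 Hsu Hut HtT H1.
    assert (P1 : p (t - s) <= 1) by (apply pw_le_1; lra).
    destruct (driver_chen_defect tens Ht C T B 0 p X X XX XX Z Z Z' Z' HC0 HC
      (data_pair_refl tens T B p X XX Z Z' HB HX) (mo_pos Hmo) (mo_mono Hmo)
      s u t b H0 Hsu Hut HtT P1) as [G _].
    eapply Rle_trans; [apply G|]. apply Rmult_le_compat_r; [apply norm_ge_0|].
    apply Rmult_le_compat_r; auto.
    repeat apply Rmult_le_pos; apply pw_ge_0. }
  assert (D := fun a Ha0 => unit_interval_driver tens Ht C T alpha B K (sewing_ratio alpha)
    X XX Z Z' HC0 HC HB ltac:(lra) HX HK Hmo a Ha0).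
  split; auto.
  - intros. apply contract_minus_b, Ht.
  - intros s b Hs. unfold second_order.
    rewrite (chen_diag tens Ht T X XX s) by (auto; apply HX).
    exact (linear_map_comb _ (fun _ => 0) nil (contract_linear tens Ht _ _ _)).
  - intros s t H0 Hst HtT H1. apply (dp_Z (D s H0)); lra.
  - intros s t b H0 Hst HtT H1. apply (dp_ZZ (D s H0)); lra.
Qed.

Context (y0 : W) (Y : R -> W) (delta LL : R).
Hypothesis Hd : 0 < delta <= 1.
Hypothesis HLL : 0 <= LL.
Hypothesis HY0 : Y 0 = y0.
Hypothesis HR : forall s t, 0 <= s -> s < t -> t <= T -> t - s <= delta ->
  norm (minus (minus (dlt Y s t) (scal (t - s) (F0 (Y s)))) (germ F Z ZZ Y s t))
  <= LL * p (t - s) ^ 3.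

Let K1 : 1 <= K := sm_K HF.
Let kap : R := LL + K + 2 * K ^ 2.

Lemma davie_increments s t : 0 <= s -> s <= t -> t <= T -> t - s <= delta ->
  norm (dlt Y s t) <= kap * p (t - s) /\
  norm (first_rem F Z Y s t) <= kap * p (t - s) ^ 2.
Proof.
  intros H0 Hst HtT Hts.
  assert (HD := rough_driver_of_data).
  assert (kap0 : 0 <= kap) by (unfold kap; nra).
  assert (P0 := pw_ge_0 alpha (t - s)).
  destruct (eq_or_lt s t Hst) as [<-|Lst].
  { assert (E : dlt Y s s = zero) by (unfold dlt; vec).
    split.
    - rewrite E. rewrite norm_zero_eq. now apply Rmult_le_pos.
    - apply (norm_le_of_eq _ zero).
      + unfold first_rem. rewrite E.
        replace (dlt Z s s) with (zero : U) by (unfold dlt; vec).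
        rewrite lin_zero_arg. vec.
      + rewrite norm_zero_eq. apply Rmult_le_pos; auto. apply pow2_ge_0. }
  assert (P1 : p (t - s) <= 1) by (apply pw_le_1; lra).
  assert (P2 : t - s <= p (t - s) ^ 2) by (apply le_pw_sqr; lra).
  assert (P3 : p (t - s) ^ 2 <= p (t - s)) by nra.
  assert (P3' := pow2_ge_0 (p (t - s))).
  assert (P4 : p (t - s) ^ 3 <= p (t - s) ^ 2) by (simpl; nra).
  assert (Rr : norm (first_rem F Z Y s t) <= (LL + K + K ^ 2) * p (t - s) ^ 2).
  { apply (norm_le_of_eq _ (plus (plus
      (minus (minus (dlt Y s t) (scal (t - s) (F0 (Y s)))) (germ F Z ZZ Y s t))
      (scal (t - s) (F0 (Y s)))) (ZZ s t (second_field F (Y s)))));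
      [unfold first_rem, germ; vec|].
    eapply Rle_trans.
    { apply norm_plus_le; [apply norm_plus_le; [apply HR; auto|apply norm_scal_le]|].
      eapply Rle_trans; [apply (rd_ZZ HD); auto; lra|].
      apply Rmult_le_compat_l; [|apply (sm_G HF)]. apply Rmult_le_pos; lra. }
    rewrite Rabs_right by lra.
    assert (G := sm_F0 HF (Y s)). assert (G0 := norm_ge_0 (F0 (Y s))).
    assert ((t - s) * norm (F0 (Y s)) <= p (t - s) ^ 2 * K) by (apply Rmult_le_compat; lra).
    assert (LL * p (t - s) ^ 3 <= LL * p (t - s) ^ 2) by (apply Rmult_le_compat_l; lra).
    assert (E : (LL + K + K ^ 2) * p (t - s) ^ 2 =
      LL * p (t - s) ^ 2 + p (t - s) ^ 2 * K + K * p (t - s) ^ 2 * K) by ring.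
    rewrite E. lra. }
  split.
  - apply (norm_le_of_eq _ (plus (first_rem F Z Y s t) (F (Y s) (dlt Z s t))));
      [unfold first_rem; vec|].
    eapply Rle_trans.
    { apply norm_plus_le; [apply Rr|].
      apply norm_app_le; [apply (sm_F HF)|apply (rd_Z HD); auto; lra]. }
    assert ((LL + K + K ^ 2) * p (t - s) ^ 2 <= (LL + K + K ^ 2) * p (t - s))
      by (apply Rmult_le_compat_l; auto; nra).
    unfold kap. lra.
  - eapply Rle_trans; [apply Rr|]. apply Rmult_le_compat_r; auto. unfold kap. nra.
Qed.

(** The increments of [Y - D] are the germ up to order [3 alpha > 1], an
    [o(t - s)]; so the Riemann sums of the germ telescope to them in the limit.
    The Hölder bounds are those of [davie_increments] on short intervals; on
    intervals longer than [delta] they follow from boundedness. *)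
Lemma solution_of_davie : (exists D, is_drift F0 T Y D) ->
  is_solution T alpha tens X XX Z Z' F F0 y0 Y (fun t => lin_comp (F (Y t)) (Z' t)).
Proof.
  intros Hdrift.
  assert (kap0 : 0 <= kap) by (unfold kap; nra).
  assert (Pd : 0 < p delta) by (rewrite pw_pos by lra; apply Rpower_gt_0).
  assert (HD := rough_driver_of_data).
  assert (HYk : forall s t, 0 <= s -> s <= t -> t <= T -> t - s <= delta ->
    norm (dlt Y s t) <= kap * p (t - s)) by (intros; now apply davie_increments).
  destruct (bounded_of_local_hoelder T alpha delta kap Y HT ltac:(lra) ltac:(lra) kap0 HYk)
    as [M [M0 HM]].
  assert (big : forall s t, delta < t - s -> p delta <= p (t - s))
    by (intros; apply pw_mono; lra).
  assert (KB : 0 <= K * B) by nra.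
  split; [split|].
  - apply (hoelder_le (A := lin_NormedModule V W) T alpha HT _
      (kap * K * B + K * B + 2 * (K * B) / p delta)).
    intros s t H0 Hst HtT.
    assert (P0 := pw_ge_0 alpha (t - s)).
    assert (c1 : 0 <= 2 * (K * B) / p delta) by (apply Rdiv_le_0_compat; lra).
    assert (c2 : 0 <= kap * K * B + K * B).
    { assert (0 <= kap * (K * B)) by now apply Rmult_le_pos. lra. }
    assert (Bs : forall r, 0 <= r <= T -> norm (lin_comp (F (Y r)) (Z' r)) <= K * B).
    { intros r Hr. apply lin_comp_bound; [apply (sm_F HF)|now apply (ds_Z' HX)]. }
    destruct (Rle_dec (t - s) delta) as [L|L].
    + apply (norm_le_of_eq (A := lin_NormedModule V W) _
        (plus (lin_comp (minus (F (Y t)) (F (Y s))) (Z' t))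
              (lin_comp (F (Y s)) (incr (A := lin_NormedModule V U) Z' s t)))).
      { now apply derivative_increment. }
      eapply Rle_trans.
      { apply (norm_plus_le (A := lin_NormedModule V W)); apply lin_comp_bound.
        - eapply Rle_trans; [apply (sm_F_lip HF)|].
          apply Rmult_le_compat_l; [lra|]. apply (HYk s t); auto.
        - apply (ds_Z' HX); lra.
        - apply (sm_F HF).
        - apply (ds_Z'_inc HX); auto. }
      assert (0 <= 2 * (K * B) / p delta * p (t - s)) by now apply Rmult_le_pos. lra.
    + eapply Rle_trans.
      { apply (norm_minus_le (A := lin_NormedModule V W)); apply Bs; lra. }
      apply Rle_trans with (2 * (K * B) / p delta * p (t - s)).
      * apply Rle_trans with (2 * (K * B) / p delta * p delta); [right; field; lra|].
        apply Rmult_le_compat_l; auto. apply big; lra.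
      * apply Rmult_le_compat_r; auto. lra.
  - apply (hoelder2_le T alpha HT _
      (kap + K * B + (M + K * (B * (B * p T))) / p delta ^ 2)).
    intros s t H0 Hst HtT.
    assert (P0 := pw_ge_0 alpha (t - s)). assert (P2 := pow2_ge_0 (p (t - s))).
    assert (PT := pw_ge_0 alpha T).
    assert (Pd2 : 0 < p delta ^ 2) by nra.
    assert (c3 : 0 <= M + K * (B * (B * p T))).
    { apply Rplus_le_le_0_compat; auto. repeat apply Rmult_le_pos; lra. }
    assert (c1 : 0 <= (M + K * (B * (B * p T))) / p delta ^ 2) by (apply Rdiv_le_0_compat; lra).
    destruct (Rle_dec (t - s) delta) as [L|L].
    + apply (norm_le_of_eq _ (plus (first_rem F Z Y s t) (F (Y s) (remainder X Z Z' s t)))).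
      { now apply remainder_first_rem. }
      eapply Rle_trans.
      { apply norm_plus_le; [apply davie_increments; lra|].
        apply norm_app_le; [apply (sm_F HF)|].
        apply (ds_rem HX); lra. }
      assert (0 <= (M + K * (B * (B * p T))) / p delta ^ 2 * p (t - s) ^ 2) by now apply Rmult_le_pos.
      lra.
    + apply Rle_trans with (M + K * (B * (B * p T))).
      { unfold remainder. apply norm_minus_le; [apply (HM s t); lra|].
                change (norm (F (Y s) (Z' s (incr X s t))) <= K * (B * (B * p T))).
        apply norm_app_le; [apply (sm_F HF)|].
        apply norm_app_le; [apply (ds_Z' HX); lra|].
        eapply Rle_trans; [apply (ds_X HX); lra|].
        apply Rmult_le_compat_l; [lra|]. apply pw_mono; lra. }
      apply Rle_trans with ((M + K * (B * (B * p T))) / p delta ^ 2 * p (t - s) ^ 2).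
      * apply Rle_trans with ((M + K * (B * (B * p T))) / p delta ^ 2 * p delta ^ 2);
          [right; field; lra|].
        apply Rmult_le_compat_l; auto. apply pow_incr. split; [lra|]. apply big; lra.
      * apply Rmult_le_compat_r; auto. lra.
  - intros t Htt. split; [|reflexivity].
    destruct Hdrift as [D HDr].
    exists (minus (minus (Y t) y0) (D t)), (D t). split; [|split; [now apply HDr|vec]].
    set (LD := LL + K * kap).
    assert (LD0 : 0 <= LD) by (unfold LD; nra).
    assert (key : forall u v, 0 <= u -> u < v -> v <= T -> v - u <= delta ->
      norm (minus (germ F Z ZZ Y u v) (dlt (fun r => minus (Y r) (D r)) u v))
      <= LD * p (v - u) ^ 3).
    { intros u v Hu Huv Hv Huvd.
      assert (DF := drift_frozen F0 K T ltac:(lra) (sm_F0_lip HF) Y D (kap * p (v - u)) u v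
        HDr Hu ltac:(lra) Hv).
      apply (norm_le_of_eq _ (minus
        (minus (dlt D u v) (scal (v - u) (F0 (Y u))))
        (minus (minus (dlt Y u v) (scal (v - u) (F0 (Y u)))) (germ F Z ZZ Y u v))));
        [unfold dlt; vec|].
      eapply Rle_trans.
      { apply norm_minus_le; [apply DF|apply HR; auto].
        intros r Hr. eapply Rle_trans; [apply (HYk u r); lra|].
        apply Rmult_le_compat_l; auto. apply pw_mono; lra. }
      assert (P0 := pw_ge_0 alpha (v - u)).
      assert (v - u <= p (v - u) ^ 2) by (apply le_pw_sqr; lra).
      assert (K * (kap * p (v - u)) * (v - u) <= K * (kap * p (v - u)) * p (v - u) ^ 2).
      { apply Rmult_le_compat_l; auto. apply Rmult_le_pos; [lra|]. now apply Rmult_le_pos. }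
      unfold LD. lra. }
    intros eps He.
    destruct (pw_small_at (3 * alpha - 1) (eps / (2 * (LD * T + 1)))) as [d [Pdd Hdd]]; [lra| |].
    { assert (0 <= LD * T) by nra. apply Rdiv_lt_0_compat; lra. }
    exists (Rmin d delta). split; [apply Rmin_pos; lra|].
    intros part Hpart Hmesh.
    assert (Rmin d delta <= d) by apply Rmin_l. assert (Rmin d delta <= delta) by apply Rmin_r.
    set (th := LD * pw (3 * alpha - 1) d).
    assert (th0 : 0 <= th) by (apply Rmult_le_pos; auto; apply pw_ge_0).
    assert (tel := partition_telescope
      (rough_germ tens XX Z Z' F Y (fun t => lin_comp (F (Y t)) (Z' t)))
      (fun r => minus (Y r) (D r)) (Rmin d delta) th part 0 t Hpart Hmesh).
    assert (D0 : D 0 = zero).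
    { apply (norm_eq_zero). apply Rle_antisym; [|apply norm_ge_0].
      apply Rle_trans with ((0 - 0) * K); [|right; ring].
      apply (norm_RInt_le_const (fun r => F0 (Y r)) 0 0); [lra| |apply HDr; lra].
      intros r _. apply (sm_F0 HF). }
    assert (Eg : dlt (fun r => minus (Y r) (D r)) 0 t = minus (minus (Y t) y0) (D t)).
    { unfold dlt. rewrite D0, HY0. vec. }
    rewrite Eg in tel.
    eapply Rle_lt_trans.
    { apply tel. intros u v Hu Huv Hv Huvd.
      eapply Rle_trans; [apply (key u v); lra|].
      rewrite pw_cube_split by lra. unfold th.
      rewrite (Rmult_comm (v - u)), <- Rmult_assoc. apply Rmult_le_compat_r; [lra|].
      apply Rmult_le_compat_l; auto. apply pw_mono; lra. }
    rewrite Rminus_0_r.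
    assert (LT : 0 <= LD * T) by nra.
    apply Rle_lt_trans with (LD * (eps / (2 * (LD * T + 1))) * T).
    + unfold th. apply Rmult_le_compat; try lra; auto.
      apply Rmult_le_compat_l; auto.
    + apply Rmult_lt_reg_r with (2 * (LD * T + 1)); [lra|].
      replace (LD * (eps / (2 * (LD * T + 1))) * T * (2 * (LD * T + 1))) with (LD * T * eps)
        by (field; lra). nra.
Qed.
End DavieSolution.

(** * Stability of solutions *)

Lemma uniform_sum_norm {E : NormedSpace} (Xi : R -> R -> E) s h n e :
  (forall i, (i < n)%nat -> norm (Xi (s + INR i * h) (s + INR (S i) * h)) <= e) ->
  norm (uniform_sum Xi s h n) <= INR n * e.
Proof.
  induction n as [|n IH]; intros H.
  - simpl. rewrite norm_zero_eq. lra.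
  - cbn [uniform_sum]. replace (INR (S n) * e) with (INR n * e + e) by (rewrite S_INR; ring).
    apply norm_plus_le.
    + apply IH. intros i Hi. apply H. lia.
    + apply H. lia.
Qed.

(** Since [A] is of order [3 alpha > 1], its sums over fine uniform partitions
    vanish in the limit, and what remains of [A s t] is the sewing error. *)
Lemma sewing_bound {E : NormedSpace} (A : R -> R -> E) alpha q C L s t :
  modulus (pw alpha) q -> 1 / 3 < alpha -> 0 <= C -> 0 <= L -> s <= t ->
  (forall r, s <= r <= t -> A r r = zero) ->
  (forall a b, s <= a -> a <= b -> b <= t -> norm (A a b) <= L * pw alpha (b - a) ^ 3) ->
  (forall a u b, s <= a -> a <= u -> u <= b -> b <= t ->
     norm (minus (A a b) (plus (A a u) (A u b))) <= C * pw alpha (b - a) ^ 3) ->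
  norm (A s t) <= 2 / (1 - q) * C * pw alpha (t - s) ^ 3.
Proof.
  intros Hmo Ha HC HL Hst H0 HA HD.
  assert (Hq := mo_q Hmo).
  destruct (eq_or_lt s t Hst) as [<-|Lst].
  { rewrite H0 by lra. rewrite norm_zero_eq.
    apply Rmult_le_pos; [|apply pow_le, pw_ge_0].
    apply Rmult_le_pos; auto. apply Rdiv_le_0_compat; lra. }
  apply le_epsilon. intros eps He.
  assert (LT : 0 <= L * (t - s)) by (apply Rmult_le_pos; lra).
  destruct (pw_small_at (3 * alpha - 1) (eps / (L * (t - s) + 1))) as [d [Pd Hd]]; [lra| |].
  { apply Rdiv_lt_0_compat; lra. }
  destruct (archimed_cor1 (d / (t - s))) as [n [Hn Hn']]; [apply Rdiv_lt_0_compat; lra|].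
  assert (Pn : 0 < INR n) by now apply lt_0_INR.
  assert (Pi : 0 < / INR n) by now apply Rinv_0_lt_compat.
  set (h := (t - s) / INR n).
  assert (h0 : 0 < h) by (apply Rdiv_lt_0_compat; lra).
  assert (hd : h <= d).
  { unfold h, Rdiv. apply Rle_trans with ((t - s) * (d / (t - s))).
    - apply Rmult_le_compat_l; lra.
    - right; field; lra. }
  assert (En : INR n * h = t - s) by (unfold h; field; lra).
  assert (B1 : norm (minus (uniform_sum A s h n) (A s t)) <= 2 / (1 - q) * C * pw alpha (t - s) ^ 3).
  { apply (uniform_sum_sewing A (pw alpha) q C s t n); auto.
    intros a u b Hsa Hau Hub Hbt. rewrite norm_minus_sym. now apply HD. }
  assert (B2 : norm (uniform_sum A s h n) <= INR n * (L * (h * pw (3 * alpha - 1) d))).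
  { apply uniform_sum_norm. intros i Hi.
    assert (I0 : 0 <= INR i) by apply pos_INR.
    assert (I1 : INR (S i) <= INR n) by (apply le_INR; lia).
    assert (I2 : INR (S i) * h <= INR n * h) by (apply Rmult_le_compat_r; lra).
    assert (I3 : INR (S i) * h = INR i * h + h) by (rewrite S_INR; ring).
    assert (I4 : 0 <= INR i * h) by (apply Rmult_le_pos; lra).
    eapply Rle_trans; [apply HA; lra|]. apply Rmult_le_compat_l; auto.
    replace (s + INR (S i) * h - (s + INR i * h)) with h by lra.
    rewrite pw_cube_split by auto. apply Rmult_le_compat_l; [lra|]. apply pw_mono; lra. }
  replace (A s t) with (minus (uniform_sum A s h n) (minus (uniform_sum A s h n) (A s t))) by vec.
  eapply Rle_trans; [apply norm_minus_le; [apply B2|apply B1]|].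
  assert (B3 : INR n * (L * (h * pw (3 * alpha - 1) d)) <= eps).
  { replace (INR n * (L * (h * pw (3 * alpha - 1) d))) with (L * (INR n * h) * pw (3 * alpha - 1) d) by ring.
    rewrite En. apply Rle_trans with (L * (t - s) * (eps / (L * (t - s) + 1))).
    - apply Rmult_le_compat_l; auto.
    - apply Rmult_le_reg_r with (L * (t - s) + 1); [lra|].
      replace (L * (t - s) * (eps / (L * (t - s) + 1)) * (L * (t - s) + 1)) with (L * (t - s) * eps)
        by (field; lra). nra. }
  lra.
Qed.

Section SolutionStability.
Context {U V W VV : NormedSpace} (tens : V -> V -> VV).
Notation BB := (lin_NormedModule U (lin_NormedModule U W)).
Notation VU := (lin_NormedModule V U).
Notation VW := (lin_NormedModule V W).
Hypothesis Ht : is_tensor_square tens.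

Lemma data_pair_left T B e p X X2 XX XX2 (Z Z2 : R -> U) (Z' Z2' : R -> lin V U) :
  data_pair tens T B e p X X2 XX XX2 Z Z2 Z' Z2' -> data_size tens T B p X XX Z Z'.
Proof.
  intros [H1 H2 H3 H4 H5 H6 H7 H8 H9].
  split; [exact H3|intros s t a b c; exact (proj1 (H5 s t a b c))|intros s t a b c; exact (proj1 (H6 s t a b c))
    |intros s a; exact (proj1 (H7 s a))|intros s t a b c; exact (proj1 (H8 s t a b c))
    |intros s t a b c; exact (proj1 (H9 s t a b c))].
Qed.

Lemma data_pair_right T B e p X X2 XX XX2 (Z Z2 : R -> U) (Z' Z2' : R -> lin V U) :
  data_pair tens T B e p X X2 XX XX2 Z Z2 Z' Z2' -> data_size tens T B p X2 XX2 Z2 Z2'.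
Proof.
  intros [H1 H2 H3 H4 H5 H6 H7 H8 H9].
  split; [exact H4|intros s t a b c; exact (proj1 (proj2 (H5 s t a b c)))|intros s t a b c; exact (proj1 (proj2 (H6 s t a b c)))
    |intros s a; exact (proj1 (proj2 (H7 s a)))|intros s t a b c; exact (proj1 (proj2 (H8 s t a b c)))
    |intros s t a b c; exact (proj1 (proj2 (H9 s t a b c)))].
Qed.

Section Global.
Context (C T alpha B q K delta E : R) (m : nat) (F : W -> lin U W) (F0 : W -> W)
  (X X2 : R -> V) (XX XX2 : R -> R -> VV) (Z Z2 : R -> U) (Z' Z2' : R -> lin V U)
  (y y2 : W) (Y Y2 : R -> W) (Y' Y2' : R -> lin V W).
Notation p := (pw alpha).
Notation ZZ := (second_order (U := U) (W := W) tens XX Z').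
Notation ZZ2 := (second_order (U := U) (W := W) tens XX2 Z2').

Definition solution_const : R := 2 / (1 - q) * germ_const B K.
Definition stab_const : R := K + solution_const.
Definition gain : R := 55 * stab_const ^ 6.
Definition sup_const : R := (2 * gain) ^ m * (1 + driver_const C B).
Definition window_const : R := gain * (sup_const + driver_const C B).

Hypothesis HC0 : 0 <= C.
Hypothesis HC : contract_bounded (U := U) (W := W) tens C.
Hypothesis HT : 0 < T.
Hypothesis Ha : 1 / 3 < alpha <= 1 / 2.
Hypothesis Hmo : modulus p q.
Hypothesis HF : smooth K F F0.
Hypothesis HK : driver_const C B <= K.
Hypothesis HD : data_pair tens T B E p X X2 XX XX2 Z Z2 Z' Z2'.
Hypothesis Hsol : is_solution T alpha tens X XX Z Z' F F0 y Y Y'.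
Hypothesis Hsol2 : is_solution T alpha tens X2 XX2 Z2 Z2' F F0 y2 Y2 Y2'.
Hypothesis HY' : forall s, 0 <= s <= T -> norm (Y' s) <= B.
Hypothesis HY2' : forall s, 0 <= s <= T -> norm (Y2' s) <= B.
Hypothesis HRY : forall s t, 0 <= s -> s <= t -> t <= T ->
  norm (remainder X Y Y' s t) <= B * p (t - s) ^ 2.
Hypothesis HRY2 : forall s t, 0 <= s -> s <= t -> t <= T ->
  norm (remainder X2 Y2 Y2' s t) <= B * p (t - s) ^ 2.
Hypothesis Hy : norm (minus y y2) <= E.
Hypothesis Hd : 0 < delta <= 1.
Hypothesis Hsmall : 120 * (2 / (1 - q)) * stab_const ^ 6 * p delta <= 1.
Hypothesis Hm : T <= INR m * delta.

Let B1 : 1 <= B := da_B HD.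
Let E0 : 0 <= E := da_e HD.
Let K1 : 1 <= K := sm_K HF.

Lemma sewing_const_ge_2 : 2 <= 2 / (1 - q).
Proof.
  assert (Hq := mo_q Hmo). apply Rmult_le_reg_r with (1 - q); [lra|].
  unfold Rdiv. rewrite Rmult_assoc, Rinv_l by lra. lra.
Qed.

Lemma driver_const_ge_0 : 0 <= driver_const C B.
Proof. unfold driver_const. apply Rmult_le_pos; [lra|]. apply pow_le; lra. Qed.

(** Both solutions satisfy Davie's estimate, and differences of their remainders
    are sewn by [sewing_bound]; this is the instance of the abstract stability
    estimates in continuous time. *)
Lemma solution_window_stability :
  (forall t, 0 <= t <= T -> norm (minus (Y t) (Y2 t)) <= sup_const * E) /\
  (forall s t, 0 <= s -> s <= t -> t <= T -> t - s <= delta ->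
     norm (minus (dlt Y s t) (dlt Y2 s t)) <= window_const * E * p (t - s) /\
     norm (minus (first_rem F Z Y s t) (first_rem F Z2 Y2 s t)) <=
       window_const * E * p (t - s) ^ 2).
Proof.
  assert (DL := data_pair_left _ _ _ _ _ _ _ _ _ _ _ _ HD).
  assert (DR := data_pair_right _ _ _ _ _ _ _ _ _ _ _ _ HD).
  assert (S2 := sewing_const_ge_2). assert (D0 := driver_const_ge_0).
  assert (G0 : 0 <= germ_const B K) by (apply germ_const_ge_0; lra).
  assert (Hp := pw_ge_0 alpha).
  assert (Hpm : forall x x', x <= x' -> p x <= p x') by apply Hmo.
  destruct (davie_of_solution tens Ht C T alpha B K q F F0 X XX Z Z' HC0 HC B1 HT ltac:(lra) DL HF HK
    Hmo y Y Y' Hsol HY' HRY) as [Ey [D [HDr HJ]]].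
  destruct (davie_of_solution tens Ht C T alpha B K q F F0 X2 XX2 Z2 Z2' HC0 HC B1 HT ltac:(lra) DR HF HK
    Hmo y2 Y2 Y2' Hsol2 HY2' HRY2) as [Ey2 [D2 [HDr2 HJ2]]].
  fold solution_const in HJ, HJ2.
  assert (SC0 : 0 <= solution_const) by (apply Rmult_le_pos; lra).
  assert (KS : K <= stab_const) by (unfold stab_const; lra).
  assert (LS : solution_const <= stab_const) by (unfold stab_const; lra).
  set (Val := fun t : R => 0 <= t <= T).
  set (eps := driver_const C B * E).
  assert (e0 : 0 <= eps) by now apply Rmult_le_pos.
  assert (HFS : smooth stab_const F F0) by now apply smooth_mono with K.
  assert (HZ : forall a, Val a -> driver_pair (fun r => r) (fun i => Val i /\ a <= i <= a + delta) p
    stab_const eps Z Z2 ZZ ZZ2).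
  { intros a Va. apply (driver_of_data tens Ht C T B E p X X2 XX XX2 Z Z2 Z' Z2' HC0 HC HD Hp Hpm).
    - lra.
    - intros i [Hi _]. exact Hi.
    - intros s t [_ Hs] [_ Htt]. apply pw_le_1; lra. }
  assert (Hpd1 : p delta <= 1) by (apply pw_le_1; lra).
  assert (Hlen : forall x, x <= delta -> x <= p x ^ 2) by (intros; apply le_pw_sqr; lra).
  assert (P3 : forall s t, 0 <= p (t - s) ^ 3) by (intros; apply pow_le, Hp).
  assert (J1 : forall s t, pair_in (fun r => r) Val delta s t ->
    norm (davie_rem F Z ZZ D Y s t) <= stab_const * p (t - s) ^ 3).
  { intros s t ([Hs Hs'] & [Htt Htt'] & Hst). eapply Rle_trans; [apply HJ; lra|].
    apply Rmult_le_compat_r; auto. }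
  assert (J2 : forall s t, pair_in (fun r => r) Val delta s t ->
    norm (davie_rem F Z2 ZZ2 D2 Y2 s t) <= stab_const * p (t - s) ^ 3).
  { intros s t ([Hs Hs'] & [Htt Htt'] & Hst). eapply Rle_trans; [apply HJ2; lra|].
    apply Rmult_le_compat_r; auto. }
  assert (DB : forall s t, pair_in (fun r => r) Val delta s t ->
    norm (dlt D s t) <= stab_const * (t - s) /\ norm (dlt D2 s t) <= stab_const * (t - s)).
  { intros s t ([Hs Hs'] & [Htt Htt'] & Hst). split.
    - eapply Rle_trans; [apply (drift_bound F0 K T (sm_F0 HF) Y D s t HDr); lra|].
      apply Rmult_le_compat_r; lra.
    - eapply Rle_trans; [apply (drift_bound F0 K T (sm_F0 HF) Y2 D2 s t HDr2); lra|].
      apply Rmult_le_compat_r; lra. }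
  assert (DD : forall Q s t, 0 <= Q -> pair_in (fun r => r) Val delta s t ->
    (forall r, Val r -> s <= r <= t -> norm (minus (Y r) (Y2 r)) <= Q) ->
    norm (minus (dlt D s t) (dlt D2 s t)) <= (stab_const * Q + eps) * (t - s)).
  { intros Q s t HQ ([Hs Hs'] & [Htt Htt'] & Hst) HYQ.
    eapply Rle_trans.
    { apply (drift_difference F0 K T ltac:(lra) (sm_F0_lip HF) Y D Y2 D2 Q s t HDr HDr2); try lra.
      intros r Hr. apply HYQ; auto. split; lra. }
    apply Rmult_le_compat_r; [lra|].
    assert (K * Q <= stab_const * Q) by (apply Rmult_le_compat_r; auto). lra. }
  assert (SW : forall s t C', 0 <= C' -> pair_in (fun r => r) Val delta s t ->
    (forall s' u t', Val s' -> Val u -> Val t' -> s <= s' -> s' <= u <= t' -> t' <= t ->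
     norm (minus (minus (davie_rem F Z ZZ D Y s' t') (davie_rem F Z2 ZZ2 D2 Y2 s' t'))
       (plus (minus (davie_rem F Z ZZ D Y s' u) (davie_rem F Z2 ZZ2 D2 Y2 s' u))
             (minus (davie_rem F Z ZZ D Y u t') (davie_rem F Z2 ZZ2 D2 Y2 u t'))))
     <= C' * p (t' - s') ^ 3) ->
    norm (minus (davie_rem F Z ZZ D Y s t) (davie_rem F Z2 ZZ2 D2 Y2 s t)) <=
    2 / (1 - q) * C' * p (t - s) ^ 3 + eps * p (t - s) ^ 2).
  { intros s t C' HC' ([Hs Hs'] & [Htt Htt'] & Hst) HA.
    assert (0 <= eps * p (t - s) ^ 2) by (apply Rmult_le_pos; auto; apply pow2_ge_0).
    apply Rle_trans with (2 / (1 - q) * C' * p (t - s) ^ 3); [|lra].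
    apply (sewing_bound (fun s t => minus (davie_rem F Z ZZ D Y s t) (davie_rem F Z2 ZZ2 D2 Y2 s t))
      alpha q C' (2 * solution_const)); auto; try lra.
    - intros r Hr. unfold davie_rem.
      rewrite (germ_diag tens Ht T alpha B F X XX Z Z' DL) by lra.
      rewrite (germ_diag tens Ht T alpha B F X2 XX2 Z2 Z2' DR) by lra.
      unfold dlt. vec.
    - intros a b Hsa Hab Hbt.
      replace (2 * solution_const * p (b - a) ^ 3) with
        (solution_const * p (b - a) ^ 3 + solution_const * p (b - a) ^ 3) by ring.
      apply norm_minus_le; [apply HJ; lra|apply HJ2; lra].
    - intros a u b Hsa Hau Hub Hbt. apply HA; unfold Val; lra. }
  assert (gl : forall t, 0 <= t <= T -> norm (minus (Y t) (Y2 t)) <= sup_const * E).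
  { intros t Htt.
    replace (sup_const * E) with ((2 * gain) ^ m * (E + eps)) by (unfold sup_const, eps; ring).
    unfold gain.
    apply (global_stability F F0 (fun r => r) Val p stab_const (2 / (1 - q)) delta eps Z Z2 ZZ ZZ2
      Y Y2 D D2 HFS HZ Hp Hpm) with (pt := fun j => INR j * delta) (T := T); auto; try lra.
    - intros j Hj. split; auto. split; auto. apply Rmult_le_pos; [apply pos_INR|lra].
    - intros i Hi Hi0. rewrite Hi0, Ey, Ey2. exact Hy. }
  split; auto.
  intros s t Hs Hst HtT Hts.
  assert (Vs : Val s) by (split; lra).
  destruct (window_stability F F0 (fun r => r) Val p stab_const (2 / (1 - q)) delta eps Z Z2 ZZ ZZ2
      Y Y2 D D2 HFS HZ Hp Hpm (proj1 Hd) Hpd1 Hlen J1 J2 DB DD SW ltac:(lra) Hsmall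
      s (sup_const * E) Vs (gl s Vs)) as (_ & L2 & L3).
  assert (Ew : 55 * stab_const ^ 6 * (sup_const * E + eps) = window_const * E)
    by (unfold window_const, gain, eps; ring).
  rewrite Ew in L2, L3.
  assert (Hw : Val t /\ s <= t <= s + delta) by (split; [split; lra|lra]).
  split; [apply L2, Hw|apply L3, Hw].
Qed.

Definition deriv_const : R := K * sup_const * B + K.
Definition field_const : R :=
  K * (2 * B ^ 2) ^ 2 * sup_const + 2 * K * (2 * B ^ 2) * window_const +
  K * (2 * B ^ 2) * sup_const + K * window_const.
Definition rem_const (PT : R) : R :=
  window_const + deriv_const + (2 * sup_const + (deriv_const * B + K * B) * PT) / delta ^ 2.
Definition incr_const : R :=
  field_const * B + K * (2 * B ^ 2) + deriv_const + 2 * deriv_const / delta.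

Lemma stab_consts_ge_0 : 0 <= sup_const /\ 0 <= window_const /\ 0 <= deriv_const /\ 0 <= field_const.
Proof.
  assert (Hq := mo_q Hmo). assert (D0 := driver_const_ge_0).
  assert (G0 : 0 <= germ_const B K) by (apply germ_const_ge_0; lra).
  assert (SC0 : 0 <= solution_const) by (unfold solution_const; nonneg).
  assert (g0 : 0 <= gain) by (unfold gain, stab_const; nonneg).
  assert (s0 : 0 <= sup_const) by (unfold sup_const; nonneg).
  assert (w0 : 0 <= window_const) by (unfold window_const; nonneg).
  unfold deriv_const, field_const. repeat split; nonneg.
Qed.

Lemma field_pair_bound t : 0 <= t <= T -> pair_bound K (K * (sup_const * E)) (F (Y t)) (F (Y2 t)).
Proof.
  intros Htt. apply (sm_F_pair HF). now apply solution_window_stability.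
Qed.

Lemma deriv_pair_bound t : 0 <= t <= T ->
  pair_bound (A := VW) (K * B) (deriv_const * E) (Y' t) (Y2' t).
Proof.
  intros Htt. rewrite (proj2 (proj2 Hsol t Htt)), (proj2 (proj2 Hsol2 t Htt)).
  eapply (pair_bound_le (A := VW)).
  - apply pair_bound_comp; [now apply field_pair_bound|apply (da_Z' HD t Htt)].
  - apply Rle_refl.
  - unfold deriv_const. right; ring.
Qed.

Lemma delta_le_p s t : delta <= t - s -> delta <= p (t - s) /\ delta ^ 2 <= p (t - s) ^ 2.
Proof.
  intros H. assert (L : delta <= p (t - s)).
  { apply Rle_trans with (p delta); [|apply pw_mono; lra].
    assert (delta <= p delta ^ 2) by (apply le_pw_sqr; lra).
    assert (p delta <= 1) by (apply pw_le_1; lra). assert (0 <= p delta) by apply pw_ge_0. nra. }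
  split; auto. apply pow_incr. lra.
Qed.

(** On intervals longer than [delta] the uniform bound on the difference of the
    solutions is enough, at the price of a negative power of [delta]. *)
Lemma remainder_stability PT s t : p T <= PT -> 0 <= s -> s < t -> t <= T ->
  norm (minus (remainder X Y Y' s t) (remainder X2 Y2 Y2' s t)) <=
  rem_const PT * E * p (t - s) ^ 2.
Proof.
  intros HPT Hs Hst HtT.
  destruct solution_window_stability as [gl win].
  destruct stab_consts_ge_0 as (c1 & c2 & c3 & _).
  assert (P2 := pow2_ge_0 (p (t - s))). assert (P0 := pw_ge_0 alpha (t - s)).
  assert (PT0 : 0 <= PT) by (eapply Rle_trans; [apply (pw_ge_0 alpha T)|exact HPT]).
  set (c4 := 2 * sup_const + (deriv_const * B + K * B) * PT).
  assert (c40 : 0 <= c4).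
  { assert (0 <= deriv_const * B) by (apply Rmult_le_pos; lra).
    assert (0 <= (deriv_const * B + K * B) * PT) by (apply Rmult_le_pos; nra). unfold c4; lra. }
  assert (d2 : 0 < delta ^ 2) by (apply pow_lt; lra).
  assert (c5 : 0 <= c4 / delta ^ 2) by (apply Rdiv_le_0_compat; lra).
  unfold rem_const. fold c4.
  destruct (Rle_dec (t - s) delta) as [L|L].
  - assert (Htt : 0 <= s <= T) by lra.
    rewrite (remainder_first_rem F X Z Z' Y Y' s t (proj2 (proj2 Hsol s Htt))).
    rewrite (remainder_first_rem F X2 Z2 Z2' Y2 Y2' s t (proj2 (proj2 Hsol2 s Htt))).
    destruct (pair_bound_app _ _ _ _ _ _ _ _ (field_pair_bound s Htt)
      (da_rem HD s t Hs ltac:(lra) HtT)) as (_ & _ & G).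
    destruct (win s t Hs ltac:(lra) HtT L) as [_ G2].
    apply (norm_le_of_eq _ (plus (minus (first_rem F Z Y s t) (first_rem F Z2 Y2 s t))
      (minus (F (Y s) (remainder X Z Z' s t)) (F (Y2 s) (remainder X2 Z2 Z2' s t))))); [vec|].
    eapply Rle_trans; [apply norm_plus_le; [apply G2|apply G]|].
    assert (0 <= c4 / delta ^ 2 * E * p (t - s) ^ 2) by (apply Rmult_le_pos; auto; apply Rmult_le_pos; auto).
    unfold deriv_const. lra.
  - destruct (pair_bound_app _ _ _ _ _ _ _ _ (deriv_pair_bound s ltac:(lra))
      (da_X HD s t Hs ltac:(lra) HtT)) as (_ & _ & G).
    apply (norm_le_of_eq _ (minus (minus (minus (Y t) (Y2 t)) (minus (Y s) (Y2 s)))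
      (minus (Y' s (incr X s t)) (Y2' s (incr X2 s t))))); [unfold remainder, incr; vec|].
    eapply Rle_trans.
    { apply norm_minus_le; [apply norm_minus_le; apply gl; lra|apply G]. }
    assert (pT : p (t - s) <= PT) by (apply Rle_trans with (p T); [apply pw_mono; lra|auto]).
    assert (G1 : deriv_const * E * (B * p (t - s)) + K * B * (E * p (t - s)) <=
       (deriv_const * B + K * B) * PT * E).
    { replace (deriv_const * E * (B * p (t - s)) + K * B * (E * p (t - s))) with
        ((deriv_const * B + K * B) * p (t - s) * E) by ring.
      apply Rmult_le_compat_r; auto. apply Rmult_le_compat_l; auto.
      assert (0 <= deriv_const * B) by (apply Rmult_le_pos; lra). nra. }
    destruct (delta_le_p s t ltac:(lra)) as [_ D2].
    assert (G2 : c4 * E <= c4 / delta ^ 2 * E * p (t - s) ^ 2).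
    { replace (c4 * E) with (c4 / delta ^ 2 * E * delta ^ 2) by (field; lra).
      apply Rmult_le_compat_l; auto. now apply Rmult_le_pos. }
    assert (0 <= (window_const + deriv_const) * E * p (t - s) ^ 2).
    { apply Rmult_le_pos; auto. apply Rmult_le_pos; lra. }
    unfold c4 in G2 at 1. lra.
Qed.

(** [Y'] is the composition of [F (Y)] with [Z'], and the increment of [F (Y)]
    differs from its linearization by a Taylor remainder, whose difference along
    the two solutions is a four-point bound. *)
Lemma derivative_stability s t : 0 <= s -> s <= t -> t <= T ->
  norm (minus (incr (A := VW) Y' s t) (incr (A := VW) Y2' s t)) <= incr_const * E * p (t - s).
Proof.
  intros Hs Hst HtT.
  destruct solution_window_stability as [gl win].
  destruct stab_consts_ge_0 as (c1 & c2 & c3 & c6).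
  assert (DL := data_pair_left _ _ _ _ _ _ _ _ _ _ _ _ HD).
  assert (DR := data_pair_right _ _ _ _ _ _ _ _ _ _ _ _ HD).
  assert (P0 := pw_ge_0 alpha (t - s)).
  assert (KB2 : 0 <= K * (2 * B ^ 2)).
  { apply Rmult_le_pos; [lra|]. assert (H := pow2_ge_0 B). lra. }
  assert (c5 : 0 <= 2 * deriv_const / delta) by (apply Rdiv_le_0_compat; lra).
  assert (c7 : 0 <= field_const * B) by (apply Rmult_le_pos; lra).
  unfold incr_const.
  assert (Hss : 0 <= s <= T) by lra. assert (Htt : 0 <= t <= T) by lra.
  destruct (Rle_dec (t - s) delta) as [L|L].
  - assert (P1 : p (t - s) <= 1) by (apply pw_le_1; lra).
    set (kp := 2 * B ^ 2) in *.
    assert (kp0 : 0 <= kp) by (unfold kp; assert (H := pow2_ge_0 B); lra).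
    assert (I1 : norm (minus (Y t) (Y s)) <= kp * p (t - s)).
    { apply (controlled_increment_bound alpha B X Y Y'); auto; try lra. apply (ds_X DL); auto. }
    assert (I2 : norm (minus (Y2 t) (Y2 s)) <= kp * p (t - s)).
    { apply (controlled_increment_bound alpha B X2 Y2 Y2'); auto; try lra. apply (ds_X DR); auto. }
    destruct (win s t Hs Hst HtT L) as [I3 _]. unfold dlt in I3.
    assert (I4 := gl s Hss).
    assert (CE : norm (minus (taylor_rem F (Fderive F) (Y s) (Y t)) (taylor_rem F (Fderive F) (Y2 s) (Y2 t)))
      <= (K * kp ^ 2 * sup_const + 2 * K * kp * window_const) * E * p (t - s)).
    { eapply Rle_trans; [apply (sm_rem_four HF)|].
      apply Rle_trans with (K * ((kp ^ 2 * p (t - s)) * (sup_const * E) +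
        (2 * kp) * (window_const * E * p (t - s)))); [|right; ring].
      apply Rmult_le_compat_l; [lra|].
      apply Rplus_le_compat; apply Rmult_le_compat; auto using pow2_ge_0, norm_ge_0.
      - apply Rle_trans with ((kp * p (t - s)) ^ 2).
        + apply pow_incr. split; [apply norm_ge_0|auto].
        + replace ((kp * p (t - s)) ^ 2) with (kp ^ 2 * p (t - s) ^ 2) by ring.
          apply Rmult_le_compat_l; [apply pow2_ge_0|nra].
      - apply Rplus_le_le_0_compat; apply norm_ge_0.
      - assert (kp * p (t - s) <= kp) by nra. lra. }
    assert (CDF := sm_DF_pair HF _ _ _ I4).
    assert (CY : pair_bound (kp * p (t - s)) (window_const * E * p (t - s))
      (minus (Y t) (Y s)) (minus (Y2 t) (Y2 s))) by (split; [|split]; auto).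
    destruct (pair_bound_app _ _ _ _ _ _ _ _ CDF CY) as (_ & _ & G).
    assert (CF : pair_bound (K * kp * p (t - s)) (field_const * E * p (t - s))
      (minus (F (Y t)) (F (Y s))) (minus (F (Y2 t)) (F (Y2 s)))).
    { split; [|split].
      - eapply Rle_trans; [apply (sm_F_lip HF)|]. rewrite Rmult_assoc.
        apply Rmult_le_compat_l; lra.
      - eapply Rle_trans; [apply (sm_F_lip HF)|]. rewrite Rmult_assoc.
        apply Rmult_le_compat_l; lra.
      - apply (norm_le_of_eq (A := lin_NormedModule U W) _ (plus
          (minus (taylor_rem F (Fderive F) (Y s) (Y t)) (taylor_rem F (Fderive F) (Y2 s) (Y2 t)))
          (minus (Fderive F (Y s) (minus (Y t) (Y s))) (Fderive F (Y2 s) (minus (Y2 t) (Y2 s))))));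
          [unfold taylor_rem; vec|].
        eapply Rle_trans; [apply (norm_plus_le (A := lin_NormedModule U W)); [apply CE|apply G]|].
        unfold field_const. fold kp. right; ring. }
    rewrite (derivative_increment F Z' Y Y' s t (proj2 (proj2 Hsol s Hss)) (proj2 (proj2 Hsol t Htt))).
    rewrite (derivative_increment F Z2' Y2 Y2' s t
      (proj2 (proj2 Hsol2 s Hss)) (proj2 (proj2 Hsol2 t Htt))).
    assert (A1 := pair_bound_comp _ _ _ _ _ _ _ _ CF (da_Z' HD t Htt)).
    assert (A2 := pair_bound_comp _ _ _ _ _ _ _ _ (field_pair_bound s Hss)
      (da_Z'_inc HD s t Hs Hst HtT)).
    destruct (pair_bound_plus (A := VW) _ _ _ _ _ _ _ _ A1 A2) as (_ & _ & A3).
    eapply Rle_trans; [apply A3|].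
    assert (0 <= 2 * deriv_const / delta * E * p (t - s)) by (apply Rmult_le_pos; auto; apply Rmult_le_pos; auto).
    unfold deriv_const in *. lra.
  - destruct (deriv_pair_bound s Hss) as (_ & _ & G1). destruct (deriv_pair_bound t Htt) as (_ & _ & G2).
    apply (norm_le_of_eq (A := VW) _ (minus (minus (Y' t) (Y2' t)) (minus (Y' s) (Y2' s))));
      [unfold incr; vec|].
    eapply Rle_trans; [apply (norm_minus_le (A := VW)); [apply G2|apply G1]|].
    destruct (delta_le_p s t ltac:(lra)) as [D1 _].
    assert (G3 : 2 * deriv_const * E <= 2 * deriv_const / delta * E * p (t - s)).
    { replace (2 * deriv_const * E) with (2 * deriv_const / delta * E * delta) by (field; lra).
      apply Rmult_le_compat_l; auto. now apply Rmult_le_pos. }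
    assert (0 <= (field_const * B + K * (2 * B ^ 2) + deriv_const) * E * p (t - s)).
    { apply Rmult_le_pos; auto. apply Rmult_le_pos; lra. }
    lra.
Qed.
End Global.
End SolutionStability.

(** * Constants, existence and the theorem *)

Fixpoint list_max (l : list R) : R :=
  match l with nil => 1 | x :: l => Rmax x (list_max l) end.

Lemma list_max_ge l : 1 <= list_max l /\ forall x, In x l -> x <= list_max l.
Proof.
  induction l as [|y l [IH1 IH2]]; simpl; [split; [lra|tauto]|]. split.
  - eapply Rle_trans; [apply IH1|apply Rmax_r].
  - intros x [<-|H]; [apply Rmax_l|]. eapply Rle_trans; [now apply IH2|apply Rmax_r].
Qed.

Definition nat_above (x : R) : nat := Z.to_nat (up x).

Lemma nat_above_spec x : x <= INR (nat_above x).
Proof.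
  unfold nat_above. destruct (archimed x) as [H _].
  rewrite INR_IZR_INZ. apply Rle_trans with (IZR (up x)); [lra|]. apply IZR_le. lia.
Qed.

Section Spaces.
Context {U V W VV : NormedSpace} (tens : V -> V -> VV).
Hypothesis HV : finite_dim V.
Hypothesis Ht : is_tensor_square tens.
Notation VW := (lin_NormedModule V W).

(** The exponent enters the constants through the sewing constant and the length
    of the windows; for [alpha >= 1/3 + 1/B] the ratio [2 ^ (- 3 / B)] and the
    length given by [pw_small] serve all exponents at once. *)
Lemma stability_uniform B : 1 <= B -> exists G, 0 <= G /\
  forall alpha T E (F : W -> lin U W) (F0 : W -> W) X X2 XX XX2 (Z Z2 : R -> U) (Z' Z2' : R -> lin V U)
    (y y2 : W) (Y Y2 : R -> W) (Y' Y2' : R -> lin V W),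
  1 / 3 + 1 / B <= alpha <= 1 / 2 -> 0 < T <= B ->
  Cb 3 F -> Cb 1 F0 -> Cb_norm 3 F <= B -> Cb_norm 1 F0 <= B ->
  data_pair tens T (B ^ 2) E (pw alpha) X X2 XX XX2 Z Z2 Z' Z2' ->
  is_solution T alpha tens X XX Z Z' F F0 y Y Y' ->
  is_solution T alpha tens X2 XX2 Z2 Z2' F F0 y2 Y2 Y2' ->
  controlled_norm T alpha X Y Y' <= B -> controlled_norm T alpha X2 Y2 Y2' <= B ->
  norm (minus y y2) <= E ->
  (forall t, 0 <= t <= T -> norm (minus (Y t) (Y2 t)) <= G * E) /\
  (forall s t, 0 <= s -> s < t -> t <= T ->
     norm (minus (remainder X Y Y' s t) (remainder X2 Y2 Y2' s t)) <= G * E * pw alpha (t - s) ^ 2) /\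
  (forall s t, 0 <= s -> s <= t -> t <= T ->
     norm (minus (incr (A := VW) Y' s t) (incr (A := VW) Y2' s t)) <= G * E * pw alpha (t - s)).
Proof.
  intros HB. destruct (contract_bound_exists tens HV Ht U W) as [C [HC0 HC]].
  assert (iB : 0 < / B) by (apply Rinv_0_lt_compat; lra).
  set (q := Rpower 2 (- (3 / B))).
  assert (q0 : 0 < q) by apply Rpower_gt_0.
  assert (q1 : q < 1).
  { unfold q. apply Rlt_le_trans with (Rpower 2 0); [apply Rpower_lt; unfold Rdiv; lra|].
    rewrite Rpower_O; lra. }
  set (K := 4 * B ^ 2 + driver_const C (B ^ 2)).
  assert (B2 : B <= B ^ 2) by nra.
  assert (dc0 : 0 <= driver_const C (B ^ 2)).
  { unfold driver_const. apply Rmult_le_pos; [lra|]. apply pow_le; nra. }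
  assert (K0 : 1 <= K) by (unfold K; nra).
  set (c := 120 * (2 / (1 - q)) * stab_const (B ^ 2) q K ^ 6).
  assert (S0 : 0 <= 2 / (1 - q)) by (apply Rdiv_le_0_compat; lra).
  assert (gc0 : 0 <= germ_const (B ^ 2) K) by (apply germ_const_ge_0; nra).
  assert (c0 : 0 <= c) by (unfold c, stab_const, solution_const; nonneg).
  destruct (pw_small (/ (c + 1))) as [delta [Hd Hdp]]; [apply Rinv_0_lt_compat; lra|].
  set (m := S (nat_above (B / delta))).
  assert (Hm : B <= INR m * delta).
  { unfold m. rewrite S_INR. assert (H := nat_above_spec (B / delta)).
    replace B with (B / delta * delta) at 1 by (field; lra). apply Rmult_le_compat_r; lra. }
  set (G1 := sup_const C (B ^ 2) q K m).
  set (G2 := rem_const C (B ^ 2) q K delta m B).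
  set (G3 := incr_const C (B ^ 2) q K delta m).
  exists (Rabs G1 + Rabs G2 + Rabs G3).
  assert (A1 := Rabs_pos G1). assert (A2 := Rabs_pos G2). assert (A3 := Rabs_pos G3).
  assert (L1 := Rle_abs G1). assert (L2 := Rle_abs G2). assert (L3 := Rle_abs G3).
  split; [lra|].
  intros alpha T E F F0 X X2 XX XX2 Z Z2 Z' Z2' y y2 Y Y2 Y' Y2' Ha HT CF CF0 NF NF0 HD Hs Hs2
    NY NY2 Hy.
  assert (Ha' : 1 / 3 < alpha <= 1 / 2) by (unfold Rdiv in *; lra).
  assert (Hmo : modulus (pw alpha) q).
  { apply pw_modulus; [lra| |auto]. unfold sewing_ratio, q. apply Rle_Rpower; [lra|].
    unfold Rdiv in *. lra. }
  assert (HF : smooth K F F0).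
  { apply smooth_mono with (4 * B ^ 2); [now apply smooth_of_Cb|unfold K; lra]. }
  destruct (controlled_norm_bounds T alpha B X Y Y' (proj1 HT) ltac:(lra) (proj1 Hs) NY) as (Y1 & _ & Y3).
  destruct (controlled_norm_bounds T alpha B X2 Y2 Y2' (proj1 HT) ltac:(lra) (proj1 Hs2) NY2) as (Z1 & _ & Z3).
  assert (Y1' : forall s, 0 <= s <= T -> norm (Y' s) <= B ^ 2)
    by (intros s Hss; eapply Rle_trans; [apply (Y1 s Hss)|auto]).
  assert (Z1' : forall s, 0 <= s <= T -> norm (Y2' s) <= B ^ 2)
    by (intros s Hss; eapply Rle_trans; [apply (Z1 s Hss)|auto]).
  assert (Y3' : forall s t, 0 <= s -> s <= t -> t <= T ->
    norm (remainder X Y Y' s t) <= B ^ 2 * pw alpha (t - s) ^ 2).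
  { intros s t H1 H2 H3. eapply Rle_trans; [now apply Y3|].
    apply Rmult_le_compat_r; [apply pow2_ge_0|auto]. }
  assert (Z3' : forall s t, 0 <= s -> s <= t -> t <= T ->
    norm (remainder X2 Y2 Y2' s t) <= B ^ 2 * pw alpha (t - s) ^ 2).
  { intros s t H1 H2 H3. eapply Rle_trans; [now apply Z3|].
    apply Rmult_le_compat_r; [apply pow2_ge_0|auto]. }
  assert (HK : driver_const C (B ^ 2) <= K) by (unfold K; nra).
  assert (Hsmall : 120 * (2 / (1 - q)) * stab_const (B ^ 2) q K ^ 6 * pw alpha delta <= 1).
  { fold c. apply Rle_trans with (c * / (c + 1)).
    - apply Rmult_le_compat_l; auto. apply Hdp; lra.
    - apply Rmult_le_reg_r with (c + 1); [lra|]. rewrite Rmult_assoc, Rinv_l; lra. }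
  assert (HmT : T <= INR m * delta) by lra.
  assert (E0 : 0 <= E) by exact (norm_le_ge_0 _ _ Hy).
  assert (PT : pw alpha T <= B).
  { apply Rle_trans with (pw alpha B); [apply pw_mono; lra|]. apply pw_le_self; lra. }
  assert (up : forall g x y, g <= Rabs G1 + Rabs G2 + Rabs G3 -> 0 <= y -> x <= g * E * y ->
    x <= (Rabs G1 + Rabs G2 + Rabs G3) * E * y).
  { intros g x z Hg Hz Hx. eapply Rle_trans; [apply Hx|].
    apply Rmult_le_compat_r; auto. apply Rmult_le_compat_r; auto. }
  split; [|split].
  - intros t Htt.
    destruct (solution_window_stability tens Ht C T alpha (B ^ 2) q K delta E m F F0 X X2 XX XX2
      Z Z2 Z' Z2' y y2 Y Y2 Y' Y2' HC0 HC (proj1 HT) Ha' Hmo HF HK HD Hs Hs2 Y1' Z1' Y3' Z3' Hy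
      Hd Hsmall HmT) as [H _].
    eapply Rle_trans; [now apply H|]. apply Rmult_le_compat_r; auto. fold G1. lra.
  - intros s t H1 H2 H3. apply (up G2); [lra|apply pow2_ge_0|].
    apply (remainder_stability tens Ht C T alpha (B ^ 2) q K delta E m F F0 X X2 XX XX2
      Z Z2 Z' Z2' y y2 Y Y2 Y' Y2' HC0 HC (proj1 HT) Ha' Hmo HF HK HD Hs Hs2 Y1' Z1' Y3' Z3' Hy
      Hd Hsmall HmT B s t PT H1 H2 H3).
  - intros s t H1 H2 H3. apply (up G3); [lra|apply pw_ge_0|].
    apply (derivative_stability tens Ht C T alpha (B ^ 2) q K delta E m F F0 X X2 XX XX2
      Z Z2 Z' Z2' y y2 Y Y2 Y' Y2' HC0 HC (proj1 HT) Ha' Hmo HF HK HD Hs Hs2 Y1' Z1' Y3' Z3' Hy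
      Hd Hsmall HmT s t H1 H2 H3).
Qed.

Lemma rough_dist_ge_0 T alpha (X : R -> V) (XX : R -> R -> VV) X2 XX2 :
  0 <= rough_dist T alpha X XX X2 XX2.
Proof. eapply Rle_trans; [apply sqrt_pos|apply Rmax_r]. Qed.

Lemma solutions_coincide alpha T (F : W -> lin U W) (F0 : W -> W) X XX (Z : R -> U)
    (Z' : R -> lin V U) y (Y Y2 : R -> W) (Y' Y2' : R -> lin V W) :
  1 / 3 < alpha <= 1 / 2 -> 0 < T -> Cb 3 F -> Cb 1 F0 ->
  rough_path T alpha tens X XX -> controlled T alpha X Z Z' ->
  is_solution T alpha tens X XX Z Z' F F0 y Y Y' ->
  is_solution T alpha tens X XX Z Z' F F0 y Y2 Y2' ->
  forall t, 0 <= t <= T -> Y2 t = Y t /\ Y2' t = Y' t.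
Proof.
  intros Ha HT CF CF0 HX HZ Hs Hs2.
  set (l := T :: / (alpha - 1 / 3) :: Cb_norm 3 F :: Cb_norm 1 F0 :: rough_norm T alpha X XX ::
    controlled_norm T alpha X Z Z' :: controlled_norm T alpha X Y Y' ::
    controlled_norm T alpha X Y2 Y2' :: nil).
  destruct (list_max_ge l) as [B1 HB]. set (B := list_max l) in *.
  assert (in0 : forall n, (n < 8)%nat -> nth n l 0 <= B) by (intros n Hn; apply HB, nth_In; exact Hn).
  assert (DS := data_size_of_norms tens Ht T alpha B X XX Z Z' HT ltac:(lra) B1 HX HZ
    (in0 4%nat ltac:(lia)) (in0 5%nat ltac:(lia))).
  assert (B2 : 1 <= B ^ 2) by nra.
  assert (DP := data_pair_refl tens T (B ^ 2) (pw alpha) X XX Z Z' B2 DS).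
  destruct (stability_uniform B B1) as [G [_ HG]].
  assert (HaB : 1 / 3 + 1 / B <= alpha <= 1 / 2).
  { split; [|lra]. assert (H := in0 1%nat ltac:(lia)). simpl in H.
    assert (P : 0 < alpha - 1 / 3) by lra.
    assert (/ B <= alpha - 1 / 3).
    { rewrite <- (Rinv_inv (alpha - 1 / 3)). apply Rinv_le_contravar; auto.
      now apply Rinv_0_lt_compat. }
    unfold Rdiv in *. lra. }
  destruct (HG alpha T 0 F F0 X X XX XX Z Z Z' Z' y y Y Y2 Y' Y2' HaB) as [H _]; auto.
  - split; auto. apply (in0 0%nat); lia.
  - apply (in0 2%nat); lia.
  - apply (in0 3%nat); lia.
  - apply (in0 6%nat); lia.
  - apply (in0 7%nat); lia.
  - rewrite norm_minus_diag; lra.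
  - intros t Htt.
    assert (E : Y t = Y2 t) by (apply minus_zero_iff; generalize (H t Htt); lra).
    split; auto. rewrite (proj2 (proj2 Hs t Htt)), (proj2 (proj2 Hs2 t Htt)). now rewrite E.
Qed.

Lemma controlled_dist_le alpha T X X2 (Y Y2 : R -> W) (Y' Y2' : R -> lin V W) c :
  0 < T ->
  (forall s t, 0 <= s -> s < t -> t <= T ->
     norm (minus (remainder X Y Y' s t) (remainder X2 Y2 Y2' s t)) <= c * pw alpha (t - s) ^ 2) ->
  (forall s t, 0 <= s -> s <= t -> t <= T ->
     norm (minus (incr (A := VW) Y' s t) (incr (A := VW) Y2' s t)) <= c * pw alpha (t - s)) ->
  Rbar_le (controlled_dist T alpha X Y Y' X2 Y2 Y2') (2 * c).
Proof.
  intros HT H1 H2. unfold controlled_dist.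
  destruct (hoelder2_le T alpha HT (fun s t => minus (remainder X Y Y' s t) (remainder X2 Y2 Y2' s t)) c)
    as [L1 F1]; auto.
  destruct (hoelder_le (A := VW) T alpha HT (fun t => minus (Y' t) (Y2' t)) c) as [L2 F2].
  { intros s t Hs Hst HtT.
    apply (norm_le_of_eq (A := VW) _ (minus (incr (A := VW) Y' s t) (incr (A := VW) Y2' s t)));
      [unfold incr; vec|]. now apply H2. }
  change (@hoelder T alpha VW (fun t => minus (Y' t) (Y2' t))) with
    (hoelder T alpha (fun t => minus (Y' t) (Y2' t))) in *.
  rewrite <- F1, <- F2 in *. simpl in *. lra.
Qed.

Lemma controlled_dist_ge_0 {A : NormedSpace} alpha T X X2 (Y Y2 : R -> A) (Y' Y2' : R -> lin V A) :
  0 < T -> 0 <= real (controlled_dist T alpha X Y Y' X2 Y2 Y2').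
Proof.
  intros HT. unfold controlled_dist.
  assert (pos : forall (S : R -> Prop) x, 0 <= x -> S x -> Rbar_le 0 (Lub_Rbar S)).
  { intros S x Hx Sx. apply Rbar_le_trans with (Finite x); [exact Hx|]. now apply Lub_Rbar_correct. }
  assert (quot : forall (x r : R), 0 <= x -> 0 <= x / Rpower T r)
    by (intros; apply Rdiv_le_0_compat; auto; apply Rpower_gt_0).
  assert (H1 : Rbar_le 0 (hoelder2 T (2 * alpha)
    (fun s t => minus (remainder X Y Y' s t) (remainder X2 Y2 Y2' s t)))).
  { apply (pos _ (norm (minus (remainder X Y Y' 0 T) (remainder X2 Y2 Y2' 0 T)) /
      Rpower T (2 * alpha))); [apply quot, norm_ge_0|]. exists 0, T.
    rewrite Rminus_0_r, Rabs_right by lra. repeat split; lra. }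
  assert (H2 : Rbar_le 0 (hoelder (A := lin_NormedModule V A) T alpha (fun t => minus (Y' t) (Y2' t)))).
  { apply (pos _ (norm (incr (A := lin_NormedModule V A) (fun t => minus (Y' t) (Y2' t)) 0 T) /
      Rpower T alpha)); [apply quot, norm_ge_0|]. exists 0, T.
    rewrite Rminus_0_r, Rabs_right by lra. repeat split; lra. }
  revert H1 H2. generalize (hoelder2 T (2 * alpha)
    (fun s t => minus (remainder X Y Y' s t) (remainder X2 Y2 Y2' s t))).
  change (hoelder T alpha (fun t => minus (Y' t) (Y2' t))) with
    (hoelder (A := lin_NormedModule V A) T alpha (fun t => minus (Y' t) (Y2' t))).
  generalize (hoelder (A := lin_NormedModule V A) T alpha (fun t => minus (Y' t) (Y2' t))).
  intros [r2| |] [r1| |] H1 H2; simpl in *; try tauto; lra.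
Qed.

(** The bound ranges over natural numbers so that [G] can be chosen as a function
    of it before any of the data. *)
Lemma distance_uniform n : exists G, 0 <= G /\
  forall alpha T (F : W -> lin U W) (F0 : W -> W) X X2 XX XX2 (Z Z2 : R -> U) (Z' Z2' : R -> lin V U)
    (y y2 : W) (Y Y2 : R -> W) (Y' Y2' : R -> lin V W) d,
  let B := INR n + 1 in
  1 / 3 + 1 / B <= alpha <= 1 / 2 -> 0 < T <= B ->
  Cb 3 F -> Cb 1 F0 -> Cb_norm 3 F <= B -> Cb_norm 1 F0 <= B ->
  rough_path T alpha tens X XX -> rough_path T alpha tens X2 XX2 ->
  controlled T alpha X Z Z' -> controlled T alpha X2 Z2 Z2' ->
  is_solution T alpha tens X XX Z Z' F F0 y Y Y' ->
  is_solution T alpha tens X2 XX2 Z2 Z2' F F0 y2 Y2 Y2' ->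
  controlled_norm T alpha X Y Y' <= B -> controlled_norm T alpha X2 Y2 Y2' <= B ->
  controlled_norm T alpha X Z Z' <= B -> controlled_norm T alpha X2 Z2 Z2' <= B ->
  rough_norm T alpha X XX <= B -> rough_norm T alpha X2 XX2 <= B ->
  real (controlled_dist T alpha X Z Z' X2 Z2 Z2') <= d ->
  rough_dist T alpha X XX X2 XX2 <= d ->
  norm (minus y y2) <= d ->
  norm (minus (Z' 0) (Z2' 0)) <= d ->
  Rbar_le (controlled_dist T alpha X Y Y' X2 Y2 Y2') (G * d).
Proof.
  set (B := INR n + 1).
  assert (B1 : 1 <= B) by (unfold B; generalize (pos_INR n); lra).
  destruct (stability_uniform B B1) as [G [G0 HG]].
  exists (2 * (G * (2 * B))). split; [apply Rmult_le_pos; [lra|apply Rmult_le_pos; lra]|].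
  intros alpha T F F0 X X2 XX XX2 Z Z2 Z' Z2' y y2 Y Y2 Y' Y2' d B' Ha HT CF CF0 NF NF0 HX HX2 HZ HZ2
    Hs Hs2 NY NY2 NZ NZ2 NX NX2 D1 D2 D3 D4.
  assert (iB : 0 < / B) by (apply Rinv_0_lt_compat; lra).
  assert (Ha' : 0 <= alpha <= 1).
  { change (1 / 3 + 1 / B <= alpha <= 1 / 2) in Ha. unfold Rdiv in Ha. lra. }
  assert (DP := data_pair_of_norms tens Ht T alpha B d X XX X2 XX2 Z Z2 Z' Z2' HT Ha' B1 HX HX2 HZ HZ2
    NX NX2 NZ NZ2 D1 D2 D4).
  assert (d0 : 0 <= d) by exact (norm_le_ge_0 _ _ D3).
  assert (Hy : norm (minus y y2) <= 2 * B * d) by nra.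
  destruct (HG alpha T (2 * B * d) F F0 X X2 XX XX2 Z Z2 Z' Z2' y y2 Y Y2 Y' Y2' Ha HT CF CF0 NF NF0
    DP Hs Hs2 NY NY2 Hy) as (_ & H2 & H3).
  replace (2 * (G * (2 * B)) * d) with (2 * (G * (2 * B * d))) by ring.
  apply controlled_dist_le; [lra|exact H2|exact H3].
Qed.
End Spaces.

Lemma solution_exists {U V : NormedSpace} {W : BanachSpace} {VV : NormedSpace} (tens : V -> V -> VV)
    alpha T (F : W -> lin U W) (F0 : W -> W) X XX (Z : R -> U) (Z' : R -> lin V U) (y0 : W) :
  finite_dim V -> is_tensor_square tens ->
  1 / 3 < alpha <= 1 / 2 -> 0 < T -> Cb 3 F -> Cb 1 F0 ->
  rough_path T alpha tens X XX -> controlled T alpha X Z Z' ->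
  exists (Y : R -> W) (Y' : R -> lin V W), is_solution T alpha tens X XX Z Z' F F0 y0 Y Y'.
Proof.
  intros HV Ht Ha HT CF CF0 HX HZ.
  destruct (contract_bound_exists tens HV Ht U W) as [C [HC0 HC]].
  set (l := Cb_norm 3 F :: Cb_norm 1 F0 :: rough_norm T alpha X XX ::
    controlled_norm T alpha X Z Z' :: nil).
  destruct (list_max_ge l) as [B1 HB]. set (B := list_max l) in *.
  assert (in0 : forall n, (n < 4)%nat -> nth n l 0 <= B) by (intros n Hn; apply HB, nth_In; exact Hn).
  assert (DS := data_size_of_norms tens Ht T alpha B X XX Z Z' HT ltac:(lra) B1 HX HZ
    (in0 2%nat ltac:(lia)) (in0 3%nat ltac:(lia))).
  assert (B2 : 1 <= B ^ 2) by nra.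
  set (K := 4 * B ^ 2 + driver_const C (B ^ 2)).
  assert (dc0 : 0 <= driver_const C (B ^ 2)).
  { unfold driver_const. apply Rmult_le_pos; [lra|]. apply pow_le; nra. }
  assert (HK : driver_const C (B ^ 2) <= K) by (unfold K; lra).
  assert (HF : smooth (W := W) K F F0).
  { apply smooth_mono with (4 * B ^ 2); [|unfold K; lra].
    apply smooth_of_Cb; auto; [apply (in0 0%nat); lia|apply (in0 1%nat); lia]. }
  assert (K1 := sm_K HF).
  assert (HD := rough_driver_of_data (W := W) tens Ht C T alpha (B ^ 2) K X XX Z Z' HC0 HC B2 Ha DS HK).
  set (q := sewing_ratio alpha).
  assert (q1 : q < 1) by (apply sewing_ratio_lt_1; lra).
  assert (L0 := davie_const_ge_0 F F0 K alpha HF Ha). fold q in L0.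
  assert (ka := kappa_ge_0 F F0 K HF).
  set (c := davie_const K q + 120 * (2 / (1 - q)) * K2 K alpha ^ 6).
  assert (c1 : 0 <= 120 * (2 / (1 - q)) * K2 K alpha ^ 6) by (unfold K2; fold q; nonneg).
  assert (c0 : 0 <= c) by (unfold c; lra).
  destruct (pw_small (/ (c + 1))) as [d0 [Hd0 Hdp]]; [apply Rinv_0_lt_compat; lra|].
  set (N := S (nat_above (T / d0))).
  assert (PN : 0 < INR N) by (apply lt_0_INR; unfold N; lia).
  set (delta := T / INR N).
  assert (HN : INR N * delta = T) by (unfold delta; field; lra).
  assert (Hdpos : 0 < delta) by (apply Rdiv_lt_0_compat; lra).
  assert (Hdd : delta <= d0).
  { apply Rmult_le_reg_l with (INR N); auto. rewrite HN.
    replace T with (T / d0 * d0) by (field; lra). apply Rmult_le_compat_r; [lra|].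
    eapply Rle_trans; [apply nat_above_spec|]. apply le_INR. unfold N; lia. }
  assert (Hd : 0 < delta <= 1) by lra.
  assert (Hpd : pw alpha delta <= / (c + 1)).
  { apply Rle_trans with (pw alpha d0); [apply pw_mono; lra|apply Hdp; lra]. }
  assert (P0 := pw_ge_0 alpha delta).
  assert (Hcp : c * pw alpha delta <= 1).
  { apply Rle_trans with (c * / (c + 1)); [now apply Rmult_le_compat_l|].
    apply Rmult_le_reg_r with (c + 1); [lra|]. rewrite Rmult_assoc, Rinv_l; lra. }
  assert (HdL : davie_const K q * pw alpha delta <= 1).
  { eapply Rle_trans; [|apply Hcp]. apply Rmult_le_compat_r; auto. unfold c; lra. }
  assert (HdS : 120 * (2 / (1 - q)) * K2 K alpha ^ 6 * pw alpha delta <= 1).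
  { eapply Rle_trans; [|apply Hcp]. apply Rmult_le_compat_r; auto. unfold c; lra. }
  destruct (euler_path F F0 Z (second_order tens XX Z') T K alpha y0 HD HF Ha HT
    (fun u c r => geometric_limit u c r) delta N HN Hd HdL HdS) as [Y [HY0 HY]].
  assert (HR := euler_path_davie F F0 Z (second_order tens XX Z') T K alpha y0 HD HF Ha HT
    delta N Hd HdL Y HY).
  set (LL := 8 * (davie_const K (sewing_ratio alpha) + K * kappa_const K)) in *.
  assert (LL0 : 0 <= LL).
  { assert (0 <= K * kappa_const K) by (apply Rmult_le_pos; lra). unfold LL. fold q. lra. }
  assert (Hd2 : 0 < delta / 2 <= 1) by lra.
  exists Y, (fun t => lin_comp (F (Y t)) (Z' t)).
  apply (solution_of_davie tens Ht C T alpha (B ^ 2) K F F0 X XX Z Z' HC0 HC B2 HT Ha DS HF HK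
    y0 Y (delta / 2) LL Hd2 LL0 HY0 HR).
  apply (drift_exists F0 K T alpha (delta / 2) (LL + K + 2 * K ^ 2) Y); try lra.
  - assert (0 <= K ^ 2) by apply pow2_ge_0. lra.
  - apply (sm_F0_lip HF).
  - intros s t H1 H2 H3 H4.
    apply (davie_increments tens Ht C T alpha (B ^ 2) K F F0 X XX Z Z' HC0 HC B2 Ha DS HF HK
      Y (delta / 2) LL Hd2 LL0 HR s t H1 H2 H3 H4).
Qed.

Theorem theorem3p10 :
  forall (U V W : BanachSpace) (VV : NormedSpace) (tens : V -> V -> VV),
  finite_dim U -> finite_dim V -> finite_dim W -> is_tensor_square tens ->
  (forall (alpha T : R) (F : W -> lin U W) (F0 : W -> W)
     (X : R -> V) (XX : R -> R -> VV) (Z : R -> U) (Z' : R -> lin V U),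
   1 / 3 < alpha <= 1 / 2 -> 0 < T ->
   Cb 3 F -> Cb 1 F0 ->
   rough_path T alpha tens X XX ->
   controlled T alpha X Z Z' ->
   forall y0 : W,
   exists (Y : R -> W) (Y' : R -> lin V W),
     is_solution T alpha tens X XX Z Z' F F0 y0 Y Y' /\
     forall (Y2 : R -> W) (Y2' : R -> lin V W),
       is_solution T alpha tens X XX Z Z' F F0 y0 Y2 Y2' ->
       forall t, 0 <= t <= T -> Y2 t = Y t /\ Y2' t = Y' t)
  /\
  (exists (C : R -> R)
     (M : R -> R -> R -> R -> R -> R -> R -> R -> R -> R -> R -> R -> R -> R),
   (forall a1 a2 a3 a4 a5 a6 a7 a8 a9 a10 a11 a12 a13,
      0 <= M a1 a2 a3 a4 a5 a6 a7 a8 a9 a10 a11 a12 a13) /\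
   forall (alpha T : R) (F : W -> lin U W) (F0 : W -> W)
     (X X2 : R -> V) (XX XX2 : R -> R -> VV)
     (Z Z2 : R -> U) (Z' Z2' : R -> lin V U)
     (y0 y02 : W) (Y Y2 : R -> W) (Y' Y2' : R -> lin V W),
   1 / 3 < alpha <= 1 / 2 -> 0 < T ->
   Cb 3 F -> Cb 1 F0 ->
   rough_path T alpha tens X XX -> rough_path T alpha tens X2 XX2 ->
   controlled T alpha X Z Z' -> controlled T alpha X2 Z2 Z2' ->
   is_solution T alpha tens X XX Z Z' F F0 y0 Y Y' ->
   is_solution T alpha tens X2 XX2 Z2 Z2' F F0 y02 Y2 Y2' ->
   Rbar_le
     (controlled_dist T alpha X Y Y' X2 Y2 Y2')
     (Finite
       (C alpha *
        M T (Cb_norm 3 F) (Cb_norm 1 F0)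
          (norm (Y' 0)) (norm (Y2' 0)) (norm (Z' 0)) (norm (Z2' 0))
          (controlled_norm T alpha X Y Y') (controlled_norm T alpha X2 Y2 Y2')
          (controlled_norm T alpha X Z Z') (controlled_norm T alpha X2 Z2 Z2')
          (rough_norm T alpha X XX) (rough_norm T alpha X2 XX2) *
        (real (controlled_dist T alpha X Z Z' X2 Z2 Z2')
         + rough_dist T alpha X XX X2 XX2
         + norm (minus y0 y02)
         + norm (minus (Y' 0) (Y2' 0))
         + norm (minus (Z 0) (Z2 0))
         + norm (minus (Z' 0) (Z2' 0)))))).
Proof.
  intros U V W VV tens HU HV HW Ht. split.
  - intros alpha T F F0 X XX Z Z' Ha HT CF CF0 HX HZ y0.
    destruct (solution_exists tens alpha T F F0 X XX Z Z' y0 HV Ht Ha HT CF CF0 HX HZ)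
      as (Y & Y' & Hs).
    exists Y, Y'. split; auto. intros Y2 Y2' Hs2.
    apply (solutions_coincide tens HV Ht alpha T F F0 X XX Z Z' y0 Y Y2 Y' Y2'); auto.
  - destruct (choice_function _ (distance_uniform (U := U) (V := V) (W := W) tens HV Ht)) as [G HG].
    exists (fun alpha => 1 + G (nat_above (/ (alpha - 1 / 3)))).
    exists (fun a1 a2 a3 a4 a5 a6 a7 a8 a9 a10 a11 a12 a13 => 1 + G (nat_above (list_max
      (a1 :: a2 :: a3 :: a4 :: a5 :: a6 :: a7 :: a8 :: a9 :: a10 :: a11 :: a12 :: a13 :: nil)))).
    assert (G0 : forall n, 0 <= G n) by (intros n; apply (HG n)).
    split; [intros; specialize (G0 (nat_above (list_max
      (a1 :: a2 :: a3 :: a4 :: a5 :: a6 :: a7 :: a8 :: a9 :: a10 :: a11 :: a12 :: a13 :: nil)))); lra|].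
    intros alpha T F F0 X X2 XX XX2 Z Z2 Z' Z2' y0 y02 Y Y2 Y' Y2' Ha HT CF CF0 HX HX2 HZ HZ2 Hs Hs2.
    set (l := T :: Cb_norm 3 F :: Cb_norm 1 F0 :: _).
    set (d := real (controlled_dist T alpha X Z Z' X2 Z2 Z2') + _ + _ + _ + _ + _).
    destruct (list_max_ge l) as [_ Hl].
    set (n1 := nat_above (/ (alpha - 1 / 3))). set (n2 := nat_above (list_max l)).
    set (n := Nat.max n1 n2).
    assert (N1 := nat_above_spec (/ (alpha - 1 / 3))). fold n1 in N1.
    assert (N2 := nat_above_spec (list_max l)). fold n2 in N2.
    assert (N1' : INR n1 <= INR n) by (apply le_INR; unfold n; lia).
    assert (N2' : INR n2 <= INR n) by (apply le_INR; unfold n; lia).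
    assert (in0 : forall k, (k < 13)%nat -> nth k l 0 <= INR n + 1).
    { intros k Hk. assert (nth k l 0 <= list_max l) by (apply Hl, nth_In; exact Hk). lra. }
    assert (HaB : 1 / 3 + 1 / (INR n + 1) <= alpha <= 1 / 2).
    { split; [|lra]. assert (P : 0 < alpha - 1 / 3) by lra.
      assert (/ (INR n + 1) <= alpha - 1 / 3).
      { rewrite <- (Rinv_inv (alpha - 1 / 3)). apply Rinv_le_contravar; [|lra].
        now apply Rinv_0_lt_compat. }
      unfold Rdiv in *. lra. }
    assert (d1 := controlled_dist_ge_0 (V := V) (A := U) alpha T X X2 Z Z2 Z' Z2' HT).
    assert (d2 := rough_dist_ge_0 T alpha X XX X2 XX2).
    assert (d3 : 0 <= norm (minus y0 y02)) by apply norm_ge_0.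
    assert (d4 := norm_ge_0 (V := lin_NormedModule V W) (minus (Y' 0) (Y2' 0))).
    assert (d5 : 0 <= norm (minus (Z 0) (Z2 0))) by apply norm_ge_0.
    assert (d6 := norm_ge_0 (V := lin_NormedModule V U) (minus (Z' 0) (Z2' 0))).
    eapply Rbar_le_trans.
    { apply (proj2 (HG n) alpha T F F0 X X2 XX XX2 Z Z2 Z' Z2' y0 y02 Y Y2 Y' Y2' d); auto;
        try (unfold d; clear - d1 d2 d3 d4 d5 d6; lra).
      - split; auto. apply (in0 0%nat); lia.
      - apply (in0 1%nat); lia.
      - apply (in0 2%nat); lia.
      - apply (in0 7%nat); lia.
      - apply (in0 8%nat); lia.
      - apply (in0 9%nat); lia.
      - apply (in0 10%nat); lia.
      - apply (in0 11%nat); lia.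
      - apply (in0 12%nat); lia.
      - assert (L : norm (minus y0 y02) <= d)
          by (unfold d; clear - d1 d2 d3 d4 d5 d6; lra). exact L. }
    assert (d0 : 0 <= d) by (unfold d; clear - d1 d2 d3 d4 d5 d6; lra).
    (* this splits a constant depending on [alpha] and the norms together: [n] is
       one of [n1], [n2], and the other factor is at least one *)
    assert (Gn : G n <= (1 + G n1) * (1 + G n2)).
    { assert (g1 := G0 n1). assert (g2 := G0 n2).
      unfold n. destruct (Nat.max_dec n1 n2) as [->| ->]; nra. }
    simpl. apply Rmult_le_compat_r; auto.
Qed.
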